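(* Let $R$ be a commutative ring. There is an equivalence of categories $$\mathrm{Mack}^R_{\mathrm{dfl}}(\mathbb S)\simeq \mathcal F_{\mathcal B,R}$$ between the category of deflative $R$-linear Mackey functors on the 2-category $\mathbb S$ and the category of $R$-linear biset functors.
   Context: All groups, sets with group action and bisets are finite; rings are commutative with unit. 2-categories are strict. $e$ denotes the unit of a group. **The 2-category $\mathbb S$.** A 0-cell is a pair $\frac XG$ of a finite group $G$ and a finite left $G$-set $X$. A 1-cell $\alpha=\frac{\alpha}{\theta_\alpha}\colon \frac XG\to\frac YH$ is a map $\alpha\colon X\to Y$ together with a family $\theta_\alpha=\{\theta_{\alpha,x}\colon G\to H\}_{x\in X}$ of maps such that $\alpha(gx)=\theta_{\alpha,x}(g)\alpha(x)$ and $\theta_{\alpha,x}(gg')=\theta_{\alpha,g'x}(g)\,\theta_{\alpha,x}(g')$ for all $x\in X$, $g,g'\in G$. The composite $\beta\circ\alpha$ is the composite of maps with $\theta_{\beta\circ\alpha,x}=\theta_{\beta,\alpha(x)}\circ\theta_{\alpha,x}$; the identity has $\theta_x=\mathrm{id}_G$. A 2-cell $\varepsilon\colon\alpha\Rightarrow\alpha'$ between 1-cells $\alpha,\alpha'\colon\frac XG\to\frac YH$ is a map $X\to H$, $x\mapsto\varepsilon_x$, with $\alpha'(x)=\varepsilon_x\alpha(x)$ and $\varepsilon_{gx}\theta_{\alpha,x}(g)\varepsilon_x^{-1}=\theta_{\alpha',x}(g)$. Vertical composition: $(\varepsilon'\cdot\varepsilon)_x=\varepsilon'_x\varepsilon_x$;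 all 2-cells are invertible. Whiskering: $(\beta\circ\varepsilon)_x=\theta_{\beta,\alpha(x)}(\varepsilon_x)$ and $(\delta\circ\alpha)_x=\delta_{\alpha(x)}$. All objects $\frac{\emptyset}{G}$ are isomorphic and initial, denoted $\emptyset$. **Bicoproducts.** In a 2-category $\mathbb C$ with invertible 2-cells, a bicoproduct of $A_1,A_2$ is a 0-cell $A_1\amalg A_2$ with 1-cells $\iota_i\colon A_i\to A_1\amalg A_2$ such that for every 0-cell $X$ the functor $(-\circ\iota_1,-\circ\iota_2)\colon\mathbb C(A_1\amalg A_2,X)\to\mathbb C(A_1,X)\times\mathbb C(A_2,X)$ is an equivalence of categories. These exist in $\mathbb S$. **Bipullbacks.** A bipullback of $f_i\colon A_i\to B$ ($i=1,2$) is a 0-cell $P$ with 1-cells $\pi_i\colon P\to A_i$ and a 2-cell $\kappa\colon f_1\circ\pi_1\Rightarrow f_2\circ\pi_2$ such that: (i) for any 1-cells $g_i\colon X\to A_i$ and 2-cell $\varepsilon\colon f_1\circ g_1\Rightarrow f_2\circ g_2$ there are a 1-cell $g\colon X\to P$ and 2-cells $\xi_i\colon\pi_i\circ g\Rightarrow g_i$ with $\varepsilon\cdot(f_1\circ\xi_1)=(f_2\circ\xi_2)\cdot(\kappa\circ g)$; (ii) for any two such triples $(g,\xi_1,\xi_2)$, $(g',\xi_1',\xi_2')$ there is a unique 2-cell $\zeta\colon g\Rightarrow g'$ with $\xi'_i\cdot(\pi_i\circ\zeta)=\xi_i$ ($i=1,2$). These exist in $\mathbb S$. **Mackey functors on $\mathbb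 S$.** $R\mathrm{Mod}$ is viewed as a 2-category with only identity 2-cells, so a 2-functor $\mathbb S\to R\mathrm{Mod}$ is a functor on 0- and 1-cells which takes equal values on any two 1-cells connected by a 2-cell. An $R$-linear Mackey functor $M=(M^*,M_* )$ on $\mathbb S$ is a pair of a contravariant 2-functor $M^*\colon\mathbb S\to R\mathrm{Mod}$ and a covariant 2-functor $M_*\colon\mathbb S\to R\mathrm{Mod}$ such that: (0) $M^*(\frac XG)=M_*(\frac XG)=:M(\frac XG)$ for every 0-cell; (1) for any bicoproduct $\frac XG\xrightarrow{\upsilon_X}\frac XG\amalg\frac YH\xleftarrow{\upsilon_Y}\frac YH$ the map $(M^*(\upsilon_X),M^*(\upsilon_Y))\colon M(\frac XG\amalg\frac YH)\to M(\frac XG)\times M(\frac YH)$ is an isomorphism, and $M(\emptyset)=0$; (2) for any bipullback with $\gamma\colon\frac WL\to\frac XG$, $\delta\colon\frac WL\to\frac YH$ of $\alpha\colon\frac XG\to\frac ZK$ and $\beta\colon\frac YH\to\frac ZK$, one has $M^*(\alpha)\circ M_*(\beta)=M_*(\gamma)\circ M^*(\delta)$. A morphism $\varphi\colon M\to N$ is a family of $R$-homomorphisms $\varphi_{\frac XG}\colon M(\frac XG)\to N(\frac XG)$ natural with respect to both $M^*,N^*$ and $M_*,N_*$. **Stab-surjective, deflative.** A 1-cell $\alpha\colon\frac XG\to\frac YH$ is stab-surjective if (i) every $y\in Y$ is of the form $h\alpha(x)$ with $x\in X,h\in H$; (ii) whenever $h\alpha(x)=h'\alpha(x')$ ($x,x'\in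 X$, $h,h'\in H$) there is $g\in G$ with $x'=gx$ and $h=h'\theta_{\alpha,x}(g)$. $M$ is deflative if $M_*(\alpha)\circ M^*(\alpha)=\mathrm{id}_{M(\frac YH)}$ for every stab-surjective 1-cell $\alpha\colon\frac XG\to\frac YH$. $\mathrm{Mack}^R_{\mathrm{dfl}}(\mathbb S)$ is the full subcategory of deflative $R$-linear Mackey functors. **Biset functors.** The category $\mathcal B_R$ has finite groups as objects. For groups $G,H$, a finite $H$-$G$-biset is a finite set with commuting left $H$- and right $G$-actions; $\mathcal B(G,H)$ is the Grothendieck group of the monoid of isomorphism classes of finite $H$-$G$-bisets under disjoint union, and $\mathcal B_R(G,H)=\mathcal B(G,H)\otimes R$ is the set of morphisms $G\to H$. Composition is the $R$-bilinear extension of $({}_KV_H,{}_HU_G)\mapsto V\times_HU=(V\times U)/\sim$, where $(vh,u)\sim(v,hu)$. $\mathcal F_{\mathcal B,R}$ is the category of $R$-linear functors $\mathcal B_R\to R\mathrm{Mod}$ with natural transformations. *)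

(* Defs.v *)
From HB Require Import structures.
From mathcomp Require Import all_boot all_algebra all_fingroup.
From mathcomp Require Import boolp functions generic_quotient.

Set Implicit Arguments.
Unset Strict Implicit.
Unset Printing Implicit Defensive.

Import GRing.Theory.
#[local] Obligation Tactic := idtac.

Record category := Category {
  obj :> Type;
  hom : obj -> obj -> Type;
  idm : forall X, hom X X;
  compm : forall X Y Z, hom Y Z -> hom X Y -> hom X Z;
  compmA : forall W X Y Z (h : hom Y Z) (g : hom X Y) (f : hom W X),
    compm h (compm g f) = compm (compm h g) f;
  comp1m : forall X Y (f : hom X Y), compm (idm Y) f = f;
  compm1 : forall X Y (f : hom X Y), compm f (idm X) = f }.
Arguments hom {c} X Y.
Arguments idm {c} X.
Arguments compm {c X Y Z} g f.

Record functor (C D : category) := Functor {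
  fobj :> C -> D;
  fmap : forall X Y, hom X Y -> hom (fobj X) (fobj Y);
  fmap1 : forall X, fmap (idm X) = idm (fobj X);
  fmapM : forall X Y Z (g : hom Y Z) (f : hom X Y),
    fmap (compm g f) = compm (fmap g) (fmap f) }.
Arguments fmap {C D} f {X Y} _ : rename.

Definition functor_id (C : category) : functor C C :=
  @Functor C C id (fun _ _ f => f) (fun _ => erefl) (fun _ _ _ _ _ => erefl).

Program Definition functor_comp (C D E : category)
    (G : functor D E) (F : functor C D) : functor C E :=
  @Functor C E (fun X => G (F X)) (fun _ _ f => fmap G (fmap F f)) _ _.
Next Obligation. by move=> *; rewrite /= !fmap1. Qed.
Next Obligation. by move=> *; rewrite /= !fmapM. Qed.

Record nattrans (C D : category) (F G : functor C D) := NatTrans {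
  ncomp :> forall X, hom (F X) (G X);
  ncomp_nat : forall X Y (f : hom X Y),
    compm (fmap G f) (ncomp X) = compm (ncomp Y) (fmap F f) }.

Lemma nattransP (C D : category) (F G : functor C D) (s t : nattrans F G) :
  (forall X, s X = t X) -> s = t.
Proof.
case: s t => [s sP] [t tP] /= st.
have E : s = t by exact: functional_extensionality_dep.
by subst t; congr NatTrans; exact: Prop_irrelevance.
Qed.

Program Definition nattrans_id (C D : category) (F : functor C D) :
  nattrans F F := @NatTrans C D F F (fun X => idm (F X)) _.
Next Obligation. by move=> *; rewrite /= comp1m compm1. Qed.

Program Definition nattrans_comp (C D : category) (F G H : functor C D)
    (t : nattrans G H) (s : nattrans F G) : nattrans F H :=
  @NatTrans C D F H (fun X => compm (t X) (s X)) _.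
Next Obligation.
by move=> *; rewrite /= compmA ncomp_nat -compmA ncomp_nat compmA.
Qed.

Definition is_iso (C : category) (X Y : C) (f : hom X Y) :=
  exists g : hom Y X, compm g f = idm X /\ compm f g = idm Y.

Definition nat_isomorphic (C D : category) (F G : functor C D) :=
  exists t : nattrans F G, forall X, is_iso (t X).

Definition is_equivalence (C D : category) (F : functor C D) :=
  exists G : functor D C,
    nat_isomorphic (functor_comp G F) (functor_id C) /\
    nat_isomorphic (functor_comp F G) (functor_id D).

Definition equivalent (C D : category) :=
  exists F : functor C D, is_equivalence F.

Program Definition functor_cat (C D : category) : category :=
  @Category (functor C D) (@nattrans C D) (@nattrans_id C D)
    (@nattrans_comp C D) _ _ _.
Next Obligation. by move=> *; apply: nattransP => ? /=; rewrite compmA. Qed.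
Next Obligation. by move=> *; apply: nattransP => ? /=; rewrite comp1m. Qed.
Next Obligation. by move=> *; apply: nattransP => ? /=; rewrite compm1. Qed.

Definition full_sub (C : category) (P : C -> Prop) : category :=
  @Category {X : C | P X} (fun X Y => hom (sval X) (sval Y))
    (fun X => idm (sval X)) (fun _ _ _ g f => compm g f)
    (fun _ _ _ _ h g f => compmA h g f) (fun _ _ f => comp1m f)
    (fun _ _ f => compm1 f).

Program Definition prod_cat (C D : category) : category :=
  @Category (C * D)%type (fun X Y => (hom X.1 Y.1 * hom X.2 Y.2)%type)
    (fun X => (idm X.1, idm X.2))
    (fun _ _ _ g f => (compm g.1 f.1, compm g.2 f.2)) _ _ _.
Next Obligation. by move=> *; rewrite /= !compmA. Qed.
Next Obligation. by move=> C D [? ?] [? ?] [? ?]; rewrite /= !comp1m. Qed.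
Next Obligation. by move=> C D [? ?] [? ?] [? ?]; rewrite /= !compm1. Qed.

Program Definition functor_pair (C D E : category)
    (F : functor C D) (G : functor C E) : functor C (prod_cat D E) :=
  @Functor C (prod_cat D E) (fun X => (F X, G X))
    (fun _ _ f => (fmap F f, fmap G f)) _ _.
Next Obligation. by move=> *; rewrite /= !fmap1. Qed.
Next Obligation. by move=> *; rewrite /= !fmapM. Qed.

Section ModuleCategory.
Variable R : comPzRingType.
Implicit Types M N P : lmodType R.

Lemma linear_ext M N (f g : {linear M -> N}) : f =1 g -> f = g.
Proof.
case: f g => f cf [g cg] /= /funext fg; subst g; congr GRing.Linear.Pack.
case: cf cg => [[a1] [b1]] [[a2] [b2]].
congr GRing.Linear.Class; last by congr GRing.isScalable.Axioms_.
congr Algebra.isNmodMorphism.Axioms_; exact: Prop_irrelevance.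
Qed.

Definition linear_id M : {linear M -> M} := idfun.
Definition linear_comp M N P (g : {linear N -> P}) (f : {linear M -> N}) :
  {linear M -> P} := g \o f.

Program Definition module_cat : category :=
  @Category (lmodType R) (fun M N => {linear M -> N}) linear_id linear_comp
    _ _ _.
Next Obligation. by move=> *; exact: linear_ext. Qed.
Next Obligation. by move=> *; exact: linear_ext. Qed.
Next Obligation. by move=> *; exact: linear_ext. Qed.
End ModuleCategory.

(* Left actions; the actions of mathcomp's action.v are right actions. *)
Record gset (G : finGroupType) := GSet {
  gcar :> finType;
  gact : G -> gcar -> gcar;
  gact1 : forall x, gact 1%g x = x;
  gactM : forall g h x, gact (g * h)%g x = gact g (gact h x) }.

Record cell0 := Cell0 { cgrp : finGroupType; cset : gset cgrp }.

Record cell1 (A B : cell0) := Cell1 {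
  cmap :> cset A -> cset B;
  ctheta : cset A -> cgrp A -> cgrp B;
  cmapE : forall x g, cmap (gact g x) = gact (ctheta x g) (cmap x);
  cthetaM : forall x g g',
    ctheta x (g * g')%g = (ctheta (gact g' x) g * ctheta x g')%g }.

(* The type of 2-cells depends only on the underlying maps of the two 1-cells,
   so that the strict identities between composites of 1-cells hold by
   conversion in the types of 2-cells. *)
Record cell2_on (A B : cell0) (f f' : cset A -> cset B)
    (t t' : cset A -> cgrp A -> cgrp B) := Cell2 {
  tmap :> cset A -> cgrp B;
  tmapE : forall x, f' x = gact (tmap x) (f x);
  tmap_theta : forall x g,
    (tmap (gact g x) * t x g * (tmap x)^-1)%g = t' x g }.

Definition cell2 (A B : cell0) (a a' : cell1 A B) :=
  cell2_on a a' (ctheta a) (ctheta a').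

Lemma cell1_ext (A B : cell0) (a b : cell1 A B) :
  a =1 b -> (forall x, ctheta a x =1 ctheta b x) -> a = b.
Proof.
case: a b => f t p q [f' t' p' q'] /= /funext E E'; subst f'.
have Et : t = t' by apply: funext => x; apply: funext => g; exact: E'.
by subst t'; congr Cell1; apply: Prop_irrelevance.
Qed.

Lemma cell2_ext (A B : cell0) (a b : cell1 A B) (e e' : cell2 a b) :
  e =1 e' -> e = e'.
Proof.
case: e e' => f p q [f' p' q'] /= /funext E; subst f'.
by congr Cell2; exact: Prop_irrelevance.
Qed.

Definition cell1_id (A : cell0) : cell1 A A :=
  @Cell1 A A id (fun _ g => g) (fun _ _ => erefl) (fun _ _ _ => erefl).

Program Definition cell1_comp (A B C : cell0) (b : cell1 B C) (a : cell1 A B) :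
    cell1 A C :=
  @Cell1 A C (fun x => b (a x)) (fun x g => ctheta b (a x) (ctheta a x g)) _ _.
Next Obligation. by move=> *; rewrite /= !cmapE. Qed.
Next Obligation. by move=> * /=; rewrite cthetaM cthetaM -cmapE. Qed.

Program Definition cell2_id (A B : cell0) (a : cell1 A B) : cell2 a a :=
  @Cell2 A B a a (ctheta a) (ctheta a) (fun=> 1%g) _ _.
Next Obligation. by move=> *; rewrite /= gact1. Qed.
Next Obligation. by move=> *; rewrite /= mul1g invg1 mulg1. Qed.

Program Definition vcomp (A B : cell0) (a b c : cell1 A B)
    (e' : cell2 b c) (e : cell2 a b) : cell2 a c :=
  @Cell2 A B a c (ctheta a) (ctheta c) (fun x => e' x * e x)%g _ _.
Next Obligation.
by move=> A B a b c e' e x; rewrite /= (tmapE e') (tmapE e) gactM.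
Qed.
Next Obligation.
by move=> A B a b c e' e x g; rewrite /= -(tmap_theta e') -(tmap_theta e)
  invMg !mulgA.
Qed.

Program Definition whiskerl (A B C : cell0) (b : cell1 B C) (a a' : cell1 A B)
    (e : cell2 a a') : cell2 (cell1_comp b a) (cell1_comp b a') :=
  @Cell2 A C (cell1_comp b a) (cell1_comp b a') (ctheta (cell1_comp b a))
    (ctheta (cell1_comp b a')) (fun x => ctheta b (a x) (e x)) _ _.
Next Obligation. by move=> A B C b a a' e x; rewrite /= (tmapE e) cmapE. Qed.
Next Obligation.
move=> A B C b a a' e x g /=; apply: (mulIg (ctheta b (a x) (e x))).
rewrite mulgKV.
rewrite (tmapE e) -cthetaM -(tmap_theta e) mulgKV cthetaM.
by rewrite cmapE.
Qed.

Program Definition whiskerr (A B C : cell0) (b b' : cell1 B C)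
    (d : cell2 b b') (a : cell1 A B) :
    cell2 (cell1_comp b a) (cell1_comp b' a) :=
  @Cell2 A C (cell1_comp b a) (cell1_comp b' a) (ctheta (cell1_comp b a))
    (ctheta (cell1_comp b' a)) (fun x => d (a x)) _ _.
Next Obligation. by move=> A B C b b' d a x; exact: (tmapE d). Qed.
Next Obligation.
by move=> A B C b b' d a x g; rewrite /= cmapE (tmap_theta d).
Qed.

Program Definition hom_cat (A B : cell0) : category :=
  @Category (cell1 A B) (@cell2 A B) (@cell2_id A B) (@vcomp A B) _ _ _.
Next Obligation. by move=> *; apply: cell2_ext => x /=; rewrite mulgA. Qed.
Next Obligation. by move=> *; apply: cell2_ext => x /=; rewrite mul1g. Qed.
Next Obligation. by move=> *; apply: cell2_ext => x /=; rewrite mulg1. Qed.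

Program Definition precomp (A B C : cell0) (i : cell1 A B) :
    functor (hom_cat B C) (hom_cat A C) :=
  @Functor (hom_cat B C) (hom_cat A C) (fun b => cell1_comp b i)
    (fun _ _ d => whiskerr d i) _ _.
Next Obligation. by move=> *; exact: cell2_ext. Qed.
Next Obligation. by move=> *; exact: cell2_ext. Qed.

Definition is_bicoproduct (A1 A2 P : cell0) (i1 : cell1 A1 P)
    (i2 : cell1 A2 P) :=
  forall X : cell0, is_equivalence (functor_pair (precomp X i1) (precomp X i2)).

Definition is_bipullback (A1 A2 B P : cell0) (f1 : cell1 A1 B)
    (f2 : cell1 A2 B) (p1 : cell1 P A1) (p2 : cell1 P A2)
    (k : cell2 (cell1_comp f1 p1) (cell1_comp f2 p2)) :=
  let is_triple (X : cell0) (g1 : cell1 X A1) (g2 : cell1 X A2)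
      (e : cell2 (cell1_comp f1 g1) (cell1_comp f2 g2)) (g : cell1 X P)
      (x1 : cell2 (cell1_comp p1 g) g1) (x2 : cell2 (cell1_comp p2 g) g2) :=
    vcomp e (whiskerl f1 x1) =
    @vcomp X B (cell1_comp f1 (cell1_comp p1 g))
      (cell1_comp f2 (cell1_comp p2 g)) (cell1_comp f2 g2)
      (whiskerl f2 x2) (whiskerr k g) in
  forall (X : cell0) (g1 : cell1 X A1) (g2 : cell1 X A2)
    (e : cell2 (cell1_comp f1 g1) (cell1_comp f2 g2)),
  (exists g x1 x2, is_triple X g1 g2 e g x1 x2) /\
  (forall g x1 x2 g' x1' x2', is_triple X g1 g2 e g x1 x2 ->
     is_triple X g1 g2 e g' x1' x2' ->
   exists! z : cell2 g g',
     vcomp x1' (whiskerl p1 z) = x1 /\ vcomp x2' (whiskerl p2 z) = x2).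

Definition stab_surjective (A B : cell0) (a : cell1 A B) :=
  (forall y : cset B, exists x h, y = gact h (a x)) /\
  (forall (x x' : cset A) (h h' : cgrp B), gact h (a x) = gact h' (a x') ->
   exists g, x' = gact g x /\ h = (h' * ctheta a x g)%g).

Section Mackey.
Variable R : comPzRingType.

(* [pull] and [push] are the contravariant and the covariant part; they share
   their values on 0-cells. *)
Record mackey := Mackey {
  mval :> cell0 -> lmodType R;
  pull : forall A B, cell1 A B -> {linear mval B -> mval A};
  push : forall A B, cell1 A B -> {linear mval A -> mval B};
  pull_id : forall A m, pull (cell1_id A) m = m;
  push_id : forall A m, push (cell1_id A) m = m;
  pull_comp : forall A B C (b : cell1 B C) (a : cell1 A B) m,
    pull (cell1_comp b a) m = pull a (pull b m);
  push_comp : forall A B C (b : cell1 B C) (a : cell1 A B) m,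
    push (cell1_comp b a) m = push b (push a m);
  pull_cell2 : forall A B (a a' : cell1 A B), cell2 a a' -> pull a = pull a';
  push_cell2 : forall A B (a a' : cell1 A B), cell2 a a' -> push a = push a';
  mackey_bicoproduct : forall A1 A2 P (i1 : cell1 A1 P) (i2 : cell1 A2 P),
    is_bicoproduct i1 i2 -> bijective (fun m => (pull i1 m, pull i2 m));
  mackey_empty : forall A, #|cset A| = 0%N -> forall m : mval A, m = 0%R;
  mackey_bipullback : forall X Y Z W (a : cell1 X Z) (b : cell1 Y Z)
      (c : cell1 W X) (d : cell1 W Y)
      (k : cell2 (cell1_comp a c) (cell1_comp b d)),
    is_bipullback k -> forall m, pull a (push b m) = push c (pull d m) }.

Record mackey_hom (M N : mackey) := MackeyHom {
  mhom :> forall A, {linear M A -> N A};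
  mhom_pull : forall A B (a : cell1 A B) m,
    mhom A (pull M a m) = pull N a (mhom B m);
  mhom_push : forall A B (a : cell1 A B) m,
    mhom B (push M a m) = push N a (mhom A m) }.

Lemma mackey_hom_ext (M N : mackey) (f g : mackey_hom M N) :
  (forall A, f A =1 g A) -> f = g.
Proof.
case: f g => [f p q] [g p' q'] /= E.
have {}E : f = g.
  apply: functional_extensionality_dep => A.
  by apply: linear_ext => x; exact: E.
by subst g; congr MackeyHom; apply: Prop_irrelevance.
Qed.

Program Definition mackey_hom_id (M : mackey) : mackey_hom M M :=
  @MackeyHom M M (fun A => linear_id (M A)) _ _.
Next Obligation. by []. Qed.
Next Obligation. by []. Qed.

Program Definition mackey_hom_comp (M N P : mackey) (g : mackey_hom N P)
    (f : mackey_hom M N) : mackey_hom M P :=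
  @MackeyHom M P (fun A => linear_comp (g A) (f A)) _ _.
Next Obligation. by move=> *; rewrite /= !mhom_pull. Qed.
Next Obligation. by move=> *; rewrite /= !mhom_push. Qed.

Program Definition mackey_cat : category :=
  @Category mackey mackey_hom mackey_hom_id mackey_hom_comp _ _ _.
Next Obligation. by move=> *; exact: mackey_hom_ext. Qed.
Next Obligation. by move=> *; exact: mackey_hom_ext. Qed.
Next Obligation. by move=> *; exact: mackey_hom_ext. Qed.

Definition deflative (M : mackey) :=
  forall A B (a : cell1 A B), stab_surjective a ->
  forall m, push M a (pull M a m) = m.

Definition deflative_mackey_cat : category :=
  @full_sub mackey_cat deflative.
End Mackey.

Local Open Scope quotient_scope.

Record biset_on (H G : finGroupType) (T : Type) := BisetOn {
  lact : H -> T -> T;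
  ract : T -> G -> T;
  lact1 : forall x, lact 1%g x = x;
  lactM : forall h h' x, lact (h * h')%g x = lact h (lact h' x);
  ract1 : forall x, ract x 1%g = x;
  ractM : forall x g g', ract x (g * g')%g = ract (ract x g) g';
  lractC : forall h x g, lact h (ract x g) = ract (lact h x) g }.

Record biset (H G : finGroupType) := Biset {
  bcar :> finType;
  bstr :> biset_on H G bcar }.

Section Bisets.
Variables H G : finGroupType.
Implicit Types U V W : biset H G.

Definition biset_iso U V := exists f : U -> V,
  [/\ bijective f, forall h x, f (lact U h x) = lact V h (f x) &
      forall x g, f (ract U x g) = ract V (f x) g].

Lemma biset_iso_refl U : biset_iso U U.
Proof. by exists id; split=> //; exists id. Qed.

Lemma biset_iso_sym U V : biset_iso U V -> biset_iso V U.
Proof.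
case=> f [[f' fK f'K] fl fr]; exists f'; split; first by exists f.
  by move=> h x; apply: (can_inj fK); rewrite fl !f'K.
by move=> x g; apply: (can_inj fK); rewrite fr !f'K.
Qed.

Lemma biset_iso_trans U V W :
  biset_iso U V -> biset_iso V W -> biset_iso U W.
Proof.
case=> f [bf fl fr] [g [bg gl gr]]; exists (g \o f).
split; first exact: bij_comp.
  by move=> h x /=; rewrite fl gl.
by move=> x k /=; rewrite fr gr.
Qed.

Program Definition biset_transport (T T' : Type) (f : T -> T') (f' : T' -> T)
    (fK : cancel f f') (f'K : cancel f' f) (s : biset_on H G T) :
    biset_on H G T' :=
  @BisetOn H G T' (fun h x => f (lact s h (f' x)))
    (fun x g => f (ract s (f' x) g)) _ _ _ _ _.
Next Obligation. by move=> * /=; rewrite lact1. Qed.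
Next Obligation. by move=> T T' f f' fK * /=; rewrite fK lactM. Qed.
Next Obligation. by move=> * /=; rewrite ract1. Qed.
Next Obligation. by move=> T T' f f' fK * /=; rewrite fK ractM. Qed.
Next Obligation. by move=> T T' f f' fK * /=; rewrite !fK lractC. Qed.

Program Definition biset_empty : biset H G :=
  @Biset H G void (@BisetOn H G void (fun _ x => x) (fun x _ => x) _ _ _ _ _).
Next Obligation. by []. Qed.
Next Obligation. by []. Qed.
Next Obligation. by []. Qed.
Next Obligation. by []. Qed.
Next Obligation. by []. Qed.

Program Definition biset_sum U V : biset H G :=
  @Biset H G (U + V)%type (@BisetOn H G (U + V)%type
    (fun h x => match x with
                | inl u => inl (lact U h u) | inr v => inr (lact V h v) end)
    (fun x g => match x with
                | inl u => inl (ract U u g) | inr v => inr (ract V v g) end)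
    _ _ _ _ _).
Next Obligation. by move=> U V [] * /=; rewrite lact1. Qed.
Next Obligation. by move=> U V h h' [] * /=; rewrite lactM. Qed.
Next Obligation. by move=> U V [] * /=; rewrite ract1. Qed.
Next Obligation. by move=> U V [] * /=; rewrite ractM. Qed.
Next Obligation. by move=> U V h [] * /=; rewrite lractC. Qed.

(* The type of bisets on arbitrary carriers is too large to be quotiented into
   an nmodType, so isomorphism classes are formed from the bisets carried by
   some 'I_n, which represent all finite bisets. [biset_class] below sends any
   biset to its class; [biset_classP] and [class_reprK] say that it is constant
   exactly on isomorphism classes and surjective. *)
Definition skel_biset : Type := {classic {n : nat & biset_on H G 'I_n}}.
HB.instance Definition _ := Choice.on skel_biset.

Definition skel_val (s : skel_biset) : biset H G :=
  @Biset H G 'I_(projT1 s) (projT2 s).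

Definition skel_of U : skel_biset :=
  existT (fun n => biset_on H G 'I_n) #|U|
    (biset_transport (@enum_rankK U) (@enum_valK U) (bstr U)).

Definition skel_eq (s t : skel_biset) :=
  `[< biset_iso (skel_val s) (skel_val t) >].

Lemma skel_ofK U : biset_iso (skel_val (skel_of U)) U.
Proof.
exists enum_val; split.
- by exists enum_rank; [exact: enum_valK|exact: enum_rankK].
- by move=> h x /=; rewrite enum_rankK.
- by move=> x g /=; rewrite enum_rankK.
Qed.

Lemma skel_eq_refl : reflexive skel_eq.
Proof. by move=> s; apply/asboolP; exact: biset_iso_refl. Qed.

Lemma skel_eq_sym : symmetric skel_eq.
Proof. by move=> s t; apply/asboolP/asboolP; exact: biset_iso_sym. Qed.

Lemma skel_eq_trans : transitive skel_eq.
Proof.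
move=> t s u /asboolP st /asboolP tu; apply/asboolP.
exact: biset_iso_trans tu.
Qed.

Canonical skel_equiv :=
  EquivRel skel_eq skel_eq_refl skel_eq_sym skel_eq_trans.

Definition biset_classes := {eq_quot skel_equiv}.
HB.instance Definition _ := Choice.on biset_classes.

Definition biset_class U : biset_classes :=
  \pi_{eq_quot skel_equiv} (skel_of U).
Definition class_repr (c : biset_classes) : biset H G := skel_val (repr c).

Lemma biset_classP U V : biset_class U = biset_class V <-> biset_iso U V.
Proof.
split=> [/eqmodP /asboolP UV|UV].
  apply: (biset_iso_trans (biset_iso_sym (skel_ofK U))).
  exact: biset_iso_trans UV (skel_ofK V).
apply/eqmodP/asboolP; apply: (biset_iso_trans (skel_ofK U)).
exact: biset_iso_trans UV (biset_iso_sym (skel_ofK V)).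
Qed.

Lemma class_reprK c : biset_class (class_repr c) = c.
Proof.
by rewrite -[RHS]reprK; apply/eqmodP/asboolP; exact: skel_ofK.
Qed.

Lemma biset_class_repr U : biset_iso (class_repr (biset_class U)) U.
Proof. by apply/biset_classP; exact: class_reprK. Qed.

Definition class_add (c d : biset_classes) :=
  biset_class (biset_sum (class_repr c) (class_repr d)).

Lemma biset_sum_iso U U' V V' : biset_iso U U' -> biset_iso V V' ->
  biset_iso (biset_sum U V) (biset_sum U' V').
Proof.
case=> f [[f' fK f'K] fl fr] [g [[g' gK g'K] gl gr]].
exists (fun x => match x with inl u => inl (f u) | inr v => inr (g v) end).
split; last by case=> x k /=; rewrite ?fr ?gr.
  exists (fun x => match x with inl u => inl (f' u) | inr v => inr (g' v) end).
    by case=> x; rewrite ?fK ?gK.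
  by case=> x; rewrite ?f'K ?g'K.
by move=> h [] x /=; rewrite ?fl ?gl.
Qed.

Lemma class_addE U V :
  class_add (biset_class U) (biset_class V) = biset_class (biset_sum U V).
Proof.
by apply/biset_classP; apply: biset_sum_iso; exact: biset_class_repr.
Qed.

Lemma class_addA : associative class_add.
Proof.
move=> c d e; rewrite -[c]class_reprK -[d]class_reprK -[e]class_reprK.
rewrite !class_addE; apply/biset_classP.
exists (fun x => match x with inl u => inl (inl u)
  | inr (inl u) => inl (inr u) | inr (inr u) => inr u end).
split; [|by move=> h [|[]]|by move=> [|[]]].
by exists (fun x => match x with inl (inl u) => inl u
  | inl (inr u) => inr (inl u) | inr u => inr (inr u) end);
  [move=> [|[]]|move=> [[]|]].
Qed.

Lemma class_addC : commutative class_add.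
Proof.
move=> c d; rewrite -[c]class_reprK -[d]class_reprK.
rewrite !class_addE; apply/biset_classP.
exists (fun x => match x with inl u => inr u | inr u => inl u end).
split; [|by move=> h []|by move=> []].
by exists (fun x => match x with inl u => inr u | inr u => inl u end); case.
Qed.

Lemma class_add0 : left_id (biset_class biset_empty) class_add.
Proof.
move=> c; rewrite -[c]class_reprK.
rewrite !class_addE; apply/biset_classP.
exists (fun x => match x with inl u => of_void _ u | inr u => u end).
split; [|by move=> h []|by move=> []].
by exists inr => [[]|].
Qed.

HB.instance Definition _ :=
  GRing.isNmodule.Build biset_classes class_addA class_addC class_add0.
End Bisets.

Section BisetProduct.
Variables (K H G : finGroupType) (V : biset K H) (U : biset H G).

(* Relates (v h, u) to (v, h u); this is already an equivalence relation. *)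
Definition prod_rel (p q : V * U) :=
  [exists h : H, (p.1 == ract V q.1 h) && (q.2 == lact U h p.2)].

Lemma prod_rel_refl : reflexive prod_rel.
Proof.
by move=> p; apply/existsP; exists 1%g; rewrite ract1 lact1 !eqxx.
Qed.

Lemma prod_rel_symW p q : prod_rel p q -> prod_rel q p.
Proof.
case/existsP=> h /andP[/eqP p1 /eqP q2]; apply/existsP; exists h^-1%g.
by rewrite p1 q2 -ractM -lactM mulgV mulVg ract1 lact1 !eqxx.
Qed.

Lemma prod_rel_sym : symmetric prod_rel.
Proof. by move=> p q; apply/idP/idP; exact: prod_rel_symW. Qed.

Lemma prod_rel_trans : transitive prod_rel.
Proof.
move=> q p r /existsP[h /andP[/eqP p1 /eqP q2]]
  /existsP[h' /andP[/eqP q1 /eqP r2]].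
by apply/existsP; exists (h' * h)%g; rewrite p1 r2 q2 q1 ractM lactM !eqxx.
Qed.

Canonical prod_equiv :=
  EquivRel prod_rel prod_rel_refl prod_rel_sym prod_rel_trans.

Definition prod_car := {eq_quot prod_equiv}.
HB.instance Definition _ := Choice.on prod_car.
HB.instance Definition _ : isCountable prod_car :=
  CanIsCountable (reprK : cancel repr \pi_{eq_quot prod_equiv}).
HB.instance Definition _ : isFinite prod_car :=
  CanIsFinite (reprK : cancel repr \pi_{eq_quot prod_equiv}).

Definition prod_pi (v : V) (u : U) : prod_car :=
  \pi_{eq_quot prod_equiv} (v, u).

Lemma prod_piP v u v' u' : prod_pi v u = prod_pi v' u' <->
  exists h, v = ract V v' h /\ u' = lact U h u.
Proof.
split=> [/eqmodP /existsP[h /andP[/eqP ? /eqP ?]]|[h [E E']]].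
  by exists h.
apply/eqmodP/existsP; exists h; apply/andP; split; exact/eqP.
Qed.

Lemma prod_pi_bal v h u : prod_pi (ract V v h) u = prod_pi v (lact U h u).
Proof. by apply/prod_piP; exists h. Qed.

Lemma prod_carP (q : prod_car) : exists v u, q = prod_pi v u.
Proof.
exists (repr q).1, (repr q).2.
by rewrite /prod_pi -surjective_pairing [RHS]reprK.
Qed.

Definition prod_lift (T : Type) (f : V -> U -> T) (q : prod_car) : T :=
  f (repr q).1 (repr q).2.

Lemma prod_liftE (T : Type) (f : V -> U -> T) v u :
  (forall v h u, f (ract V v h) u = f v (lact U h u)) ->
  prod_lift f (prod_pi v u) = f v u.
Proof.
move=> fb; rewrite /prod_lift.
have : prod_pi (repr (prod_pi v u)).1 (repr (prod_pi v u)).2 = prod_pi v u.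
  by rewrite {1}/prod_pi -surjective_pairing [LHS]reprK.
move: (repr _).1 (repr _).2 => v' u' /prod_piP[h [-> ->]].
by rewrite fb.
Qed.

Definition prod_lact k := prod_lift (fun v u => prod_pi (lact V k v) u).
Definition prod_ract q g := prod_lift (fun v u => prod_pi v (ract U u g)) q.

Lemma prod_lactE k v u : prod_lact k (prod_pi v u) = prod_pi (lact V k v) u.
Proof. by apply: prod_liftE => ? ? ?; rewrite lractC prod_pi_bal. Qed.

Lemma prod_ractE v u g : prod_ract (prod_pi v u) g = prod_pi v (ract U u g).
Proof. by apply: prod_liftE => ? ? ?; rewrite prod_pi_bal lractC. Qed.

Program Definition biset_prod : biset K G :=
  @Biset K G prod_car (@BisetOn K G prod_car prod_lact prod_ract _ _ _ _ _).
Next Obligation.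
by move=> q; have [v [u ->]] := prod_carP q; rewrite !prod_lactE lact1.
Qed.
Next Obligation.
by move=> k k' q; have [v [u ->]] := prod_carP q; rewrite !prod_lactE lactM.
Qed.
Next Obligation.
by move=> q; have [v [u ->]] := prod_carP q; rewrite !prod_ractE ract1.
Qed.
Next Obligation.
by move=> q g g'; have [v [u ->]] := prod_carP q; rewrite !prod_ractE ractM.
Qed.
Next Obligation.
move=> k q g; have [v [u ->]] := prod_carP q.
by rewrite !(prod_lactE, prod_ractE).
Qed.
End BisetProduct.

Program Definition biset_id (G : finGroupType) : biset G G :=
  @Biset G G G (@BisetOn G G G (fun h x => (h * x)%g) (fun x g => (x * g)%g)
    (@mul1g G) _ (@mulg1 G) _ _).
Next Obligation. by move=> G h h' x /=; rewrite mulgA. Qed.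
Next Obligation. by move=> G x g g' /=; rewrite mulgA. Qed.
Next Obligation. by move=> G h x g /=; rewrite mulgA. Qed.

Lemma biset_isoW (H G : finGroupType) (U W : biset H G) (f : U -> W) :
  injective f -> (forall w, exists u, f u = w) ->
  (forall h x, f (lact U h x) = lact W h (f x)) ->
  (forall x g, f (ract U x g) = ract W (f x) g) -> biset_iso U W.
Proof.
move=> fi fs fl fr; exists f; split=> //; have [g gK] := choice fs.
by exists g => // x; apply: fi.
Qed.

Lemma biset_prod_isoW (K H G : finGroupType) (V : biset K H) (U : biset H G)
    (W : biset K G) (f : V -> U -> W) :
  (forall v h u, f (ract V v h) u = f v (lact U h u)) ->
  (forall k v u, f (lact V k v) u = lact W k (f v u)) ->
  (forall v u g, f v (ract U u g) = ract W (f v u) g) ->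
  (forall w, exists v u, f v u = w) ->
  (forall v u v' u', f v u = f v' u' -> prod_pi v u = prod_pi v' u') ->
  biset_iso (biset_prod V U) W.
Proof.
move=> fb fl fr fs fi.
apply: (@biset_isoW _ _ (biset_prod V U) W (prod_lift f)).
- move=> p q; have [v [u ->]] := prod_carP p; have [v' [u' ->]] := prod_carP q.
  by rewrite !prod_liftE //; exact: fi.
- move=> w; have [v [u <-]] := fs w; exists (prod_pi v u).
  by rewrite prod_liftE.
- move=> k p; have [v [u ->]] := prod_carP p.
  by rewrite [lact _ _ _]prod_lactE !prod_liftE.
- move=> p g; have [v [u ->]] := prod_carP p.
  by rewrite [ract _ _ _]prod_ractE !prod_liftE.
Qed.

Lemma biset_prod_iso (K H G : finGroupType) (V V' : biset K H)
    (U U' : biset H G) : biset_iso V V' -> biset_iso U U' ->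
  biset_iso (biset_prod V U) (biset_prod V' U').
Proof.
case=> f [[f' fK f'K] fl fr] [g [[g' gK g'K] gl gr]].
apply: (biset_prod_isoW (W := biset_prod V' U')
  (f := fun v u => prod_pi (f v) (g u))).
- by move=> v h u; rewrite fr gl prod_pi_bal.
- by move=> k v u; rewrite fl [RHS]prod_lactE.
- by move=> v u k; rewrite gr [RHS]prod_ractE.
- move=> w; have [v [u ->]] := prod_carP w; exists (f' v), (g' u).
  by rewrite f'K g'K.
- move=> v u v' u' /prod_piP[h [E1 E2]]; apply/prod_piP; exists h; split.
    by apply: (can_inj fK); rewrite fr.
  by apply: (can_inj gK); rewrite gl.
Qed.

Lemma biset_prodA (L K H G : finGroupType) (W : biset L K) (V : biset K H)
    (U : biset H G) :
  biset_iso (biset_prod W (biset_prod V U)) (biset_prod (biset_prod W V) U).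
Proof.
pose f (w : W) (q : biset_prod V U) : biset_prod (biset_prod W V) U :=
  prod_lift (fun v u => prod_pi (V := biset_prod W V) (prod_pi w v) u) q.
have fE w v u : f w (prod_pi v u) =
    prod_pi (V := biset_prod W V) (prod_pi w v) u.
  apply: prod_liftE => {}v h {}u; rewrite -prod_ractE.
  exact: (prod_pi_bal (V := biset_prod W V)).
apply: (biset_prod_isoW (f := f)).
- move=> w k q; have [v [u ->]] := prod_carP q.
  by rewrite [lact (biset_prod V U) _ _]prod_lactE !fE prod_pi_bal.
- move=> l w q; have [v [u ->]] := prod_carP q.
  by rewrite !fE [RHS]prod_lactE [lact (biset_prod W V) _ _]prod_lactE.
- move=> w q g; have [v [u ->]] := prod_carP q.
  by rewrite [ract (biset_prod V U) _ _]prod_ractE !fE [RHS]prod_ractE.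
- move=> q; have [p [u ->]] := prod_carP q; have [w [v ->]] := prod_carP p.
  by exists w, (prod_pi v u).
- move=> w q w' q'; have [v [u ->]] := prod_carP q.
  have [v' [u' ->]] := prod_carP q'; rewrite !fE => /prod_piP[h [+ ->]].
  rewrite [ract (biset_prod W V) _ _]prod_ractE => /prod_piP[k [-> E]].
  by rewrite prod_pi_bal [lact (biset_prod V U) _ _]prod_lactE -E prod_pi_bal.
Qed.

Lemma biset_prod1l (H G : finGroupType) (U : biset H G) :
  biset_iso (biset_prod (biset_id H) U) U.
Proof.
apply: (biset_prod_isoW (V := biset_id H) (f := fun h u => lact U h u)).
- by move=> v h u; rewrite -lactM.
- by move=> k v u; rewrite -lactM.
- by move=> v u g; rewrite lractC.
- by move=> u; exists 1%g, u; rewrite lact1.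
- move=> v u v' u' E; apply/prod_piP; exists (v'^-1 * v)%g.
  by rewrite /= mulKVg lactM E -lactM mulVg lact1.
Qed.

Lemma biset_prod1r (H G : finGroupType) (U : biset H G) :
  biset_iso (biset_prod U (biset_id G)) U.
Proof.
apply: (biset_prod_isoW (U := biset_id G) (f := fun u g => ract U u g)).
- by move=> v h u; rewrite -ractM.
- by move=> k v u; rewrite lractC.
- by move=> v u g; rewrite -ractM.
- by move=> u; exists u, 1%g; rewrite ract1.
- move=> v u v' u' E; apply/prod_piP; exists (u' * u^-1)%g.
  by rewrite /= mulgKV ractM -E -ractM mulgV ract1.
Qed.

Lemma biset_prod0l (K H G : finGroupType) (U : biset H G) :
  biset_iso (biset_prod (biset_empty K H) U) (biset_empty K G).
Proof.
by apply: (biset_prod_isoW (V := biset_empty K H) (W := biset_empty K G)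
  (f := fun v _ => v)) => // [[]|[]].
Qed.

Lemma biset_prod0r (K H G : finGroupType) (V : biset K H) :
  biset_iso (biset_prod V (biset_empty H G)) (biset_empty K G).
Proof.
by apply: (biset_prod_isoW (U := biset_empty H G) (W := biset_empty K G)
  (f := fun _ v => v)) => // [[]|? []].
Qed.

Lemma biset_prodDl (K H G : finGroupType) (V V' : biset K H) (U : biset H G) :
  biset_iso (biset_prod (biset_sum V V') U)
            (biset_sum (biset_prod V U) (biset_prod V' U)).
Proof.
apply: (biset_prod_isoW (V := biset_sum V V')
  (W := biset_sum (biset_prod V U) (biset_prod V' U))
  (f := fun v u => match v with
    | inl v => inl (prod_pi v u) | inr v => inr (prod_pi v u) end)).
- by case=> v h u /=; rewrite prod_pi_bal.
- by move=> k [] v u /=; rewrite prod_lactE.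
- by case=> v u g /=; rewrite prod_ractE.
- case=> q; have [v [u ->]] := prod_carP q; first by exists (inl v), u.
  by exists (inr v), u.
- case=> v u [] v' u' //= [] /prod_piP[h [-> ->]].
    by apply/prod_piP; exists h.
  by apply/prod_piP; exists h.
Qed.

Lemma biset_prodDr (K H G : finGroupType) (V : biset K H) (U U' : biset H G) :
  biset_iso (biset_prod V (biset_sum U U'))
            (biset_sum (biset_prod V U) (biset_prod V U')).
Proof.
apply: (biset_prod_isoW (U := biset_sum U U')
  (W := biset_sum (biset_prod V U) (biset_prod V U'))
  (f := fun v u => match u with
    | inl u => inl (prod_pi v u) | inr u => inr (prod_pi v u) end)).
- by move=> v h [] u /=; rewrite prod_pi_bal.
- by move=> k v [] u /=; rewrite prod_lactE.
- by move=> v [] u g /=; rewrite prod_ractE.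
- case=> q; have [v [u ->]] := prod_carP q; first by exists v, (inl u).
  by exists v, (inr u).
- move=> v [] u v' [] u' //= [] /prod_piP[h [-> ->]].
    by apply/prod_piP; exists h.
  by apply/prod_piP; exists h.
Qed.

Definition class_mul (K H G : finGroupType) (c : biset_classes K H)
    (d : biset_classes H G) : biset_classes K G :=
  biset_class (biset_prod (class_repr c) (class_repr d)).

Section ClassMul.
Local Open Scope ring_scope.

Lemma class_mulE (K H G : finGroupType) (V : biset K H) (U : biset H G) :
  class_mul (biset_class V) (biset_class U) = biset_class (biset_prod V U).
Proof.
by apply/biset_classP; apply: biset_prod_iso; exact: biset_class_repr.
Qed.

Lemma class_mulA (L K H G : finGroupType) (e : biset_classes L K)
    (d : biset_classes K H) (c : biset_classes H G) :
  class_mul e (class_mul d c) = class_mul (class_mul e d) c.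
Proof.
rewrite -[c]class_reprK -[d]class_reprK -[e]class_reprK !class_mulE.
by apply/biset_classP; exact: biset_prodA.
Qed.

Lemma class_mul1l (H G : finGroupType) (c : biset_classes H G) :
  class_mul (biset_class (biset_id H)) c = c.
Proof.
rewrite -[c]class_reprK !class_mulE.
by apply/biset_classP; exact: biset_prod1l.
Qed.

Lemma class_mul1r (H G : finGroupType) (c : biset_classes H G) :
  class_mul c (biset_class (biset_id G)) = c.
Proof.
rewrite -[c]class_reprK !class_mulE.
by apply/biset_classP; exact: biset_prod1r.
Qed.

Lemma class_mul0l (K H G : finGroupType) (c : biset_classes H G) :
  class_mul (0 : biset_classes K H) c = 0.
Proof.
rewrite -[c]class_reprK !class_mulE.
by apply/biset_classP; exact: biset_prod0l.
Qed.

Lemma class_mul0r (K H G : finGroupType) (c : biset_classes K H) :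
  class_mul c (0 : biset_classes H G) = 0.
Proof.
rewrite -[c]class_reprK !class_mulE.
by apply/biset_classP; exact: biset_prod0r.
Qed.

Lemma class_mulDl (K H G : finGroupType) (d d' : biset_classes K H)
    (c : biset_classes H G) :
  class_mul (d + d') c = class_mul d c + class_mul d' c.
Proof.
rewrite -[c]class_reprK -[d]class_reprK -[d']class_reprK.
rewrite [_ + _ in LHS]class_addE !class_mulE [RHS]class_addE.
by apply/biset_classP; exact: biset_prodDl.
Qed.

Lemma class_mulDr (K H G : finGroupType) (d : biset_classes K H)
    (c c' : biset_classes H G) :
  class_mul d (c + c') = class_mul d c + class_mul d c'.
Proof.
rewrite -[c]class_reprK -[d]class_reprK -[c']class_reprK.
rewrite [_ + _ in LHS]class_addE !class_mulE [RHS]class_addE.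
by apply/biset_classP; exact: biset_prodDr.
Qed.
End ClassMul.

Local Open Scope ring_scope.

Section Grothendieck.
Variable M : nmodType.

Definition groth_rel (p q : M * M) :=
  `[< exists k, p.1 + q.2 + k = q.1 + p.2 + k >].

Lemma groth_rel_refl : reflexive groth_rel.
Proof. by move=> p; apply/asboolP; exists 0. Qed.

Lemma groth_rel_sym : symmetric groth_rel.
Proof. by move=> p q; apply/asboolP/asboolP => -[k E]; exists k. Qed.

Lemma groth_rel_trans : transitive groth_rel.
Proof.
move=> [c d] [a b] [e f] /asboolP[k /= E] /asboolP[l /= F].
apply/asboolP; exists (k + l + c + d) => /=.
rewrite [LHS](AC (2*4) ((1*6*3)*(5*2*4))) [RHS](AC (2*4) ((5*2*3)*(1*6*4))) /=.
by rewrite E F.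
Qed.

Canonical groth_equiv :=
  EquivRel groth_rel groth_rel_refl groth_rel_sym groth_rel_trans.

(* The Grothendieck group of M; [groth_pi a b] is the difference a - b. *)
Definition groth := {eq_quot groth_equiv}.
HB.instance Definition _ := Choice.on groth.

Definition groth_pi (a b : M) : groth := \pi_{eq_quot groth_equiv} (a, b).

Lemma groth_piP a b c d : groth_pi a b = groth_pi c d <->
  exists k, a + d + k = c + b + k.
Proof.
split=> [/eqmodP|E]; first by move/asboolP.
by apply/eqmodP/asboolP.
Qed.

Lemma groth_repr (x : groth) : x = groth_pi (repr x).1 (repr x).2.
Proof. by rewrite /groth_pi -surjective_pairing [RHS]reprK. Qed.

Definition groth_add (x y : groth) : groth :=
  groth_pi ((repr x).1 + (repr y).1) ((repr x).2 + (repr y).2).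
Definition groth_opp (x : groth) : groth := groth_pi (repr x).2 (repr x).1.

Lemma groth_addE a b c d :
  groth_add (groth_pi a b) (groth_pi c d) = groth_pi (a + c) (b + d).
Proof.
have := groth_repr (groth_pi a b); have := groth_repr (groth_pi c d).
rewrite /groth_add; move: (repr _) (repr _) => [c' d'] [a' b'] /=.
move=> /groth_piP[k E] /groth_piP[l F]; apply/groth_piP; exists (k + l).
rewrite [LHS](AC (2*2*2) ((1*3*6)*(2*4*5))).
rewrite [RHS](AC (2*2*2) ((1*3*6)*(2*4*5))) /=.
by rewrite -F -E.
Qed.

Lemma groth_oppE a b : groth_opp (groth_pi a b) = groth_pi b a.
Proof.
have := groth_repr (groth_pi a b).
rewrite /groth_opp; move: (repr _) => [a' b'] /= /groth_piP[k E].
by apply/groth_piP; exists k; rewrite [b' + a]addrC E [a' + b]addrC.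
Qed.

Lemma groth_addA : associative groth_add.
Proof.
move=> x y z; rewrite [x]groth_repr [y]groth_repr [z]groth_repr.
by rewrite !groth_addE !addrA.
Qed.

Lemma groth_addC : commutative groth_add.
Proof.
move=> x y; rewrite [x]groth_repr [y]groth_repr !groth_addE.
by rewrite addrC [_ + (repr y).2]addrC.
Qed.

Lemma groth_add0 : left_id (groth_pi 0 0) groth_add.
Proof. by move=> x; rewrite [x]groth_repr groth_addE !add0r. Qed.

Lemma groth_addN : left_inverse (groth_pi 0 0) groth_opp groth_add.
Proof.
move=> x; rewrite [x]groth_repr groth_oppE groth_addE.
by apply/groth_piP; exists 0; rewrite !addr0 add0r addrC.
Qed.

HB.instance Definition _ :=
  GRing.isZmodule.Build groth groth_addA groth_addC groth_add0 groth_addN.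

Definition groth_in (a : M) : groth := groth_pi a 0.

Lemma groth_inD a b : groth_in (a + b) = groth_in a + groth_in b.
Proof. by rewrite [RHS]groth_addE addr0. Qed.

Lemma groth_piE a b : groth_pi a b = groth_in a - groth_in b.
Proof. by rewrite [- _]groth_oppE [RHS]groth_addE addr0 add0r. Qed.

Lemma groth_ind (P : groth -> Prop) : (forall a, P (groth_in a)) ->
  (forall x y, P x -> P y -> P (x - y)) -> forall x, P x.
Proof. by move=> Pi PB x; rewrite [x]groth_repr groth_piE; apply: PB. Qed.

Definition groth_lift (A : zmodType) (f : M -> A) (x : groth) : A :=
  f (repr x).1 - f (repr x).2.

Section Lift.
Variables (A : zmodType) (f : M -> A).
Hypothesis fD : forall a b, f (a + b) = f a + f b.

Lemma groth_lift_pi a b : groth_lift f (groth_pi a b) = f a - f b.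
Proof.
have := groth_repr (groth_pi a b).
rewrite /groth_lift; move: (repr _) => [c d] /= /groth_piP[k].
move/(congr1 f); rewrite !fD => /addIr E.
by apply/eqP; rewrite subr_eq addrAC eq_sym subr_eq E.
Qed.

Lemma groth_lift_in a : groth_lift f (groth_in a) = f a.
Proof.
have f0 : f 0 = 0 by apply: (addIr (f 0)); rewrite -fD !add0r.
by rewrite groth_lift_pi f0 subr0.
Qed.

Lemma groth_liftD x y :
  groth_lift f (x + y) = groth_lift f x + groth_lift f y.
Proof.
rewrite [x]groth_repr [y]groth_repr [_ + _ in LHS]groth_addE !groth_lift_pi.
by rewrite !fD opprD addrACA.
Qed.
End Lift.
End Grothendieck.

Lemma additive_opp (A B : zmodType) (f : A -> B) :
  (forall x y, f (x + y) = f x + f y) ->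
  f 0 = 0 /\ (forall x, f (- x) = - f x).
Proof.
move=> fD; have f0 : f 0 = 0 by apply: (addIr (f 0)); rewrite -fD !add0r.
by split=> // x; apply/eqP; rewrite -addr_eq0 -fD addNr f0.
Qed.

(* The tensor product of an abelian group with R over the integers: formal
   sums of pairs (a, r), modulo the congruence generated by biadditivity. As
   formal sums are only a monoid, (0, r) has to be equated with 0 explicitly. *)
Section Tensor.
Variables (A : zmodType) (R : comPzRingType).

Inductive tens_rel : seq (A * R) -> seq (A * R) -> Prop :=
| TensRefl s : tens_rel s s
| TensSym s t : tens_rel s t -> tens_rel t s
| TensTrans s t u : tens_rel s t -> tens_rel t u -> tens_rel s u
| TensCat s s' t t' :
    tens_rel s s' -> tens_rel t t' -> tens_rel (s ++ t) (s' ++ t')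
| TensCatC s t : tens_rel (s ++ t) (t ++ s)
| TensDl a b r : tens_rel [:: (a + b, r)] [:: (a, r); (b, r)]
| TensDr a r s : tens_rel [:: (a, r + s)] [:: (a, r); (a, s)]
| Tens0 r : tens_rel [:: (0, r)] [::].

Definition tens_relb s t := `[< tens_rel s t >].

Lemma tens_relb_refl : reflexive tens_relb.
Proof. by move=> s; apply/asboolP; exact: TensRefl. Qed.

Lemma tens_relb_sym : symmetric tens_relb.
Proof. by move=> s t; apply/asboolP/asboolP; exact: TensSym. Qed.

Lemma tens_relb_trans : transitive tens_relb.
Proof.
by move=> t s u /asboolP st /asboolP tu; apply/asboolP; exact: TensTrans tu.
Qed.

Canonical tens_equiv :=
  EquivRel tens_relb tens_relb_refl tens_relb_sym tens_relb_trans.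

Definition tens := {eq_quot tens_equiv}.
HB.instance Definition _ := Choice.on tens.

Definition tens_pi (s : seq (A * R)) : tens := \pi_{eq_quot tens_equiv} s.

Lemma tens_piP s t : tens_pi s = tens_pi t <-> tens_rel s t.
Proof.
split=> [/eqmodP|E]; first by move/asboolP.
by apply/eqmodP/asboolP.
Qed.

Lemma tens_reprK (x : tens) : tens_pi (repr x) = x.
Proof. exact: reprK. Qed.

Definition tens_add (x y : tens) : tens := tens_pi (repr x ++ repr y).
Definition tens_opp (x : tens) : tens :=
  tens_pi [seq (- p.1, p.2) | p <- repr x].
Definition tens_scale (a : R) (x : tens) : tens :=
  tens_pi [seq (p.1, a * p.2) | p <- repr x].

Lemma tens_addE s t : tens_add (tens_pi s) (tens_pi t) = tens_pi (s ++ t).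
Proof. by apply/tens_piP/TensCat; apply/tens_piP; exact: tens_reprK. Qed.

Lemma tens_rel_map (f : A * R -> A * R) s t :
  (forall a b r, tens_rel [:: f (a + b, r)] [:: f (a, r); f (b, r)]) ->
  (forall a r s, tens_rel [:: f (a, r + s)] [:: f (a, r); f (a, s)]) ->
  (forall r, tens_rel [:: f (0, r)] [::]) ->
  tens_rel s t -> tens_rel (map f s) (map f t).
Proof.
move=> fDl fDr f0; elim=> {s t} //=.
- by move=> s; exact: TensRefl.
- by move=> s t _; exact: TensSym.
- by move=> s t u _ + _; exact: TensTrans.
- by move=> s s' t t' _ Hs _ Ht; rewrite !map_cat; exact: TensCat.
- by move=> s t; rewrite !map_cat; exact: TensCatC.
Qed.

Lemma tens_oppE s : tens_opp (tens_pi s) = tens_pi [seq (- p.1, p.2) | p <- s].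
Proof.
apply/tens_piP/tens_rel_map; last by apply/tens_piP; exact: tens_reprK.
- by move=> a b r /=; rewrite opprD; exact: TensDl.
- by move=> a r r' /=; exact: TensDr.
- by move=> r /=; rewrite oppr0; exact: Tens0.
Qed.

Lemma tens_scaleE a s :
  tens_scale a (tens_pi s) = tens_pi [seq (p.1, a * p.2) | p <- s].
Proof.
apply/tens_piP/tens_rel_map; last by apply/tens_piP; exact: tens_reprK.
- by move=> b c r /=; exact: TensDl.
- by move=> b r r' /=; rewrite mulrDr; exact: TensDr.
- by move=> r /=; exact: Tens0.
Qed.

Lemma tens_addA : associative tens_add.
Proof.
move=> x y z; rewrite -[x]tens_reprK -[y]tens_reprK -[z]tens_reprK.
by rewrite !tens_addE catA.
Qed.

Lemma tens_addC : commutative tens_add.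
Proof.
move=> x y; rewrite -[x]tens_reprK -[y]tens_reprK !tens_addE.
by apply/tens_piP; exact: TensCatC.
Qed.

Lemma tens_add0 : left_id (tens_pi [::]) tens_add.
Proof. by move=> x; rewrite -[x]tens_reprK tens_addE. Qed.

Lemma tens_addN : left_inverse (tens_pi [::]) tens_opp tens_add.
Proof.
move=> x; rewrite -[x]tens_reprK tens_oppE tens_addE; apply/tens_piP.
elim: (repr x) => [|[a r] s IHs] /=; first exact: TensRefl.
apply: (@TensTrans _ ([:: (- a, r)] ++ [:: (a, r)] ++
  (map (fun p => (- p.1, p.2)) s ++ s))).
  apply: (TensCat (TensRefl [:: (- a, r)])); rewrite -cat_rcons -cat1s catA.
  by apply: TensCat (TensRefl _); rewrite -cats1; exact: TensCatC.
apply: (@TensTrans _ ([::] ++ [::])) (TensRefl _); rewrite catA.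
apply: TensCat IHs; apply: TensTrans (Tens0 r); apply: TensSym.
by rewrite -[X in [:: (X, r)]](addNr a); exact: TensDl.
Qed.

HB.instance Definition _ :=
  GRing.isZmodule.Build tens tens_addA tens_addC tens_add0 tens_addN.

Lemma tens_scaleA a b x : tens_scale a (tens_scale b x) = tens_scale (a * b) x.
Proof.
rewrite -[x]tens_reprK !tens_scaleE -map_comp; congr tens_pi.
by apply: eq_map => p /=; rewrite mulrA.
Qed.

Lemma tens_scale1 : left_id 1 tens_scale.
Proof.
move=> x; rewrite -[x]tens_reprK !tens_scaleE; congr tens_pi.
by rewrite -[RHS]map_id; apply: eq_map => -[? ?] /=; rewrite mul1r.
Qed.

Lemma tens_scaleDr : right_distributive tens_scale +%R.
Proof.
move=> a x y; rewrite -[x]tens_reprK -[y]tens_reprK.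
by rewrite [_ + _ in LHS]tens_addE !tens_scaleE [RHS]tens_addE map_cat.
Qed.

Lemma tens_scaleDl x : {morph tens_scale^~ x : a b / a + b}.
Proof.
move=> a b; rewrite -[x]tens_reprK !tens_scaleE [RHS]tens_addE.
elim: (repr x) => [|[c r] s IHs]; first by [].
move: IHs => /tens_piP IHs; apply/tens_piP; rewrite /= mulrDl.
apply: (TensTrans (TensCat (TensDr c (a * r) (b * r)) IHs)) => /=.
apply: (TensCat (TensRefl [:: (c, a * r)])); rewrite -cat_rcons -cat1s catA.
by apply: TensCat (TensRefl _); rewrite -cats1; exact: TensCatC.
Qed.

HB.instance Definition _ := GRing.Zmodule_isLmodule.Build R tens
  tens_scaleA tens_scale1 tens_scaleDr tens_scaleDl.

Definition tens_pure (a : A) (r : R) : tens := tens_pi [:: (a, r)].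

Lemma tens_pureDl a b r : tens_pure (a + b) r = tens_pure a r + tens_pure b r.
Proof. by rewrite [RHS]tens_addE; apply/tens_piP; exact: TensDl. Qed.

Lemma tens_pureDr a r s : tens_pure a (r + s) = tens_pure a r + tens_pure a s.
Proof. by rewrite [RHS]tens_addE; apply/tens_piP; exact: TensDr. Qed.

Lemma tens_pureZ c a r : c *: tens_pure a r = tens_pure a (c * r).
Proof. by rewrite [LHS]tens_scaleE. Qed.

Lemma tens_ind (P : tens -> Prop) : P 0 -> (forall a r, P (tens_pure a r)) ->
  (forall x y, P x -> P y -> P (x + y)) -> forall x, P x.
Proof.
move=> P0 Pp PD x; rewrite -[x]tens_reprK.
elim: (repr x) => [|[a r] s IHs] //.
by have := PD _ _ (Pp a r) IHs; rewrite [_ + _]tens_addE.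
Qed.

Definition tens_lift (B : zmodType) (f : A -> R -> B) (x : tens) : B :=
  \sum_(p <- repr x) f p.1 p.2.

Section Lift.
Variables (B : zmodType) (f : A -> R -> B).
Hypothesis fDl : forall a b r, f (a + b) r = f a r + f b r.
Hypothesis fDr : forall a r s, f a (r + s) = f a r + f a s.

Lemma tens_lift_pi s : tens_lift f (tens_pi s) = \sum_(p <- s) f p.1 p.2.
Proof.
have /tens_piP := tens_reprK (tens_pi s).
rewrite /tens_lift; move: (repr _) => s'; elim=> {s s'} //=.
- by move=> s t u _ -> _ ->.
- by move=> s s' t t' _ E _ F; rewrite !big_cat /= E F.
- by move=> s t; rewrite !big_cat /= addrC.
- by move=> a b r; rewrite !big_cons !big_nil /= !addr0 fDl.
- by move=> a r s; rewrite !big_cons !big_nil /= !addr0 fDr.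
move=> r; rewrite big_cons !big_nil addr0 /=.
by have [] := @additive_opp A B (f^~ r) (fun a b => fDl a b r).
Qed.

Lemma tens_lift_pure a r : tens_lift f (tens_pure a r) = f a r.
Proof. by rewrite tens_lift_pi big_seq1. Qed.

Lemma tens_liftD x y : tens_lift f (x + y) = tens_lift f x + tens_lift f y.
Proof.
rewrite -[x]tens_reprK -[y]tens_reprK [_ + _ in LHS]tens_addE.
by rewrite !tens_lift_pi big_cat.
Qed.
End Lift.
End Tensor.

Section GrothMul.
Variables K H G : finGroupType.

Definition groth_mul (x : groth (biset_classes K H))
    (y : groth (biset_classes H G)) : groth (biset_classes K G) :=
  groth_lift (fun c => groth_lift (fun d => groth_in (class_mul c d)) y) x.

Let inDr c (d d' : biset_classes H G) : groth_in (class_mul c (d + d')) =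
  groth_in (class_mul c d) + groth_in (class_mul c d')
  :> groth (biset_classes K G).
Proof. by rewrite class_mulDr groth_inD. Qed.

Let liftDl y (c c' : biset_classes K H) :
  groth_lift (fun d => groth_in (class_mul (c + c') d)) y =
  groth_lift (fun d => groth_in (class_mul c d)) y +
  groth_lift (fun d : biset_classes H G => groth_in (class_mul c' d)) y.
Proof.
rewrite [y]groth_repr !groth_lift_pi //.
by rewrite !class_mulDl !groth_inD opprD addrACA.
Qed.

Lemma groth_mulDl x x' y :
  groth_mul (x + x') y = groth_mul x y + groth_mul x' y.
Proof. by apply: groth_liftD => c c'; exact: liftDl. Qed.

Lemma groth_mulDr x y y' :
  groth_mul x (y + y') = groth_mul x y + groth_mul x y'.
Proof.
rewrite [x]groth_repr /groth_mul !(groth_lift_pi (liftDl _)).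
rewrite !(groth_liftD (inDr _)).
by rewrite opprD addrACA.
Qed.

Lemma groth_mul_in c d :
  groth_mul (groth_in c) (groth_in d) = groth_in (class_mul c d).
Proof. by rewrite /groth_mul !groth_lift_in. Qed.

Lemma groth_mulBl x x' y :
  groth_mul (x - x') y = groth_mul x y - groth_mul x' y.
Proof.
have [_ N] := @additive_opp _ _ (groth_mul^~ y) (fun a b => groth_mulDl a b y).
by rewrite groth_mulDl; congr (_ + _); exact: N.
Qed.

Lemma groth_mulBr x y y' :
  groth_mul x (y - y') = groth_mul x y - groth_mul x y'.
Proof.
have [_ N] := @additive_opp _ _ (groth_mul x) (groth_mulDr x).
by rewrite groth_mulDr; congr (_ + _); exact: N.
Qed.
End GrothMul.

Lemma groth_mulA (L K H G : finGroupType) (z : groth (biset_classes L K))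
    (y : groth (biset_classes K H)) (x : groth (biset_classes H G)) :
  groth_mul z (groth_mul y x) = groth_mul (groth_mul z y) x.
Proof.
elim/groth_ind: z => [c|z z' IH IH'].
  elim/groth_ind: y => [d|y y' IH IH'].
    elim/groth_ind: x => [e|x x' IH IH'].
      by rewrite !groth_mul_in class_mulA.
    by rewrite !(groth_mulBr _ x x') groth_mulBr IH IH'.
  rewrite (groth_mulBl y y') (groth_mulBr _ y y') groth_mulBr groth_mulBl.
  by rewrite IH IH'.
by rewrite !(groth_mulBl z z') groth_mulBl IH IH'.
Qed.

Definition groth_id (G : finGroupType) : groth (biset_classes G G) :=
  groth_in (biset_class (biset_id G)).

Lemma groth_mul1l (H G : finGroupType) (x : groth (biset_classes H G)) :
  groth_mul (groth_id H) x = x.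
Proof.
elim/groth_ind: x => [e|x x' IH IH']; last by rewrite !groth_mulBr IH IH'.
by rewrite !groth_mul_in class_mul1l.
Qed.

Lemma groth_mul1r (H G : finGroupType) (x : groth (biset_classes H G)) :
  groth_mul x (groth_id G) = x.
Proof.
elim/groth_ind: x => [e|x x' IH IH']; last by rewrite !groth_mulBl IH IH'.
by rewrite !groth_mul_in class_mul1r.
Qed.

Section BisetCategory.
Variable R : comPzRingType.

(* Morphisms from G to H are spanned by the H-G-bisets. *)
Definition burnside (G H : finGroupType) : lmodType R :=
  tens (groth (biset_classes H G)) R.

Definition burnside_class (G H : finGroupType) (U : biset H G) :
  burnside G H := tens_pure (groth_in (biset_class U)) (1 : R).

Definition burnside_id (G : finGroupType) : burnside G G :=
  burnside_class (biset_id G).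

Section Mul.
Variables G H K : finGroupType.

Definition burnside_comp (y : burnside H K) (x : burnside G H) : burnside G K :=
  tens_lift (fun b s =>
    tens_lift (fun a r => tens_pure (groth_mul b a) (s * r)) x) y.

Let bDl (b : groth (biset_classes K H)) (s : R)
    (a a' : groth (biset_classes H G)) r :
  tens_pure (groth_mul b (a + a')) (s * r) =
  tens_pure (groth_mul b a) (s * r) + tens_pure (groth_mul b a') (s * r).
Proof. by rewrite groth_mulDr tens_pureDl. Qed.

Let bDr (b : groth (biset_classes K H)) (s : R)
    (a : groth (biset_classes H G)) r r' :
  tens_pure (groth_mul b a) (s * (r + r')) =
  tens_pure (groth_mul b a) (s * r) + tens_pure (groth_mul b a) (s * r').
Proof. by rewrite mulrDr tens_pureDr. Qed.

Let lDl (x : burnside G H) (b b' : groth (biset_classes K H)) (s : R) :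
  tens_lift (fun a r => tens_pure (groth_mul (b + b') a) (s * r)) x =
  tens_lift (fun a r => tens_pure (groth_mul b a) (s * r)) x +
  tens_lift (fun a r => tens_pure (groth_mul b' a) (s * r)) x.
Proof.
rewrite -[x]tens_reprK !tens_lift_pi // -big_split /=.
by apply: eq_bigr => p _; rewrite groth_mulDl tens_pureDl.
Qed.

Let lDr (x : burnside G H) (b : groth (biset_classes K H)) (s s' : R) :
  tens_lift (fun a r => tens_pure (groth_mul b a) ((s + s') * r)) x =
  tens_lift (fun a r => tens_pure (groth_mul b a) (s * r)) x +
  tens_lift (fun a r => tens_pure (groth_mul b a) (s' * r)) x.
Proof.
rewrite -[x]tens_reprK !tens_lift_pi // -big_split /=.
by apply: eq_bigr => p _; rewrite mulrDl tens_pureDr.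
Qed.

Lemma burnside_compDl y y' x :
  burnside_comp (y + y') x = burnside_comp y x + burnside_comp y' x.
Proof. exact: (tens_liftD (lDl x) (lDr x)). Qed.

Lemma burnside_compDr y x x' :
  burnside_comp y (x + x') = burnside_comp y x + burnside_comp y x'.
Proof.
rewrite -[y]tens_reprK /burnside_comp !(tens_lift_pi (lDl _) (lDr _)).
rewrite -big_split; apply: eq_bigr => p _.
exact: (tens_liftD (bDl _ _) (bDr _ _)).
Qed.

Lemma burnside_comp_pure b s a r :
  burnside_comp (tens_pure b s) (tens_pure a r) =
  tens_pure (groth_mul b a) (s * r).
Proof.
rewrite /burnside_comp (tens_lift_pure (lDl _) (lDr _)).
exact: (tens_lift_pure (bDl _ _) (bDr _ _)).
Qed.

Lemma burnside_comp0l x : burnside_comp 0 x = 0.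
Proof. by have [] := @additive_opp _ _ (burnside_comp^~ x)
  (fun y y' => burnside_compDl y y' x). Qed.

Lemma burnside_comp0r y : burnside_comp y 0 = 0.
Proof.
by have [] := @additive_opp _ _ (burnside_comp y) (burnside_compDr y).
Qed.

Lemma burnside_compZl c y x :
  burnside_comp (c *: y) x = c *: burnside_comp y x.
Proof.
elim/tens_ind: y => [|b s|y y' IH IH'].
- by rewrite scaler0 burnside_comp0l scaler0.
- elim/tens_ind: x => [|a r|x x' IH IH'].
  + by rewrite !burnside_comp0r scaler0.
  + by rewrite tens_pureZ !burnside_comp_pure tens_pureZ mulrA.
  + by rewrite !burnside_compDr IH IH' scalerDr.
- by rewrite scalerDr !burnside_compDl IH IH' scalerDr.
Qed.

Lemma burnside_compZr c y x :
  burnside_comp y (c *: x) = c *: burnside_comp y x.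
Proof.
elim/tens_ind: y => [|b s|y y' IH IH'].
- by rewrite !burnside_comp0l scaler0.
- elim/tens_ind: x => [|a r|x x' IH IH'].
  + by rewrite scaler0 !burnside_comp0r scaler0.
  + by rewrite tens_pureZ !burnside_comp_pure tens_pureZ mulrCA.
  + by rewrite scalerDr !burnside_compDr IH IH' scalerDr.
- by rewrite !burnside_compDl IH IH' scalerDr.
Qed.

Lemma burnside_comp_class (V : biset K H) (U : biset H G) :
  burnside_comp (burnside_class V) (burnside_class U) =
  burnside_class (biset_prod V U).
Proof.
by rewrite burnside_comp_pure groth_mul_in class_mulE mul1r.
Qed.
End Mul.

Lemma burnside_compA (G H K L : finGroupType) (z : burnside K L)
    (y : burnside H K) (x : burnside G H) :
  burnside_comp z (burnside_comp y x) = burnside_comp (burnside_comp z y) x.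
Proof.
elim/tens_ind: z => [|c t|z z' IH IH'].
- by rewrite !burnside_comp0l.
- elim/tens_ind: y => [|b s|y y' IH IH'].
  + by rewrite !(burnside_comp0l, burnside_comp0r).
  + elim/tens_ind: x => [|a r|x x' IH IH'].
    * by rewrite !burnside_comp0r.
    * by rewrite !burnside_comp_pure groth_mulA mulrA.
    * by rewrite !burnside_compDr IH IH'.
  + by rewrite !(burnside_compDl, burnside_compDr) IH IH'.
- by rewrite !burnside_compDl IH IH'.
Qed.

Lemma burnside_comp1l (G H : finGroupType) (x : burnside G H) :
  burnside_comp (burnside_id H) x = x.
Proof.
elim/tens_ind: x => [|a r|x x' IH IH'].
- by rewrite burnside_comp0r.
- by rewrite burnside_comp_pure groth_mul1l mul1r.
- by rewrite burnside_compDr IH IH'.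
Qed.

Lemma burnside_comp1r (G H : finGroupType) (x : burnside G H) :
  burnside_comp x (burnside_id G) = x.
Proof.
elim/tens_ind: x => [|a r|x x' IH IH'].
- by rewrite burnside_comp0l.
- by rewrite burnside_comp_pure groth_mul1r mulr1.
- by rewrite burnside_compDl IH IH'.
Qed.

Definition biset_cat : category :=
  @Category finGroupType burnside burnside_id
    (fun G H K => @burnside_comp G H K) burnside_compA burnside_comp1l
    burnside_comp1r.

Definition is_linear_functor (F : functor biset_cat (module_cat R)) :=
  forall (G H : finGroupType) (a : R) (x y : burnside G H) (m : F G),
    (fmap F (a *: x + y) : {linear F G -> F H}) m =
    a *: (fmap F x : {linear F G -> F H}) m +
    (fmap F y : {linear F G -> F H}) m.

Definition biset_functor_cat : category :=
  @full_sub (functor_cat biset_cat (module_cat R)) is_linear_functor.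
End BisetCategory.

(* Main.v *)
From HB Require Import structures.
From mathcomp Require Import all_boot all_algebra all_fingroup.
From mathcomp Require Import boolp functions generic_quotient.
Require Import Defs.

Set Implicit Arguments.
Unset Strict Implicit.
Unset Printing Implicit Defensive.

Import GRing.Theory.
#[local] Obligation Tactic := idtac.
Local Open Scope group_scope.
Local Open Scope quotient_scope.

(** A 0-cell X/G is a groupoid, the action groupoid of G on X, and a 1-cell is a
    functor between such groupoids. The proof passes through spans
    A <- W -> B of 1-cells, composed by bipullback.

    A Mackey functor M lets a span with legs l and r act as push r after
    pull l; the bipullback axiom says that composite spans act by composites
    ([span_action_comp]). If M is deflative, a span acts like any span that
    maps onto it by a stab-surjective 1-cell ([span_action_covers]), and
    additivity on bicoproducts makes it act as a sum whenever two spans cover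
    it jointly with disjoint images ([span_action_covers2]). Between points
    pt/G and pt/H, a span is an H-G-biset up to such covers: an H-G-biset U is
    the span with apex U/(H x G) ([biset_span]), every span covers a biset
    ([covers_biset_exists]), which is unique up to isomorphism
    ([covers_biset_unique]), and products and sums of bisets are composites
    and joint covers of spans. So G |-> M(pt/G) is a biset functor.

    Conversely a biset functor F is extended to all 0-cells by modules of
    natural transformations: an element over A is a family of values
    phi(S) in F(K), for all K and all spans S from A to pt/K, which is additive
    on joint covers and natural for bisets ([family]). Spans act on families by
    precomposition, which gives both variances at once, and every axiom of a
    deflative Mackey functor becomes a cover between two spans. For bipullbacks
    this is [bipullback_covers], for bicoproducts [covers2_joint_cover] and
    [covers_embedding], for deflativity [span_deflation].

    The two constructions are inverse to each other. Over a point, a family is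
    determined by its value at the identity span, by the Yoneda argument
    ([point_eval_bij]). Sending m to the family S |-> (S acting on m) is a
    morphism from M to the Mackey functor of its biset functor; it is bijective
    at points by the Yoneda argument, and therefore everywhere, because each
    0-cell is covered by the points carrying its stabilisers
    ([mackey_hom_bijective]). *)

(** * Actions, stabilisers and invertible 2-cells *)

Section GSetTheory.
Variables (G : finGroupType) (X : gset G).
Implicit Types (g h : G) (x y : X).

Lemma gactK g x : gact g^-1 (gact g x) = x.
Proof. by rewrite -gactM mulVg gact1. Qed.

Lemma gactKV g x : gact g (gact g^-1 x) = x.
Proof. by rewrite -gactM mulgV gact1. Qed.

Lemma gact_eqV g x y : gact g x = y -> x = gact g^-1 y.
Proof. by move=> <-; rewrite gactK. Qed.

Definition stab x : {set G} := [set g | gact g x == x].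

Lemma stabP g x : reflect (gact g x = x) (g \in stab x).
Proof. by rewrite inE; exact: eqP. Qed.

Lemma stab_group_set x : group_set (stab x).
Proof.
apply/group_setP; split=> [|g h]; first by rewrite inE gact1.
by rewrite !inE gactM => /eqP gx /eqP ->; rewrite gx.
Qed.

Canonical stab_group x := Group (stab_group_set x).

Definition stabg x : finGroupType := subg_of (stab_group x).

Lemma stabgP x (g : stabg x) : gact (sgval g) x = x.
Proof. exact/stabP/subgP. Qed.
End GSetTheory.

Lemma cmapV (A B : cell0) (a : cell1 A B) x g :
  gact (ctheta a x g)^-1 (a (gact g x)) = a x.
Proof. by rewrite cmapE gactK. Qed.

Lemma ctheta1 (A B : cell0) (a : cell1 A B) x : ctheta a x 1 = 1.
Proof. by apply: (mulIg (ctheta a x 1)); rewrite -{1}(gact1 x) -cthetaM !mul1g. Qed.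

Lemma cthetaV (A B : cell0) (a : cell1 A B) x g :
  ctheta a (gact g x) g^-1 = (ctheta a x g)^-1.
Proof. by apply: (mulIg (ctheta a x g)); rewrite -cthetaM !mulVg ctheta1. Qed.

Lemma tmap_thetaE (A B : cell0) (a b : cell1 A B) (e : cell2 a b) x g :
  e (gact g x) * ctheta a x g = ctheta b x g * e x.
Proof. by rewrite -(tmap_theta e) mulgKV. Qed.

Definition pt_gset (G : finGroupType) : gset G :=
  @GSet G unit (fun _ x => x) (fun _ => erefl) (fun _ _ _ => erefl).

Definition point (G : finGroupType) : cell0 := Cell0 (pt_gset G).

Definition at_stab (A : cell0) (x : cset A) : cell1 (point (stabg x)) A :=
  @Cell1 (point (stabg x)) A (fun _ => x) (fun _ g => sgval g)
    (fun _ g => esym (stabgP g)) (fun _ _ _ => erefl).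

Program Definition cell2_inv (A B : cell0) (a b : cell1 A B) (e : cell2 a b) :
    cell2 b a :=
  @Cell2 A B b a (ctheta b) (ctheta a) (fun x => (e x)^-1) _ _.
Next Obligation. by move=> A B a b e x /=; rewrite (tmapE e) gactK. Qed.
Next Obligation.
by move=> A B a b e x g; rewrite /= invgK -mulgA -tmap_thetaE mulKg.
Qed.

(** * Stab-surjectivity and joint covers *)

(** Condition (ii) of stab-surjectivity with one of the two group elements
    normalised to the unit. For action groupoids it says that the functor is
    full. *)
Definition stab_inj (A B : cell0) (a : cell1 A B) :=
  forall x x' h, gact h (a x) = a x' ->
  exists2 g, x' = gact g x & h = ctheta a x g.

Definition in_orbits (A B : cell0) (a : cell1 A B) (y : cset B) :=
  exists x h, y = gact h (a x).

Lemma stab_surjP (A B : cell0) (a : cell1 A B) :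
  stab_surjective a <-> (forall y, in_orbits a y) /\ stab_inj a.
Proof.
split=> [[surj inj]|[surj inj]]; split=> //.
  move=> x x' h E; have := inj x x' h 1; rewrite gact1 => /(_ E)[g [-> ->]].
  by exists g; rewrite ?mul1g.
move=> x x' h h' E; have [|g -> E'] := inj x x' (h'^-1 * h).
  by rewrite gactM E gactK.
by exists g; split=> //; rewrite -E' mulKVg.
Qed.

Lemma in_orbits_gact (A B : cell0) (a : cell1 A B) y g :
  in_orbits a y -> in_orbits a (gact g y).
Proof. by case=> x [h ->]; exists x, (g * h); rewrite gactM. Qed.

Lemma in_orbitsV (A B : cell0) (a : cell1 A B) y g :
  in_orbits a (gact g y) -> in_orbits a y.
Proof. by move/(in_orbits_gact g^-1); rewrite gactK. Qed.

Lemma in_orbits_comp (A B C : cell0) (b : cell1 B C) (a : cell1 A B) y h :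
  in_orbits a y -> in_orbits (cell1_comp b a) (gact h (b y)).
Proof.
by case=> x [g ->]; exists x, (h * ctheta b (a x) g); rewrite gactM /= cmapE.
Qed.

Lemma stab_inj_comp (A B C : cell0) (b : cell1 B C) (a : cell1 A B) :
  stab_inj b -> stab_inj a -> stab_inj (cell1_comp b a).
Proof.
move=> ib ia x x' h /ib[g /esym/ia[g' -> ->] ->].
by exists g'.
Qed.

Lemma stab_surj_comp (A B C : cell0) (b : cell1 B C) (a : cell1 A B) :
  stab_surjective b -> stab_surjective a -> stab_surjective (cell1_comp b a).
Proof.
move=> /stab_surjP[sb ib] /stab_surjP[sa ia]; apply/stab_surjP; split.
  by move=> y; have [x [h ->]] := sb y; exact: in_orbits_comp.
exact: stab_inj_comp.
Qed.

Lemma stab_surj_id (A : cell0) : stab_surjective (cell1_id A).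
Proof.
apply/stab_surjP; split=> [y|x x' h /= <-]; first by exists y, 1; rewrite gact1.
by exists h.
Qed.

(** The map from the disjoint union of W1 and W2 to W is stab-surjective; this
    avoids forming a disjoint union of sets on which different groups act. *)
Definition joint_cover (W1 W2 W : cell0) (i1 : cell1 W1 W) (i2 : cell1 W2 W) :=
  [/\ forall w, in_orbits i1 w \/ in_orbits i2 w,
      forall x y h, gact h (i1 x) <> i2 y,
      stab_inj i1 & stab_inj i2].

(** * The explicit bipullback *)

Section Bipullback.
Variables (A1 A2 B : cell0) (f1 : cell1 A1 B) (f2 : cell1 A2 B).

(** The iso-comma groupoid: a point of its set is a pair of points together with
    an arrow between their images. *)
Definition bpb_car : finType :=
  {p : cset A1 * cset A2 * cgrp B | f2 p.1.2 == gact p.2 (f1 p.1.1)}.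

Definition bpb_mk x y k (E : f2 y = gact k (f1 x)) : bpb_car :=
  exist _ (x, y, k) (introT eqP E).

Lemma bpbP (p : bpb_car) : exists x y k E, p = @bpb_mk x y k E.
Proof.
case: p => -[[x y] k] E; exists x, y, k, (eqP E).
exact: val_inj.
Qed.

Lemma bpb_mk_eq x y k x' y' k' E E' :
  x = x' -> y = y' -> k = k' -> @bpb_mk x y k E = @bpb_mk x' y' k' E'.
Proof. by move=> ? ? ?; apply: val_inj; congr (_, _, _). Qed.

Lemma bpb_mk_inj x y k x' y' k' E E' :
  @bpb_mk x y k E = @bpb_mk x' y' k' E' -> [/\ x = x', y = y' & k = k'].
Proof. by move/(congr1 val) => [-> -> ->]. Qed.

Definition bpb_grp : finGroupType := (cgrp A1 * cgrp A2)%type.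

Lemma bpb_act_subproof (g : bpb_grp) (p : bpb_car) :
  f2 (gact g.2 (val p).1.2) =
  gact (ctheta f2 (val p).1.2 g.2 * (val p).2 * (ctheta f1 (val p).1.1 g.1)^-1)
    (f1 (gact g.1 (val p).1.1)).
Proof.
by rewrite cmapE (eqP (valP p)) !gactM cmapV.
Qed.

Definition bpb_act (g : bpb_grp) (p : bpb_car) : bpb_car :=
  bpb_mk (bpb_act_subproof g p).

Program Definition bpb_gset : gset bpb_grp := @GSet bpb_grp bpb_car bpb_act _ _.
Next Obligation.
move=> p; have [x [y [k [E ->]]]] := bpbP p; apply: bpb_mk_eq; rewrite /= ?gact1 //.
by rewrite !ctheta1 mul1g invg1 mulg1.
Qed.
Next Obligation.
move=> g h p; have [x [y [k [E ->]]]] := bpbP p.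
apply: bpb_mk_eq; rewrite /= ?gactM //.
by rewrite !cthetaM invMg !mulgA.
Qed.

Definition bpb : cell0 := @Cell0 bpb_grp bpb_gset.

Definition bpb_fst : cell1 bpb A1 :=
  @Cell1 bpb A1 (fun p => (val p).1.1) (fun _ g => g.1)
    (fun _ _ => erefl) (fun _ _ _ => erefl).

Definition bpb_snd : cell1 bpb A2 :=
  @Cell1 bpb A2 (fun p => (val p).1.2) (fun _ g => g.2)
    (fun _ _ => erefl) (fun _ _ _ => erefl).

Program Definition bpb_cell2 :
    cell2 (cell1_comp f1 bpb_fst) (cell1_comp f2 bpb_snd) :=
  @Cell2 bpb B _ _ (ctheta (cell1_comp f1 bpb_fst))
    (ctheta (cell1_comp f2 bpb_snd)) (fun p => (val p).2) _ _.
Next Obligation. by move=> p /=; rewrite (eqP (valP p)). Qed.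
Next Obligation. by move=> p g; rewrite /= mulgKV mulgK. Qed.

(** The projections of this 1-cell are strictly g1 and g2, so identities serve
    as the comparison 2-cells of the universal property. *)
Program Definition bpb_pair (X : cell0) (g1 : cell1 X A1) (g2 : cell1 X A2)
    (e : cell2 (cell1_comp f1 g1) (cell1_comp f2 g2)) : cell1 X bpb :=
  @Cell1 X bpb (fun x => bpb_mk (tmapE e x))
    (fun x g => (ctheta g1 x g, ctheta g2 x g)) _ _.
Next Obligation.
move=> X g1 g2 e x g /=; apply: bpb_mk_eq; rewrite /= ?cmapE //.
by rewrite -(tmap_thetaE e) mulgK.
Qed.
Next Obligation. by move=> X g1 g2 e x g g' /=; rewrite !cthetaM. Qed.

(** The first half is strict, by [bpb_pair]. In the second half the two
    projections force z x to be the pair of quotients of the given 2-cells, and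
    the third coordinate of a point is moved correctly because both triples
    are compatible with the same e. *)
Lemma bpb_is_bipullback : is_bipullback bpb_cell2.
Proof.
move=> X g1 g2 e; split.
  exists (bpb_pair e), (cell2_id g1), (cell2_id g2).
  by apply: cell2_ext => x; rewrite /= !ctheta1 mulg1 mul1g.
move=> g x1 x2 g' x1' x2' T T'.
have E1 x : g1 x = gact (x1 x) (val (g x)).1.1 by rewrite (tmapE x1).
have E1' x : g1 x = gact (x1' x) (val (g' x)).1.1 by rewrite (tmapE x1').
have E2 x : g2 x = gact (x2 x) (val (g x)).1.2 by rewrite (tmapE x2).
have E2' x : g2 x = gact (x2' x) (val (g' x)).1.2 by rewrite (tmapE x2').
have {}T x : e x * ctheta f1 (val (g x)).1.1 (x1 x) =
    ctheta f2 (val (g x)).1.2 (x2 x) * (val (g x)).2.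
  by have := congr1 (fun z : cell2 _ _ => z x) T.
have {}T' x : e x * ctheta f1 (val (g' x)).1.1 (x1' x) =
    ctheta f2 (val (g' x)).1.2 (x2' x) * (val (g' x)).2.
  by have := congr1 (fun z : cell2 _ _ => z x) T'.
pose z x : bpb_grp := ((x1' x)^-1 * x1 x, (x2' x)^-1 * x2 x).
have z1 x : g' x = gact (z x) (g x).
  have F1 : (val (g' x)).1.1 = gact ((x1' x)^-1 * x1 x) (val (g x)).1.1.
    by rewrite gactM -E1 E1' gactK.
  have F2 : (val (g' x)).1.2 = gact ((x2' x)^-1 * x2 x) (val (g x)).1.2.
    by rewrite gactM -E2 E2' gactK.
  apply: val_inj; rewrite [LHS]surjective_pairing [(val (g' x)).1]surjective_pairing.
  congr (_, _, _); rewrite ?F1 ?F2 //.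
  apply: (mulgI (ctheta f2 (val (g' x)).1.2 (x2' x))).
  rewrite -T' F1 F2 !mulgA -cthetaM mulKVg -T; apply: (mulIg (ctheta f1 (val (g x)).1.1 (z x).1)).
  by rewrite mulgKV -mulgA -cthetaM mulKVg.
have zt x h : z (gact h x) * ctheta g x h * (z x)^-1 = ctheta g' x h.
  have H1 := tmap_thetaE x1 x h; have H1' := tmap_thetaE x1' x h.
  have H2 := tmap_thetaE x2 x h; have H2' := tmap_thetaE x2' x h.
  rewrite [LHS]surjective_pairing [RHS]surjective_pairing; congr (_, _).
    apply: (mulgI (x1' (gact h x))); rewrite [RHS]H1' /= invMg invgK.
    by rewrite !mulgA mulgV mul1g H1 mulgK.
  apply: (mulgI (x2' (gact h x))); rewrite [RHS]H2' /= invMg invgK.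
  by rewrite !mulgA mulgV mul1g H2 mulgK.
exists (@Cell2 X bpb g g' (ctheta g) (ctheta g') z z1 zt); split.
  by split; apply: cell2_ext => x; rewrite /= mulKVg.
move=> w [w1 w2]; apply: cell2_ext => x /=.
have := congr1 (fun z : cell2 _ _ => z x) w1.
have := congr1 (fun z : cell2 _ _ => z x) w2.
by rewrite /z /= => <- <-; rewrite !mulKg -surjective_pairing.
Qed.
End Bipullback.

Section BipullbackLegs.
Variables (A1 A2 B : cell0) (f1 : cell1 A1 B) (f2 : cell1 A2 B).

(** Stab-surjectivity is stable under base change, on either side: an arrow
    between two images is part of the data of a point of the bipullback, so a
    lift along the full functor can be read off. *)
Lemma bpb_snd_inj : stab_inj f1 -> stab_inj (bpb_snd f1 f2).
Proof.
move=> inj p p' j; have [x [y [k [E ->]]]] := bpbP p.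
have [x' [y' [k' [E' ->]]]] := bpbP p' => /= jy.
have [|g Ex Eg] := inj x x' (k'^-1 * ctheta f2 y j * k).
  by rewrite !gactM -E -cmapE jy E' gactK.
subst x'; exists (g, j) => //; apply: bpb_mk_eq => //=.
by rewrite -Eg !invMg invgK !mulgA mulgK mulgV mul1g.
Qed.

Lemma bpb_snd_surj : stab_surjective f1 -> stab_surjective (bpb_snd f1 f2).
Proof.
case/stab_surjP=> surj inj; apply/stab_surjP; split; last exact: bpb_snd_inj.
move=> y; have [x [k E]] := surj (f2 y).
by exists (bpb_mk E), 1; rewrite gact1.
Qed.

Lemma bpb_fst_inj : stab_inj f2 -> stab_inj (bpb_fst f1 f2).
Proof.
move=> inj p p' j; have [x [y [k [E ->]]]] := bpbP p.
have [x' [y' [k' [E' ->]]]] := bpbP p' => /= jx.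
have [|g Ex Eg] := inj y y' (k' * ctheta f1 x j * k^-1).
  by rewrite E E' -jx cmapE -!gactM mulgKV.
subst y'; exists (j, g) => //; apply: bpb_mk_eq => //=.
by rewrite -Eg mulgKV mulgK.
Qed.

Lemma bpb_fst_surj : stab_surjective f2 -> stab_surjective (bpb_fst f1 f2).
Proof.
case/stab_surjP=> surj inj; apply/stab_surjP; split; last exact: bpb_fst_inj.
move=> x; have [y [k Ex]] := surj (f1 x).
have E : f2 y = gact k^-1 (f1 x) by rewrite Ex gactK.
by exists (bpb_mk E), 1; rewrite gact1.
Qed.
End BipullbackLegs.

(** Bipullbacks are functorial in the cospan; this is what makes composition of
    spans compatible with covers on both sides. *)
Section BipullbackMap.
Variables (A1 A2 A1' A2' B : cell0) (f1 : cell1 A1 B) (f2 : cell1 A2 B).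
Variables (f1' : cell1 A1' B) (f2' : cell1 A2' B).
Variables (j1 : cell1 A1' A1) (j2 : cell1 A2' A2).
Variables (e1 : cell2 (cell1_comp f1 j1) f1') (e2 : cell2 f2' (cell1_comp f2 j2)).

Definition bpb_map_cell2 :
    cell2 (cell1_comp f1 (cell1_comp j1 (bpb_fst f1' f2')))
          (cell1_comp f2 (cell1_comp j2 (bpb_snd f1' f2'))) :=
  vcomp (whiskerr e2 (bpb_snd f1' f2'))
    (vcomp (bpb_cell2 f1' f2') (whiskerr e1 (bpb_fst f1' f2'))).

Definition bpb_map : cell1 (bpb f1' f2') (bpb f1 f2) :=
  bpb_pair bpb_map_cell2.

Lemma bpb_map_inj : stab_inj j1 -> stab_inj j2 -> stab_inj bpb_map.
Proof.
move=> i1 i2 p p' [l1 l2]; have [x [y [k [E ->]]]] := bpbP p.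
have [x' [y' [k' [E' ->]]]] := bpbP p' => /bpb_mk_inj /= [].
move=> /i1[g1 Ex ->] /i2[g2 Ey ->] H; subst x' y'; exists (g1, g2) => //.
apply: bpb_mk_eq => //=; apply: (mulIg (e1 (gact g1 x))).
apply: (mulgI (e2 (gact g2 y))); rewrite -H.
have := tmap_thetaE e2 y g2; have := tmap_thetaE e1 x g1.
move=> /= /(canRL (mulgK _)) -> /(canRL (mulgK _)) ->.
by rewrite !mulgA !mulgKV.
Qed.

Lemma bpb_map_in_orbits (p : cset (bpb f1 f2)) :
  in_orbits j1 (bpb_fst f1 f2 p) -> in_orbits j2 (bpb_snd f1 f2 p) ->
  in_orbits bpb_map p.
Proof.
have [x [y [k [E ->]]]] := bpbP p => /= -[x0 [h1 Ex]] [y0 [h2 Ey]].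
pose t1 := ctheta f1 (j1 x0) h1; pose t2 := ctheta f2 (j2 y0) h2.
have F : f2' y0 = gact ((t2 * e2 y0)^-1 * k * t1 * (e1 x0)^-1) (f1' x0).
  move: E; rewrite Ex Ey !cmapE -/t1 -/t2 !gactM (tmapE e1) gactK => <-.
  by rewrite -gactM -(gactK (t2 * e2 y0) (f2' y0)) !gactM -(tmapE e2).
exists (bpb_mk F), (h1, h2); apply: bpb_mk_eq => //=.
by rewrite -/t1 -/t2 mulgKV -!mulgA mulgV mulg1 invMg !mulgA mulgK mulgV mul1g.
Qed.

End BipullbackMap.

(** * Spans and their covers *)

Record span (A B : cell0) := Span {
  apex : cell0;
  legl : cell1 apex A;
  legr : cell1 apex B }.

Definition span_map (A B : cell0) (T S : span A B)
    (i : cell1 (apex S) (apex T)) :=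
  inhabited (cell2 (legl S) (cell1_comp (legl T) i)) /\
  inhabited (cell2 (legr S) (cell1_comp (legr T) i)).

(** The covering span is the second argument. Covers generate the equivalence
    of spans under which deflative Mackey functors cannot tell them apart. *)
Definition covers (A B : cell0) (T S : span A B) :=
  exists2 i, stab_surjective i & span_map (T := T) (S := S) i.

Definition covers2 (A B : cell0) (T S1 S2 : span A B) :=
  exists i1 i2, [/\ joint_cover i1 i2, span_map (T := T) (S := S1) i1 &
                    span_map (T := T) (S := S2) i2].

Lemma span_map_comp (A B : cell0) (T S S' : span A B)
    (i : cell1 (apex S) (apex T)) (j : cell1 (apex S') (apex S)) :
  span_map i -> span_map j -> span_map (T := T) (S := S') (cell1_comp i j).
Proof.
move=> [[e] [e']] [[f] [f']]; split; constructor.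
  exact: (@vcomp _ _ _ _ (cell1_comp (legl T) (cell1_comp i j))
           (whiskerr e j) f).
exact: (@vcomp _ _ _ _ (cell1_comp (legr T) (cell1_comp i j))
         (whiskerr e' j) f').
Qed.

Lemma covers_trans (A B : cell0) (T S S' : span A B) :
  covers T S -> covers S S' -> covers T S'.
Proof.
move=> [i si mi] [j sj mj]; exists (cell1_comp i j); first exact: stab_surj_comp.
exact: span_map_comp.
Qed.

Lemma covers_refl (A B : cell0) (S : span A B) : covers S S.
Proof.
exists (cell1_id _); first exact: stab_surj_id.
by split; constructor; exact: cell2_id.
Qed.

Lemma covers_covers2 (A B : cell0) (T S S1 S2 : span A B) :
  covers T S -> covers2 S S1 S2 -> covers2 T S1 S2.
Proof.
move=> [i /stab_surjP[si ii] mi] [i1 [i2 [[cov dis inj1 inj2] m1 m2]]].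
exists (cell1_comp i i1), (cell1_comp i i2); split; try exact: span_map_comp.
split; try exact: stab_inj_comp.
  move=> w; have [x [h ->]] := si w.
  by have [E|E] := cov x; [left|right]; exact: in_orbits_comp.
by move=> x y h /ii[g /esym/dis].
Qed.

Lemma covers2_covers (A B : cell0) (T S1 S2 S1' S2' : span A B) :
  covers2 T S1 S2 -> covers S1 S1' -> covers S2 S2' -> covers2 T S1' S2'.
Proof.
move=> [i1 [i2 [[cov dis inj1 inj2] m1 m2]]].
move=> [j1 /stab_surjP[s1 k1] n1] [j2 /stab_surjP[s2 k2] n2].
exists (cell1_comp i1 j1), (cell1_comp i2 j2); split; try exact: span_map_comp.
split; try exact: stab_inj_comp.
  move=> w; have [[x [h ->]]|[x [h ->]]] := cov w; [left|right].
    exact: in_orbits_comp.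
  exact: in_orbits_comp.
by move=> x y h; exact: dis.
Qed.

(** Ordinary covers are thus a special case of joint covers, and additivity
    alone entails invariance under covers. *)
Lemma covers2_empty (A B : cell0) (T S E : span A B) :
  covers T S -> #|cset (apex E)| = 0 -> covers2 T S E.
Proof.
move=> [i /stab_surjP[si ii] mi] /card0_eq E0.
have no (x : cset (apex E)) : False by have := E0 x.
pose e (X : cell0) : cell1 (apex E) X :=
  @Cell1 (apex E) X (fun x => False_rect _ (no x)) (fun x _ => False_rect _ (no x))
    (fun x _ => False_rect _ (no x)) (fun x _ _ => False_rect _ (no x)).
exists i, (e _); split=> //.
  split; [by left|by move=> x y; have := no y|exact: ii|].
  by move=> x y; have := no x.
by split; constructor; exists (fun x => False_rect _ (no x)) => x; have := no x.
Qed.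

Definition span_comp (A B C : cell0) (S : span B C) (Q : span A B) : span A C :=
  Span (cell1_comp (legl Q) (bpb_fst (legr Q) (legl S)))
       (cell1_comp (legr S) (bpb_snd (legr Q) (legl S))).

Definition span_push (A B : cell0) (f : cell1 A B) : span A B :=
  Span (cell1_id A) f.

Definition span_pull (A B : cell0) (f : cell1 A B) : span B A :=
  Span f (cell1_id A).

Definition span_id (A : cell0) : span A A := Span (cell1_id A) (cell1_id A).

Section Whiskering.
Variables (A B C : cell0).

Section Maps.
Variables (S S' : span B C) (Q Q' : span A B).
Variables (i : cell1 (apex S') (apex S)) (j : cell1 (apex Q') (apex Q)).
Hypotheses (mi : span_map i) (mj : span_map j).

(** The third property locates the image of the composite, from which the
    disjointness of two composites of disjoint spans is read off. *)
Lemma span_comp_map : exists2 ij, span_map (T := span_comp S Q)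
   (S := span_comp S' Q') ij &
  [/\ stab_inj i -> stab_inj j -> stab_inj ij,
      forall p, in_orbits j (bpb_fst _ _ p) -> in_orbits i (bpb_snd _ _ p) ->
        in_orbits ij p &
      forall p', bpb_fst _ _ (ij p') = j (bpb_fst _ _ p') /\
                 bpb_snd _ _ (ij p') = i (bpb_snd _ _ p')].
Proof.
case: mi mj => [[el] [er]] [[fl] [fr]].
exists (bpb_map (cell2_inv fr) el).
  split; constructor.
    exact: (@whiskerr _ _ _ _ (cell1_comp (legl Q) j) fl).
  exact: (@whiskerr _ _ _ _ (cell1_comp (legr S) i) er).
split=> //.
- by move=> *; exact: bpb_map_inj.
- by move=> p *; exact: bpb_map_in_orbits.
Qed.
End Maps.

Lemma span_comp_covers (S S' : span B C) (Q Q' : span A B) :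
  covers S S' -> covers Q Q' -> covers (span_comp S Q) (span_comp S' Q').
Proof.
move=> [i /stab_surjP[si ii] mi] [j /stab_surjP[sj ij] mj].
have [k mk [ik sk _]] := span_comp_map mi mj.
by exists k => //; apply/stab_surjP; split=> [p|]; [exact: sk|exact: ik].
Qed.

Lemma span_map_id (X Y : cell0) (T : span X Y) :
  span_map (T := T) (S := T) (cell1_id _).
Proof. by split; constructor; exact: cell2_id. Qed.

Lemma span_comp_covers2l (S S1 S2 : span B C) (Q : span A B) :
  covers2 S S1 S2 ->
  covers2 (span_comp S Q) (span_comp S1 Q) (span_comp S2 Q).
Proof.
move=> [i1 [i2 [[cov dis inj1 inj2] m1 m2]]].
have /stab_surjP[si ii] := stab_surj_id (apex Q).
have [k1 mk1 [ik1 sk1 E1]] := span_comp_map m1 (span_map_id Q).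
have [k2 mk2 [ik2 sk2 E2]] := span_comp_map m2 (span_map_id Q).
exists k1, k2; split=> //; split; [|move=> x y h E|exact: ik1|exact: ik2].
  move=> p; have [H|H] := cov (bpb_snd _ _ p).
    by left; apply: sk1.
  by right; apply: sk2.
have := congr1 (bpb_snd _ _) E; rewrite cmapE.
have [_ ->] := E1 x; have [_ ->] := E2 y; exact: dis.
Qed.

Lemma span_comp_covers2r (S : span B C) (Q Q1 Q2 : span A B) :
  covers2 Q Q1 Q2 ->
  covers2 (span_comp S Q) (span_comp S Q1) (span_comp S Q2).
Proof.
move=> [i1 [i2 [[cov dis inj1 inj2] m1 m2]]].
have /stab_surjP[si ii] := stab_surj_id (apex S).
have [k1 mk1 [ik1 sk1 E1]] := span_comp_map (span_map_id S) m1.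
have [k2 mk2 [ik2 sk2 E2]] := span_comp_map (span_map_id S) m2.
exists k1, k2; split=> //; split; [|move=> x y h E|exact: ik1|exact: ik2].
  move=> p; have [H|H] := cov (bpb_fst _ _ p).
    by left; apply: sk1.
  by right; apply: sk2.
have := congr1 (bpb_fst _ _) E; rewrite cmapE.
have [-> _] := E1 x; have [-> _] := E2 y; exact: dis.
Qed.
End Whiskering.

(** Both apexes consist of triples of points with two connecting arrows; the
    1-cell only rearranges brackets. *)
Lemma span_compA (A B C D : cell0) (R : span C D) (S : span B C) (Q : span A B) :
  covers (span_comp (span_comp R S) Q) (span_comp R (span_comp S Q)).
Proof.
pose QS := span_comp S Q; pose P := span_comp R QS.
pose g2 : cell1 (apex P) (apex (span_comp R S)) :=
  @bpb_pair _ _ _ _ _ _ (cell1_comp (bpb_snd (legr Q) (legl S))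
     (bpb_fst (legr QS) (legl R))) (bpb_snd (legr QS) (legl R))
     (bpb_cell2 (legr QS) (legl R)).
pose i : cell1 (apex P) (apex (span_comp (span_comp R S) Q)) :=
  @bpb_pair _ _ _ (legr Q) (legl (span_comp R S)) _ (cell1_comp (bpb_fst (legr Q) (legl S))
     (bpb_fst (legr QS) (legl R))) g2
     (whiskerr (bpb_cell2 (legr Q) (legl S)) (bpb_fst (legr QS) (legl R))).
exists i; last by split; constructor; exact: cell2_id.
apply/stab_surjP; split.
  move=> p; have [w [q [k1 [E1 ->]]]] := bpbP p.
  move: E1; have [v [u [k2 [E2 ->]]]] := bpbP q => /= E1.
  have E2' : (legl R) u = gact k2 (legr QS (bpb_mk E1)) by [].
  exists (bpb_mk E2'), 1; rewrite gact1.
  by apply: bpb_mk_eq => //; exact: bpb_mk_eq.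
move=> p p' [l [j m]].
have [q [u [k2 [E2 ->]]]] := bpbP p; move: E2.
have [w [v [k1 [E1 ->]]]] := bpbP q => E2.
have [q' [u' [k2' [E2' ->]]]] := bpbP p'; move: E2'.
have [w' [v' [k1' [E1' ->]]]] := bpbP q' => E2' /bpb_mk_inj[].
move=> /= Ew /bpb_mk_inj[/= Ev Eu Ek2] Ek1.
exists ((l, j), m) => //.
change (bpb_mk E2' = bpb_act (f1 := legr QS) (f2 := legl R) ((l, j), m) (bpb_mk E2)).
apply: bpb_mk_eq => //=.
change (bpb_mk E1' = bpb_act (f1 := legr Q) (f2 := legl S) (l, j) (bpb_mk E1)).
exact: bpb_mk_eq.
Qed.

Section Legs.
Variables A B C : cell0.

(** The apex is a bipullback along an identity, hence is mapped to the apex of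
    S by the base change of a stab-surjective 1-cell. *)
Lemma span_comp_pull (f : cell1 B A) (S : span B C) :
  covers (Span (cell1_comp f (legl S)) (legr S)) (span_comp S (span_pull f)).
Proof.
exists (bpb_snd (cell1_id B) (legl S)).
  exact/bpb_snd_surj/stab_surj_id.
split; constructor; last exact: cell2_id.
exact: (whiskerl f (bpb_cell2 (cell1_id B) (legl S))).
Qed.

Lemma span_push_comp (f : cell1 B C) (S : span A B) :
  covers (Span (legl S) (cell1_comp f (legr S))) (span_comp (span_push f) S).
Proof.
exists (bpb_fst (legr S) (cell1_id B)).
  exact/bpb_fst_surj/stab_surj_id.
split; constructor; first exact: cell2_id.
exact: (whiskerl f (cell2_inv (bpb_cell2 (legr S) (cell1_id B)))).
Qed.
End Legs.

Lemma cell1_comp1l (A B : cell0) (f : cell1 A B) : cell1_comp (cell1_id B) f = f.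
Proof. exact: cell1_ext. Qed.

Lemma cell1_comp1r (A B : cell0) (f : cell1 A B) : cell1_comp f (cell1_id A) = f.
Proof. exact: cell1_ext. Qed.

Lemma span_comp1r (A B : cell0) (S : span A B) : covers S (span_comp S (span_id A)).
Proof.
have := span_comp_pull (cell1_id A) S; rewrite cell1_comp1l.
by case: S.
Qed.

Lemma span_comp1l (A B : cell0) (S : span A B) : covers S (span_comp (span_id B) S).
Proof.
have := span_push_comp (cell1_id B) S; rewrite cell1_comp1l.
by case: S.
Qed.

Lemma span_legsE (A B : cell0) (S : span A B) :
  covers S (span_comp (span_push (legr S)) (span_pull (legl S))).
Proof.
have := span_comp_pull (legl S) (span_push (legr S)); rewrite cell1_comp1r.
by case: S.
Qed.

Lemma span_pullM (A B C : cell0) (b : cell1 B C) (a : cell1 A B) :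
  covers (span_pull (cell1_comp b a)) (span_comp (span_pull a) (span_pull b)).
Proof. exact: (span_comp_pull b (span_pull a)). Qed.

Lemma span_pushM (A B C : cell0) (b : cell1 B C) (a : cell1 A B) :
  covers (span_push (cell1_comp b a)) (span_comp (span_push b) (span_push a)).
Proof. exact: (span_push_comp b (span_push a)). Qed.

Lemma span_pull_cell2 (A B : cell0) (a a' : cell1 A B) :
  cell2 a a' -> covers (span_pull a) (span_pull a').
Proof.
move=> e; exists (cell1_id _); first exact: stab_surj_id.
by split; constructor; [exact: cell2_inv|exact: cell2_id].
Qed.

Lemma span_push_cell2 (A B : cell0) (a a' : cell1 A B) :
  cell2 a a' -> covers (span_push a) (span_push a').
Proof.
move=> e; exists (cell1_id _); first exact: stab_surj_id.
by split; constructor; [exact: cell2_id|exact: cell2_inv].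
Qed.

(** Both composites are represented by the span with legs a and a, and a itself
    maps that span onto the identity span. *)
Lemma span_deflation (A B : cell0) (a : cell1 A B) : stab_surjective a ->
  covers (span_id B) (span_comp (span_push a) (span_pull a)).
Proof.
move=> sa; apply: covers_trans _ (span_legsE (Span a a)).
exists a => //; split; constructor; exact: cell2_id.
Qed.

(** * Equivalences of categories *)

(** The inverse functor is chosen object by object, and on arrows by lifting
    conjugates along F. *)
Lemma equivalence_of_full_faithful (C D : category) (F : functor C D) :
  (forall Y : D, exists X (f : hom (F X) Y), is_iso f) ->
  (forall (X X' : C) (g : hom (F X) (F X')), exists f : hom X X', fmap F f = g) ->
  (forall (X X' : C) (f f' : hom X X'), fmap F f = fmap F f' -> f = f') ->
  is_equivalence F.
Proof.
move=> ess full faithful.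
have G0 Y : {X : C & {f : hom (F X) Y &
    {g : hom Y (F X) | compm g f = idm (F X) /\ compm f g = idm Y}}}.
  by have /cid[X /cid[f /cid[g fg]]] := ess Y; exists X, f, g.
pose G Y := projT1 (G0 Y).
pose u Y : hom (F (G Y)) Y := projT1 (projT2 (G0 Y)).
pose v Y : hom Y (F (G Y)) := sval (projT2 (projT2 (G0 Y))).
have vu Y : compm (v Y) (u Y) = idm (F (G Y)).
  by have [] := svalP (projT2 (projT2 (G0 Y))).
have uv Y : compm (u Y) (v Y) = idm Y.
  by have [] := svalP (projT2 (projT2 (G0 Y))).
pose lift X X' (g : hom (F X) (F X')) := sval (cid (full X X' g)).
have liftK X X' g : fmap F (@lift X X' g) = g := svalP (cid (full X X' g)).
pose Gm Y Y' (h : hom Y Y') : hom (G Y) (G Y') :=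
  lift _ _ (compm (v Y') (compm h (u Y))).
have Gm1 Y : Gm Y Y (idm Y) = idm (G Y).
  by apply: faithful; rewrite liftK comp1m vu fmap1.
have GmM Y Y' Y'' (h' : hom Y' Y'') (h : hom Y Y') :
    Gm _ _ (compm h' h) = compm (Gm _ _ h') (Gm _ _ h).
  apply: faithful; rewrite fmapM !liftK !compmA.
  by rewrite -[compm (compm (compm _ h') _) (v Y')]compmA uv compm1.
pose GF := Functor Gm1 GmM.
exists GF; split.
  have nat X X' (f : hom X X') :
      compm (fmap (functor_id C) f) (lift _ _ (u (F X))) =
      compm (lift _ _ (u (F X'))) (fmap (functor_comp GF F) f).
    apply: faithful; rewrite /= !fmapM !liftK !compmA.
    by rewrite uv comp1m.
  exists (@NatTrans _ _ (functor_comp GF F) (functor_id C) _ nat) => X.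
  exists (lift X (G (F X)) (v (F X))); split; apply: faithful;
    by rewrite /= fmapM !liftK ?vu ?uv fmap1.
have nat Y Y' (h : hom Y Y') : compm (fmap (functor_id D) h) (u Y) =
   compm (u Y') (fmap (functor_comp F GF) h).
  by rewrite /= liftK !compmA uv comp1m.
exists (@NatTrans _ _ (functor_comp F GF) (functor_id D) _ nat) => Y.
by exists (v Y); split; [exact: vu|exact: uv].
Qed.

Section OfEquivalence.
Variables (C D : category) (F : functor C D).
Hypothesis eqF : is_equivalence F.

Lemma equivalence_ess_surj (Y : D) : exists X (f : hom (F X) Y), is_iso f.
Proof. by have [G [_ [t ti]]] := eqF; exists (G Y), (t Y); exact: ti. Qed.

(** Faithfulness of the inverse G reduces the equation to one after applying
    GF, which is conjugate to the identity. *)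
Lemma equivalence_full (X X' : C) (g : hom (F X) (F X')) :
  exists f : hom X X', fmap F f = g.
Proof.
have [G [[s si] [t ti]]] := eqF.
have faithG (Y Y' : D) (h h' : hom Y Y') : fmap G h = fmap G h' -> h = h'.
  move=> E; have [t' [_ tt']] := ti Y.
  have := ncomp_nat t h; have := ncomp_nat t h' => /=; rewrite E => <-.
  by move/(congr1 (fun z => compm z t')); rewrite -!compmA tt' !compm1.
have [s' [s's ss']] := si X; have [r [rs sr]] := si X'.
exists (compm (s X') (compm (fmap G g) s')); apply: faithG.
have := ncomp_nat s (compm (s X') (compm (fmap G g) s')) => /=.
move/(congr1 (compm r)); rewrite !compmA rs !comp1m => <-.
by rewrite -compmA s's compm1.
Qed.

Lemma equivalence_faithful (X X' : C) (f f' : hom X X') :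
  fmap F f = fmap F f' -> f = f'.
Proof.
have [G [[s si] _]] := eqF => E; have [s' [_ ss']] := si X.
have := ncomp_nat s f; have := ncomp_nat s f'; rewrite /= E => <-.
by move/(congr1 (fun z => compm z s')); rewrite -!compmA ss' !compm1.
Qed.
End OfEquivalence.

(** * Bipullbacks seen by spans *)

Definition at_pt (A : cell0) (x : cset A) : cell1 (point 'I_1) A :=
  @Cell1 (point 'I_1) A (fun _ => x) (fun _ _ => 1)
    (fun _ _ => esym (gact1 x)) (fun _ _ _ => esym (mul1g 1)).

Program Definition at_pt_cell2 (A : cell0) (f f' : cell1 (point 'I_1) A) g
    (E : f' tt = gact g (f tt)) : cell2 f f' :=
  @Cell2 (point 'I_1) A f f' (ctheta f) (ctheta f') (fun _ => g) _ _.
Next Obligation. by move=> A f f' g E []. Qed.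
Next Obligation.
move=> A f f' g E [] i.
have -> : i = 1 by apply: val_inj; case: i => -[].
by rewrite !ctheta1 mulg1 mulgV.
Qed.

(** An arbitrary bipullback maps to the explicit one. Testing its universal
    property on a point with trivial group suffices: existence there says that
    every point of the explicit bipullback is hit up to the action, and
    uniqueness there lifts arrows. *)
Lemma bipullback_covers (X Y Z W : cell0) (a : cell1 X Z) (b : cell1 Y Z)
    (c : cell1 W X) (d : cell1 W Y)
    (k : cell2 (cell1_comp a c) (cell1_comp b d)) : is_bipullback k ->
  covers (span_comp (span_pull a) (span_push b)) (Span d c).
Proof.
move=> bp; exists (bpb_pair (cell2_inv k)).
  apply/stab_surjP; split.
    move=> p; have [y [x [h [E ->]]]] := bpbP p.
    have E' : b y = gact h^-1 (a x) by rewrite E gactK.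
    pose e := @at_pt_cell2 Z (cell1_comp a (at_pt x)) (cell1_comp b (at_pt y))
      _ E'.
    have [[g [x1 [x2 T]]] _] := bp _ (at_pt x) (at_pt y) e.
    have {}T : h^-1 * ctheta a (c (g tt)) (x1 tt) =
      ctheta b (d (g tt)) (x2 tt) * k (g tt).
      exact: (congr1 (fun z : @cell2 (point 'I_1) _ _ _ => z tt) T).
    exists (g tt), (x2 tt, x1 tt); apply: bpb_mk_eq.
    - exact: (tmapE x2 tt).
    - exact: (tmapE x1 tt).
    - rewrite /=; apply: (mulgI h^-1); rewrite !mulgA T mulVg.
      by rewrite mulgK mulgV.
  move=> w w' [v u] /bpb_mk_inj /= [dw cw kw].
  pose c' := cell1_comp c (at_pt w'); pose d' := cell1_comp d (at_pt w').
  pose e : cell2 (cell1_comp a c') (cell1_comp b d') := whiskerr k (at_pt w').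
  have [_ /(_ (at_pt w))] := bp _ c' d' e.
  move=> /(_ (at_pt_cell2 (f' := c') (f := cell1_comp c (at_pt w)) (esym cw))).
  move=> /(_ (at_pt_cell2 (f' := d') (f := cell1_comp d (at_pt w)) (esym dw))).
  move=> /(_ (at_pt w') (cell2_id _) (cell2_id _)) [].
  - apply: cell2_ext => -[] /=.
    have /(canRL invgK) -> := esym kw.
    by rewrite !invMg !invgK !mulgA mulgKV.
  - by apply: cell2_ext => -[] /=; rewrite !ctheta1 mulg1 mul1g.
  move=> z [[z1 z2] _]; exists (z tt); first exact: (tmapE z tt).
  have /= := congr1 (fun z : @cell2 (point 'I_1) _ _ _ => z tt) z1.
  have /= := congr1 (fun z : @cell2 (point 'I_1) _ _ _ => z tt) z2.
  by rewrite !mul1g => -> ->.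
by split; constructor; exact: cell2_id.
Qed.

(** * Bicoproducts *)

Section SubCell.
Variables (A : cell0) (D : pred (cset A)).
Hypothesis D_inv : forall x g, D (gact g x) = D x.

(** Invariant subsets keep the whole group, so that a 0-cell decomposes without
    changing its group. *)
Program Definition sub_gset : gset (cgrp A) :=
  @GSet (cgrp A) {x : cset A | D x}
    (fun g x => exist _ (gact g (sval x)) _) _ _.
Next Obligation. by move=> g [x Dx] /=; rewrite D_inv. Qed.
Next Obligation. by move=> x; apply: val_inj; rewrite /= gact1. Qed.
Next Obligation. by move=> g h x; apply: val_inj; rewrite /= gactM. Qed.

Definition sub_cell : cell0 := Cell0 sub_gset.

Definition sub_in : cell1 sub_cell A :=
  @Cell1 sub_cell A (fun x => sval x) (fun _ g => g)
    (fun _ _ => erefl) (fun _ _ _ => erefl).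

Lemma sub_in_inj : stab_inj sub_in.
Proof. by move=> x x' h E; exists h => //; apply: val_inj. Qed.

Lemma sub_in_orbits x : D x -> in_orbits sub_in x.
Proof. by move=> Dx; exists (exist _ x Dx), 1; rewrite gact1. Qed.
End SubCell.

Lemma joint_cover_of_compl (A B : cell0) (a : cell1 B A) (D : pred (cset A))
    (D_inv : forall x g, D (gact g x) = D x) :
  stab_inj a -> (forall x, D x <-> ~ in_orbits a x) ->
  joint_cover a (sub_in D_inv).
Proof.
move=> ai DE; split=> //; last exact: sub_in_inj.
  move=> x; have [Dx|nDx] := boolP (D x); first by right; exact: sub_in_orbits.
  by left; apply: contrapT => /DE; exact/negP.
move=> x y h /= E; have /= Dy := valP y.
by apply: (iffLR (DE _) Dy); exists x, h; rewrite E.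
Qed.

Section Complement.
Variables (A : cell0) (D : pred (cset A)).
Hypothesis D_inv : forall x g, D (gact g x) = D x.

Lemma compl_inv x g : ~~ D (gact g x) = ~~ D x.
Proof. by rewrite D_inv. Qed.

Let i1 := sub_in D_inv.
Let i2 := sub_in compl_inv.

(** The carriers of the two parts are types of their own; this glues functions
    on them to a function on the whole set. *)
Definition by_cases (T : Type) (f1 : cset (sub_cell D_inv) -> T)
    (f2 : cset (sub_cell compl_inv) -> T) (x : cset A) : T :=
  match decP (@idP (D x)) with
  | left Dx => f1 (exist _ x Dx)
  | right nDx => f2 (exist _ x (introN idP nDx))
  end.

Lemma by_casesl T f1 f2 x : @by_cases T f1 f2 (i1 x) = f1 x.
Proof.
rewrite /by_cases; case: x => x Dx /=; case: decP => // p.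
by congr (f1 (exist _ x _)); exact: bool_irrelevance.
Qed.

Lemma by_casesr T f1 f2 x : @by_cases T f1 f2 (i2 x) = f2 x.
Proof.
rewrite /by_cases; case: x => x Dx /=; case: decP => p.
  by exfalso; exact/(negP Dx).
by congr (f2 (exist _ x _)); exact: bool_irrelevance.
Qed.

Lemma sub_case (P : cset A -> Prop) :
  (forall x, P (i1 x)) -> (forall x, P (i2 x)) -> forall x, P x.
Proof.
move=> P1 P2 x; have [Dx|nDx] := boolP (D x); first exact: (P1 (exist _ x Dx)).
exact: (P2 (exist _ x nDx)).
Qed.

Lemma sub_gact1 x g : gact g (i1 x) = i1 (gact g x). Proof. by []. Qed.
Lemma sub_gact2 x g : gact g (i2 x) = i2 (gact g x). Proof. by []. Qed.

(** 1-cells and 2-cells out of A are families indexed by the points of A with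
    conditions along the action, which never leaves a part; so both can be
    glued from the two parts. *)
Lemma sub_bicoproduct : is_bicoproduct i1 i2.
Proof.
move=> X; apply: equivalence_of_full_faithful.
- move=> [b1 b2] /=.
  pose f := by_cases b1 b2; pose t := by_cases (ctheta b1) (ctheta b2).
  have fE x g : f (gact g x) = gact (t x g) (f x).
    elim/sub_case: x => x; rewrite ?sub_gact1 ?sub_gact2 /f /t.
      by rewrite !by_casesl cmapE.
    by rewrite !by_casesr cmapE.
  have tM x g g' : t x (g * g') = t (gact g' x) g * t x g'.
    elim/sub_case: x => x; rewrite ?sub_gact1 ?sub_gact2 /f /t.
      by rewrite !by_casesl cthetaM.
    by rewrite !by_casesr cthetaM.
  exists (@Cell1 A X f t fE tM : hom_cat A X).
  have E1 : cell1_comp (@Cell1 A X f t fE tM) i1 = b1.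
    by apply: cell1_ext => [x|x g] /=; rewrite /f /t by_casesl.
  have E2 : cell1_comp (@Cell1 A X f t fE tM) i2 = b2.
    by apply: cell1_ext => [x|x g] /=; rewrite /f /t by_casesr.
  rewrite /= E1 E2; exists (idm (b1 : hom_cat _ X), idm (b2 : hom_cat _ X)).
  by exists (idm (b1 : hom_cat _ X), idm (b2 : hom_cat _ X)); split;
    congr (_, _); exact: comp1m.
- move=> b b' [e1 e2].
  pose e := by_cases e1 e2.
  have eE x : b' x = gact (e x) (b x).
    elim/sub_case: x => x; rewrite /e.
      by rewrite by_casesl; exact: (tmapE e1).
    by rewrite by_casesr; exact: (tmapE e2).
  have et x g : e (gact g x) * ctheta b x g * (e x)^-1 = ctheta b' x g.
    elim/sub_case: x => x; rewrite ?sub_gact1 ?sub_gact2 /e.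
      by rewrite !by_casesl; exact: (tmap_theta e1).
    by rewrite !by_casesr; exact: (tmap_theta e2).
  exists (@Cell2 A X b b' (ctheta b) (ctheta b') e eE et).
  congr (_, _); apply: cell2_ext => x /=; rewrite /e.
    by rewrite by_casesl.
  by rewrite by_casesr.
- move=> b b' e e' [E1 E2]; apply: cell2_ext; apply: sub_case => x.
    exact: (congr1 (fun f : _ -> _ => f x) E1).
  exact: (congr1 (fun f : _ -> _ => f x) E2).
Qed.
End Complement.

(** Faithfulness of the functor between action groupoids. *)
Definition faithful_cell1 (A B : cell0) (a : cell1 A B) :=
  forall x g g', gact g x = gact g' x -> ctheta a x g = ctheta a x g' -> g = g'.

Definition bool_gset : gset 'I_1 :=
  @GSet 'I_1 bool (fun _ x => x) (fun _ => erefl) (fun _ _ _ => erefl).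

Definition bool_cell : cell0 := Cell0 bool_gset.

Definition indicator (A : cell0) (D : pred (cset A))
    (D_inv : forall x g, D (gact g x) = D x) : cell1 A bool_cell :=
  @Cell1 A bool_cell D (fun _ _ => 1) D_inv (fun _ _ _ => esym (mul1g 1)).

Lemma indicator_cell2 (A : cell0) (D D' : cell1 A bool_cell) : D =1 D' -> cell2 D D'.
Proof.
move=> E; exists (fun _ => 1) => [x|x g]; first by rewrite E.
by apply: val_inj; case: (_ * _) => -[] //; case: (ctheta _ _ _) => -[].
Qed.

Section Bicoproduct.
Variables (A1 A2 P : cell0) (i1 : cell1 A1 P) (i2 : cell1 A2 P).
Hypothesis cop : is_bicoproduct i1 i2.

Lemma bicoproduct_sym : is_bicoproduct i2 i1.
Proof.
move=> X; apply: equivalence_of_full_faithful.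
- move=> [b2 b1]; have [b [f [g [E E']]]] := equivalence_ess_surj (cop X) (b1, b2).
  exists b, (f.2, f.1), (g.2, g.1).
  split; congr (_, _).
  + exact: (congr1 snd E).
  + exact: (congr1 fst E).
  + exact: (congr1 snd E').
  + exact: (congr1 fst E').
- move=> b b' [e2 e1].
  have [e E] := equivalence_full (cop X) (X := b) (X' := b') (e1, e2).
  exists e; congr (_, _); [exact: (congr1 snd E)|exact: (congr1 fst E)].
- move=> b b' e e' E; apply: (equivalence_faithful (cop X)).
  congr (_, _); [exact: (congr1 snd E)|exact: (congr1 fst E)].
Qed.

Lemma bicoproduct_ess (X : cell0) (b1 : cell1 A1 X) (b2 : cell1 A2 X) :
  exists b : cell1 P X, inhabited (cell2 (cell1_comp b i1) b1) /\
                        inhabited (cell2 (cell1_comp b i2) b2).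
Proof.
have [b [f _]] := equivalence_ess_surj (cop X) (b1, b2).
by exists b; split; constructor; [exact: f.1|exact: f.2].
Qed.

Lemma bicoproduct_full (X : cell0) (b b' : cell1 P X)
    (e1 : cell2 (cell1_comp b i1) (cell1_comp b' i1))
    (e2 : cell2 (cell1_comp b i2) (cell1_comp b' i2)) :
  exists e : cell2 b b', (forall x, e (i1 x) = e1 x) /\
                         (forall x, e (i2 x) = e2 x).
Proof.
have [e E] := equivalence_full (cop X) (X := b) (X' := b') (e1, e2).
by exists e; case: E => <- <-.
Qed.

(** Two indicator functions of invariant subsets that agree on both summands are
    2-isomorphic, hence equal. They are compared here for the union of the two
    images and for the whole set. *)
Lemma bicoproduct_cover p : in_orbits i1 p \/ in_orbits i2 p.
Proof.
pose D : pred (cset P) := fun q => `[< in_orbits i1 q \/ in_orbits i2 q >].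
have D_inv x g : D (gact g x) = D x.
  by apply/asboolP/asboolP => -[E|E]; [left|right|left|right];
    first [exact: in_orbits_gact|exact: in_orbitsV E].
pose c1 := indicator (D := predT) (fun (x : cset P) g => erefl).
pose c2 := indicator D_inv.
have D1 : cell2 (cell1_comp c1 i1) (cell1_comp c2 i1).
  apply: indicator_cell2 => x; apply/esym/asboolP; left.
  by exists x, 1; rewrite gact1.
have D2 : cell2 (cell1_comp c1 i2) (cell1_comp c2 i2).
  apply: indicator_cell2 => x; apply/esym/asboolP; right.
  by exists x, 1; rewrite gact1.
have [e _] := bicoproduct_full D1 D2.
have := tmapE e p => /= Dp; exact/asboolP.
Qed.

(** Some indicator function is 1 on the first summand and 0 on the second. *)
Lemma bicoproduct_disjoint x y h : gact h (i1 x) <> i2 y.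
Proof.
pose c1 := indicator (D := predT) (fun (x : cset A1) g => erefl).
pose c2 := indicator (D := pred0) (fun (x : cset A2) g => erefl).
have [s [[e1] [e2]]] := bicoproduct_ess c1 c2.
move=> /(congr1 s); rewrite cmapE /=.
by have /= <- := tmapE e1 x; have /= <- := tmapE e2 y.
Qed.

(** Pair the identity of A1 with a constant 1-cell on A2; the constant is where
    a point of A1 is needed. *)
Lemma bicoproduct_retract (x0 : cset A1) : exists s : cell1 P A1,
  inhabited (cell2 (cell1_comp s i1) (cell1_id A1)).
Proof.
pose c : cell1 A2 A1 := @Cell1 A2 A1 (fun _ => x0) (fun _ _ => 1)
   (fun _ _ => esym (gact1 x0)) (fun _ _ _ => esym (mul1g 1)).
by have [s [e _]] := bicoproduct_ess (cell1_id A1) c; exists s.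
Qed.

Lemma bicoproduct_faithful : faithful_cell1 i1.
Proof.
move=> x g g' E Et; have [s [e]] := bicoproduct_retract x.
have /= H := tmap_theta e x g; have /= H' := tmap_theta e x g'.
by rewrite -H -H' E Et.
Qed.

(** A retraction s of i1 sends an arrow h between images to an arrow of A1, but
    i1 need not send that back to h. It does because i1 s, extended by the
    identity off the orbits of the image of i1, is isomorphic to the identity:
    both restrict to the inclusions. *)
Lemma bicoproduct_stab_inj : stab_inj i1.
Proof.
move=> x x' h hx; have [s [e]] := bicoproduct_retract x.
pose D p : bool := `[< in_orbits i1 p >].
have D_inv p g : D (gact g p) = D p.
  by apply/asboolP/asboolP; [exact: in_orbitsV|exact: in_orbits_gact].
have Di1 y : D (i1 y) by apply/asboolP; exists y, 1; rewrite gact1.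
have Di2 y : D (i2 y) = false.
  by apply/asboolP => -[z [g /esym/bicoproduct_disjoint]].
pose r := cell1_comp i1 s.
pose f p := if D p then r p else p.
pose t p g := if D p then ctheta r p g else g.
have fE p g : f (gact g p) = gact (t p g) (f p).
  by rewrite /f /t D_inv; case: (D p); rewrite // cmapE.
have tM p g g' : t p (g * g') = t (gact g' p) g * t p g'.
  by rewrite /t D_inv; case: (D p); rewrite // cthetaM.
pose T : cell1 P P := @Cell1 P P f t fE tM.
have T1 : cell1_comp T i1 = cell1_comp i1 (cell1_comp s i1).
  by apply: cell1_ext => [y|y g] /=; rewrite /f /t Di1.
have T2 : cell1_comp T i2 = i2.
  by apply: cell1_ext => [y|y g] /=; rewrite /f /t Di2.
have [e1 e1E] : exists e1 : cell2 (cell1_comp T i1) i1,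
    forall y, e1 y = ctheta i1 (s (i1 y)) (e y).
  by rewrite T1; exists (whiskerl i1 e).
have e2 : cell2 (cell1_comp T i2) i2 by rewrite T2; exact: cell2_id.
have [z [zE _]] := bicoproduct_full (b := T) (b' := cell1_id P) e1 e2.
have /= := tmap_theta z (i1 x) h; rewrite hx !zE !e1E /t Di1 /=.
have /= xE := tmapE e x; have /= x'E := tmapE e x' => hE.
pose u := s (i1 x); pose th := ctheta s (i1 x) h.
have uE : gact (e x)^-1 x = u by rewrite {2}xE gactK.
have u'E : gact th u = s (i1 x') by rewrite -hx cmapE.
exists (e x' * th * (e x)^-1).
  by rewrite !gactM uE u'E -x'E.
rewrite -hE !cthetaM uE u'E; congr (_ * _).
by have := cthetaV i1 u (e x); rewrite -xE => ->.
Qed.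
End Bicoproduct.

Lemma bicoproduct_joint_cover (A1 A2 P : cell0) (i1 : cell1 A1 P)
  (i2 : cell1 A2 P) : is_bicoproduct i1 i2 -> joint_cover i1 i2.
Proof.
move=> cop; split.
- exact: bicoproduct_cover.
- exact: bicoproduct_disjoint.
- exact: bicoproduct_stab_inj cop.
- exact: bicoproduct_stab_inj (bicoproduct_sym cop).
Qed.

(** * Spans along the two inclusions of a joint cover *)

Section CoverSpans.
Variables (A1 A2 P : cell0) (i1 : cell1 A1 P) (i2 : cell1 A2 P).

Lemma joint_cover_sym : joint_cover i1 i2 -> joint_cover i2 i1.
Proof.
case=> cov dis inj1 inj2; split=> // [w|x y h /gact_eqV E].
  by have [] := cov w; [right|left].
exact: (dis _ _ _ (esym E)).
Qed.

(** For a fully faithful 1-cell the iso-comma groupoid of i1 with itself is the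
    source again, by the diagonal. *)
Lemma covers_embedding : stab_inj i1 -> faithful_cell1 i1 ->
  covers (span_comp (span_pull i1) (span_push i1)) (span_id A1).
Proof.
move=> inj fai.
exists (@bpb_pair _ _ _ i1 i1 _ (cell1_id A1) (cell1_id A1) (cell2_id i1)); last first.
  by split; constructor; exact: cell2_id.
apply/stab_surjP; split.
  move=> p; have [x [x' [k [E ->]]]] := bpbP p.
  have [g Ex Ek] := inj _ _ _ (esym E).
  exists x, (1, g); apply: bpb_mk_eq => //=; rewrite ?gact1 //.
  by rewrite mulg1 ctheta1 invg1 mulg1.
move=> x x' [l j] /bpb_mk_inj /= [lx jx].
rewrite mulg1 => E; exists l => //; congr (_, _).
have jl : gact j x = gact l x by rewrite lx jx.
apply: fai jl _; apply: (mulIg (ctheta i1 x l)^-1).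
by rewrite mulgV.
Qed.

Lemma joint_cover_disjoint : joint_cover i1 i2 ->
  #|cset (apex (span_comp (span_pull i2) (span_push i1)))| = 0.
Proof.
case=> _ dis _ _; apply: eq_card0 => p.
by have [x [y [k [E _]]]] := bpbP p; case: (dis x y k (esym E)).
Qed.

(** This is the span form of the decomposition of the identity of an object that
    is a direct sum. *)
Lemma covers2_joint_cover : joint_cover i1 i2 ->
  covers2 (span_id P) (span_comp (span_push i1) (span_pull i1))
          (span_comp (span_push i2) (span_pull i2)).
Proof.
move=> cov; apply: covers2_covers (span_legsE (Span i1 i1)) (span_legsE (Span i2 i2)).
by exists i1, i2; split=> //; split; constructor; exact: cell2_id.
Qed.
End CoverSpans.

(** * Orbits *)

Section Orbits.
Variables (A : cell0) (x : cset A).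

Lemma at_stab_inj : stab_inj (at_stab x).
Proof.
move=> [] [] h /= /stabP hx; exists (subg (stab_group x) h) => //=.
by rewrite subgK.
Qed.

Definition off_orbit : pred (cset A) := fun y => `[< ~ in_orbits (at_stab x) y >].

Lemma off_orbit_inv y g : off_orbit (gact g y) = off_orbit y.
Proof.
apply/asboolP/asboolP => H E; apply: H; first exact: in_orbits_gact.
exact: in_orbitsV E.
Qed.

(** The orbit of x is covered by a point on which the stabiliser of x acts; the
    rest of the set keeps the group of A. *)
Lemma orbit_cover : joint_cover (at_stab x) (sub_in off_orbit_inv).
Proof.
apply: joint_cover_of_compl => [|y]; first exact: at_stab_inj.
by split=> /asboolP.
Qed.

Lemma card_off_orbit : #|cset (sub_cell off_orbit_inv)| < #|cset A|.
Proof.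
rewrite /= card_sig; apply: proper_card; apply/properP; split.
  by apply/subsetP.
exists x => //; rewrite unfold_in; apply/asboolP; apply.
by exists tt, 1; rewrite gact1.
Qed.
End Orbits.

(** Induction on the cardinality, which drops when an orbit is removed. *)
Lemma orbit_ind (P : cell0 -> Prop) :
  (forall A, #|cset A| = 0 -> P A) ->
  (forall A x, P (sub_cell (@off_orbit_inv A x)) -> P A) -> forall A, P A.
Proof.
move=> P0 PO A; have [n] := ubnP #|cset A|; elim: n A => // n IHn A.
rewrite ltnS => leAn; have [E|] := eqVneq #|cset A| 0; first exact: P0.
rewrite -lt0n => /card_gt0P[x _]; apply: (PO A x); apply: IHn.
exact: leq_trans (card_off_orbit x) leAn.
Qed.

(** * Bisets as spans between points *)

Lemma prod_mulgE (G1 G2 : finGroupType) (p q : G1 * G2) :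
  p * q = (p.1 * q.1, p.2 * q.2).
Proof. by []. Qed.

Section BisetGSet.
Variables H G : finGroupType.

(** The right action of G is turned into a left action by inversion, so that the
    orbits and stabilisers of a biset are those of an H x G-set. *)
Program Definition biset_gset (U : biset H G) : gset (H * G)%type :=
  @GSet (H * G)%type U (fun p u => ract U (lact U p.1 u) p.2^-1) _ _.
Next Obligation. by move=> U u; rewrite /= invg1 ract1 lact1. Qed.
Next Obligation.
by move=> U p q u; rewrite /= invMg ractM lactM !lractC.
Qed.

Definition biset_cell (U : biset H G) : cell0 := Cell0 (biset_gset U).

Program Definition biset_of_gset (X : gset (H * G)%type) : biset H G :=
  @Biset H G X (@BisetOn H G X (fun h x => gact ((h, 1) : H * G) x)
    (fun x g => gact ((1, g^-1) : H * G) x) _ _ _ _ _).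
Next Obligation. by move=> X x; exact: gact1. Qed.
Next Obligation.
move=> X h h' x; rewrite /= -gactM; congr (gact _ x).
by rewrite prod_mulgE /= mul1g.
Qed.
Next Obligation. by move=> X x; rewrite /= invg1; exact: gact1. Qed.
Next Obligation.
move=> X x g g'; rewrite /= -gactM; congr (gact _ x).
by rewrite prod_mulgE /= invMg mul1g.
Qed.
Next Obligation.
move=> X h x g; rewrite /= -!gactM; congr (gact _ x).
by rewrite !prod_mulgE /= !mul1g !mulg1.
Qed.

Lemma biset_of_gsetE (X : gset (H * G)%type) p (x : X) :
  @gact _ (biset_gset (biset_of_gset X)) p x = gact p x.
Proof.
rewrite /= -gactM; congr (gact _ x); rewrite prod_mulgE /= invgK mul1g mulg1.
by case: p.
Qed.

Lemma lact_gact (U : biset H G) h u :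
  lact U h u = @gact _ (biset_gset U) (h, 1) u.
Proof. by rewrite /= invg1 ract1. Qed.

Lemma ract_gact (U : biset H G) u g :
  ract U u g = @gact _ (biset_gset U) (1, g^-1) u.
Proof. by rewrite /= invgK lact1. Qed.

Lemma biset_iso_gact (U V : biset H G) (f : U -> V) :
  (forall p u, f (@gact _ (biset_gset U) p u) =
               @gact _ (biset_gset V) p (f u)) ->
  injective f -> (forall v, exists u, f u = v) -> biset_iso U V.
Proof.
move=> fE fi fs; apply: biset_isoW fi fs _ _ => [h x|x g].
  by rewrite !lact_gact fE.
by rewrite !ract_gact fE.
Qed.

Definition biset_legl (U : biset H G) : cell1 (biset_cell U) (point G) :=
  @Cell1 (biset_cell U) (point G) (fun _ => tt) (fun _ p => p.2)
    (fun _ _ => erefl) (fun _ _ _ => erefl).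

Definition biset_legr (U : biset H G) : cell1 (biset_cell U) (point H) :=
  @Cell1 (biset_cell U) (point H) (fun _ => tt) (fun _ p => p.1)
    (fun _ _ => erefl) (fun _ _ _ => erefl).

Definition biset_span (U : biset H G) : span (point G) (point H) :=
  Span (biset_legl U) (biset_legr U).

Definition legs_theta (S : span (point G) (point H)) w l : H * G :=
  (ctheta (legr S) w l, ctheta (legl S) w l).
Arguments legs_theta S w l : clear implicits.

Lemma point_cell2 (A : cell0) (K : finGroupType) (f f' : cell1 A (point K)) :
  (forall x g, ctheta f x g = ctheta f' x g) -> cell2 f f'.
Proof.
move=> E; exists (fun _ => 1) => [x|x g]; first by case: (f' x); case: (f x).
by rewrite mul1g invg1 mulg1.
Qed.

Lemma span_map_biset (U : biset H G) (S : span (point G) (point H))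
    (i : cell1 (apex S) (biset_cell U)) :
  ctheta i =2 legs_theta S -> span_map (T := biset_span U) (S := S) i.
Proof. by move=> E; split; constructor; apply: point_cell2 => x g /=; rewrite E. Qed.

(** The two 2-cells of a span map into a biset are functions to H and to G;
    moving each image point by the inverse of their pair makes both 2-cells
    trivial, and the cocycle becomes the pair of cocycles of the legs. *)
Lemma span_map_strict (U : biset H G) (S : span (point G) (point H))
    (i : cell1 (apex S) (biset_cell U)) : span_map (T := biset_span U) (S := S) i ->
  exists t : cell1 (apex S) (biset_cell U),
    [/\ ctheta t =2 legs_theta S, forall u, in_orbits t u <-> in_orbits i u &
        stab_inj i -> stab_inj t].
Proof.
case=> [[el] [er]].
pose q w : H * G := (er w, el w).
have qE w l : q (gact l w) * legs_theta S w l = ctheta i w l * q w.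
  rewrite [RHS]surjective_pairing [LHS]surjective_pairing.
  by congr (_, _); [exact: (tmap_thetaE er)|exact: (tmap_thetaE el)].
pose f w : cset (biset_cell U) := gact (q w)^-1 (i w).
have fq w : gact (q w) (f w) = i w by rewrite /f gactKV.
have fE w l : f (gact l w) = gact (legs_theta S w l) (f w).
  have -> : legs_theta S w l = (q (gact l w))^-1 * (ctheta i w l * q w).
    by rewrite -qE mulKg.
  by rewrite /f cmapE -!gactM -!mulgA mulgV mulg1.
have fM w l l' : legs_theta S w (l * l') =
    legs_theta S (gact l' w) l * legs_theta S w l'.
  by rewrite /legs_theta !cthetaM.
exists (@Cell1 (apex S) (biset_cell U) f (legs_theta S) fE fM); split=> //.
  move=> u; split=> -[w [p ->]].
    by exists w, (p * (q w)^-1); rewrite gactM.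
  by exists w, (p * q w); rewrite gactM [gact (q w) _]fq.
move=> ii w w' p E; have {}E : gact p (f w) = f w' := E.
have : gact (q w' * p * (q w)^-1) (i w) = i w'.
  by rewrite !gactM -[gact (q w)^-1 _]/(f w) E fq.
move=> /ii[l -> F]; exists l => //; apply: (mulgI (q (gact l w))).
by rewrite qE -F mulgKV.
Qed.

Section Represent.
Variables (U V : biset H G) (S : span (point G) (point H)).

Lemma covers_bisetP : covers (biset_span U) S <->
  exists2 t : cell1 (apex S) (biset_cell U),
    ctheta t =2 legs_theta S & stab_surjective t.
Proof.
split=> [[i /stab_surjP[si ii]] /span_map_strict[t [tE to ti]]|[t tE st]].
  by exists t => //; apply/stab_surjP; split=> [u|]; [apply/to|exact: ti].
by exists t => //; exact: span_map_biset.
Qed.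

(** A cover presents U by generators s w, for w in the apex, with the relations
    given by the cocycle alone. So a strict map into another biset extends
    equivariantly to U. *)
Lemma covers_biset_map (i : cell1 (apex S) (biset_cell V)) :
  covers (biset_span U) S -> span_map (T := biset_span V) (S := S) i ->
  exists f : U -> V,
   [/\ forall p u, f (@gact _ (biset_gset U) p u) = @gact _ (biset_gset V) p (f u),
       forall u, in_orbits i (f u : cset (biset_cell V)),
       forall v : cset (biset_cell V), in_orbits i v -> exists u, f u = v &
       stab_inj i -> injective f].
Proof.
move=> /covers_bisetP[s sE /stab_surjP[ss si]] /span_map_strict[t [tE to ti]].
have /choice[f0 f0P] : forall u : cset (biset_cell U), exists wp :
    cset (apex S) * (H * G), u = gact wp.2 (s wp.1).
  by move=> u; have [w [p E]] := ss u; exists (w, p).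
pose f u : cset (biset_cell V) := gact (f0 u).2 (t (f0 u).1).
have fE p w : f (gact p (s w)) = gact p (t w).
  have E := f0P (gact p (s w)); rewrite /f; move: (f0 _) E => [w' p'] E.
  have {}E : gact p (s w) = gact p' (s w') := E.
  rewrite -[LHS]/(gact p' (t w')).
  have [|l -> Ep] := si w w' (p'^-1 * p); first by rewrite gactM E gactK.
  by rewrite cmapE -gactM tE -sE -Ep mulKVg.
exists f; split.
- move=> p u; have [w [q ->]] := ss u.
  by rewrite -[LHS]/(f (gact p (gact q (s w)))) -gactM !fE gactM.
- move=> u; have [w [p ->]] := ss u; rewrite fE.
  by apply/in_orbits_gact/to; exists w, 1; rewrite gact1.
- move=> v /to[w [p ->]]; exists (gact p (s w)); exact: fE.
- move=> /ti{}ti u u'; have [w [p ->]] := ss u; have [w' [p' ->]] := ss u'.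
  rewrite !fE => /esym E; have [|l -> Ep] := ti w w' (p'^-1 * p).
    by rewrite gactM -E gactK.
  by rewrite cmapE -gactM sE -tE -Ep mulKVg.
Qed.
End Represent.

(** Each summand maps to U by the presentation above; the images are disjoint
    and exhaust U because the two spans cover jointly. *)
Lemma covers_biset_sum (U U1 U2 : biset H G) (S S1 S2 : span (point G) (point H)) :
  covers2 S S1 S2 -> covers (biset_span U) S -> covers (biset_span U1) S1 ->
  covers (biset_span U2) S2 -> biset_iso (biset_sum U1 U2) U.
Proof.
move=> c2 c cU1 cU2.
have [i1 [i2 [[cov dis inj1 inj2] m1 m2]]] := covers_covers2 c c2.
have [f1 [E1 o1 s1 j1]] := covers_biset_map cU1 m1.
have [f2 [E2 o2 s2 j2]] := covers_biset_map cU2 m2.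
have nE u1 u2 : f1 u1 <> f2 u2.
  have [x [p ->]] := o1 u1; have [y [q ->]] := o2 u2 => E.
  by apply: (dis x y (q^-1 * p)); rewrite gactM E gactK.
apply: (@biset_iso_gact (biset_sum U1 U2) U
  (fun u => match u with inl u => f1 u | inr u => f2 u end)).
- by move=> p [] u; [exact: E1|exact: E2].
- move=> [] u [] u'; first by move/(j1 inj1) ->.
  + by move/nE.
  + by move/esym/nE.
  + by move/(j2 inj2) ->.
- move=> v; have [/s1[u <-]|/s2[u <-]] := cov v; first by exists (inl u).
  by exists (inr u).
Qed.

Lemma covers_biset_unique (U V : biset H G) (S : span (point G) (point H)) :
  covers (biset_span U) S -> covers (biset_span V) S -> biset_iso U V.
Proof.
move=> cU [i /stab_surjP[si ii] mi].
have [f [fE fo fs fi]] := covers_biset_map cU mi.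
by apply: (@biset_iso_gact U V f) => // [|v]; [exact: fi|exact: fs].
Qed.

Lemma covers_biset_iso (U V : biset H G) :
  biset_iso U V -> covers (biset_span V) (biset_span U).
Proof.
case=> f [[g fK gK] fl fr].
have fE u p : f (@gact _ (biset_gset U) p u) = @gact _ (biset_gset V) p (f u).
  by rewrite /= fr fl.
pose i := @Cell1 (biset_cell U) (biset_cell V) f (fun _ p => p) fE
  (fun _ _ _ => erefl).
exists i; last by apply: span_map_biset => u [].
apply/stab_surjP; split=> [v|u u' p].
  by exists (g v), 1; rewrite gact1 /= gK.
by rewrite -(cmapE i) => /(can_inj fK) <-; exists p.
Qed.

Lemma covers2_biset_sum (U V : biset H G) :
  covers2 (biset_span (biset_sum U V)) (biset_span U) (biset_span V).
Proof.
pose i1 : cell1 (biset_cell U) (biset_cell (biset_sum U V)) :=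
  @Cell1 (biset_cell U) (biset_cell (biset_sum U V)) inl (fun _ p => p)
    (fun _ _ => erefl) (fun _ _ _ => erefl).
pose i2 : cell1 (biset_cell V) (biset_cell (biset_sum U V)) :=
  @Cell1 (biset_cell V) (biset_cell (biset_sum U V)) inr (fun _ p => p)
    (fun _ _ => erefl) (fun _ _ _ => erefl).
exists i1, i2; split; try by apply: span_map_biset => u [].
split=> //.
- by case=> u; [left|right]; exists u, 1; rewrite gact1.
- by move=> u u' p [] E; exists p.
- by move=> u u' p [] E; exists p.
Qed.

(** Any span between points covers a biset. Its legs give a cocycle with values
    in H x G, along which the apex W is induced: the biset is the quotient of
    (H x G) x W by the acting group of W. *)
Section Induction.
Variable S : span (point G) (point H).
Let J : finGroupType := (H * G)%type.
Let th := legs_theta S.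

Definition ind_rel (x y : J * cset (apex S)) :=
  [exists l, (y.2 == gact l x.2) && (x.1 == y.1 * th x.2 l)].

Lemma ind_relP x y : reflect (exists l, y.2 = gact l x.2 /\ x.1 = y.1 * th x.2 l)
  (ind_rel x y).
Proof.
apply: (iffP existsP) => -[l]; first by case/andP=> /eqP ? /eqP ?; exists l.
by case=> E E'; exists l; apply/andP; split; apply/eqP.
Qed.

Lemma th_unit w : th w 1 = 1.
Proof. by rewrite /th /legs_theta !ctheta1. Qed.

Lemma th_mul w l l' : th w (l * l') = th (gact l' w) l * th w l'.
Proof. by rewrite /th /legs_theta !cthetaM. Qed.

Lemma ind_rel_refl : reflexive ind_rel.
Proof. by move=> x; apply/ind_relP; exists 1; rewrite gact1 th_unit mulg1. Qed.

Lemma ind_rel_trans : transitive ind_rel.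
Proof.
move=> y x z /ind_relP[l [E F]] /ind_relP[l' [E' F']].
apply/ind_relP; exists (l' * l); split; first by rewrite E' E gactM.
by rewrite F F' th_mul E mulgA.
Qed.

Lemma ind_rel_symW x y : ind_rel x y -> ind_rel y x.
Proof.
case/ind_relP=> l [E F]; apply/ind_relP; exists l^-1.
rewrite E gactK; split=> //; have := th_mul (gact l x.2) l l^-1.
by rewrite mulgV th_unit gactK F -mulgA => <-; rewrite mulg1.
Qed.

Lemma ind_rel_sym : symmetric ind_rel.
Proof. by move=> x y; apply/idP/idP; exact: ind_rel_symW. Qed.

Canonical ind_equiv := EquivRel ind_rel ind_rel_refl ind_rel_sym ind_rel_trans.

Definition ind_car := {eq_quot ind_equiv}.
HB.instance Definition _ := Choice.on ind_car.
HB.instance Definition _ : isCountable ind_car :=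
  CanIsCountable (reprK : cancel repr \pi_{eq_quot ind_equiv}).
HB.instance Definition _ : isFinite ind_car :=
  CanIsFinite (reprK : cancel repr \pi_{eq_quot ind_equiv}).

Definition ind_pi (p : J) w : ind_car := \pi_{eq_quot ind_equiv} (p, w).

Lemma ind_piP p w p' w' : ind_pi p w = ind_pi p' w' <->
  exists l, w' = gact l w /\ p = p' * th w l.
Proof.
split=> [/eqmodP/ind_relP//|E].
by apply/eqmodP/ind_relP.
Qed.

Lemma ind_carP (q : ind_car) : exists p w, q = ind_pi p w.
Proof.
by exists (repr q).1, (repr q).2; rewrite /ind_pi -surjective_pairing [RHS]reprK.
Qed.

Definition ind_act (p : J) (q : ind_car) : ind_car :=
  ind_pi (p * (repr q).1) (repr q).2.

Lemma ind_actE p q w : ind_act p (ind_pi q w) = ind_pi (p * q) w.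
Proof.
rewrite /ind_act; have : ind_pi (repr (ind_pi q w)).1 (repr (ind_pi q w)).2 = ind_pi q w.
  by rewrite {1}/ind_pi -surjective_pairing [LHS]reprK.
move: (repr _).1 (repr _).2 => q' w' /ind_piP[l [E F]].
by apply/ind_piP; exists l; rewrite F mulgA.
Qed.

Program Definition ind_gset : gset J := @GSet J ind_car ind_act _ _.
Next Obligation.
by move=> q; have [p [w ->]] := ind_carP q; rewrite ind_actE mul1g.
Qed.
Next Obligation.
by move=> g h q; have [p [w ->]] := ind_carP q; rewrite !ind_actE mulgA.
Qed.

Lemma covers_biset_exists : exists U : biset H G, covers (biset_span U) S.
Proof.
exists (biset_of_gset ind_gset).
have iE w l : ind_pi 1 (gact l w) =
  @gact _ (biset_gset (biset_of_gset ind_gset)) (th w l) (ind_pi 1 w).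
  rewrite biset_of_gsetE /= ind_actE mulg1; apply/esym/ind_piP.
  by exists l; rewrite mul1g.
pose i := @Cell1 (apex S) (biset_cell (biset_of_gset ind_gset)) (ind_pi 1) th iE th_mul.
apply/covers_bisetP; exists i => //; apply/stab_surjP; split.
  move=> u; have [p [w ->]] := ind_carP u; exists w, p.
  by rewrite [RHS]biset_of_gsetE /= ind_actE mulg1.
move=> w w' p; rewrite [gact _ _]biset_of_gsetE /= ind_actE mulg1.
by case/ind_piP=> l [-> ->]; exists l; rewrite ?mul1g.
Qed.
End Induction.

End BisetGSet.
Arguments legs_theta {H G} S w l.

(** The image of the point is the unit of G, whose stabiliser in G x G is the
    diagonal. *)
Lemma covers_biset_id (G : finGroupType) :
  covers (biset_span (biset_id G)) (span_id (point G)).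
Proof.
apply/covers_bisetP.
have iE (x : unit) (g : G) : (1 : G) = gact (g0 := biset_gset (biset_id G)) (g, g) (1 : G).
  by rewrite /= mulg1 mulgV.
pose i := @Cell1 (point G) (biset_cell (biset_id G)) (fun _ => (1 : G))
  (fun _ g => (g, g)) iE (fun _ _ _ => erefl).
exists i => //; apply/stab_surjP; split.
  by move=> g; exists tt, (g, 1); rewrite /= invg1 !mulg1.
move=> [] [] [g g'] /=; rewrite mulg1 => /(canRL (mulgKV _)) ->.
by rewrite mul1g; exists g'.
Qed.

(** A point (u, v, h) of the apex of the composite, where h is an arbitrary
    element of the middle group, is sent to the class of (v, h u). *)
Lemma covers_biset_prod (K H G : finGroupType) (V : biset K H) (U : biset H G) :
  covers (biset_span (biset_prod V U)) (span_comp (biset_span V) (biset_span U)).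
Proof.
set S := span_comp _ _.
pose f (p : cset (apex S)) : biset_prod V U :=
  prod_pi (val p).1.2 (lact U (val p).2 (val p).1.1).
have actE (q : K * G) v u :
    @gact _ (biset_gset (biset_prod V U)) q (prod_pi v u) =
    prod_pi (lact V q.1 v) (ract U u q.2^-1).
  by rewrite /= prod_lactE prod_ractE.
have fE p l : f (gact l p) = @gact _ (biset_gset (biset_prod V U)) (legs_theta S p l) (f p).
  have [u [v [h [E ->]]]] := bpbP p; rewrite actE /f /=.
  rewrite prod_pi_bal -!lactM !lractC -!lactM; congr (prod_pi _ (ract U (lact U _ u) _)).
  by rewrite -!mulgA mulVg mulg1 mulKg.
have fM p l l' : legs_theta S p (l * l') =
    legs_theta S (gact l' p) l * legs_theta S p l'.
  by rewrite /legs_theta !cthetaM.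
apply/covers_bisetP.
exists (@Cell1 (apex S) (biset_cell (biset_prod V U)) f (legs_theta S) fE fM) => //.
apply/stab_surjP; split.
  move=> q; have [v [u ->]] := prod_carP q.
  have E : biset_legl V v = gact (1 : H) (biset_legr U u) by [].
  by exists (bpb_mk E), 1; rewrite gact1 /= /f /= lact1.
move=> p p' [k g]; have [u [v [h [E ->]]]] := bpbP p.
have [u' [v' [h' [E' ->]]]] := bpbP p'.
rewrite [gact _ _]actE /= /f /= => /prod_piP[h0 [Ev Eu]].
pose h1 := h'^-1 * h0 * h.
have Eu' : u' = ract U (lact U h1 u) g^-1.
  by rewrite /h1 !lactM -!lractC; rewrite -!lractC in Eu; rewrite -Eu -lactM mulVg lact1.
have Ev' : v' = ract V (lact V k v) h0^-1 by rewrite Ev -ractM mulgV ract1.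
exists ((h1, g), (k, h0)) => //.
change (bpb_mk E' = bpb_act (f1 := legr (biset_span U))
  (f2 := legl (biset_span V)) ((h1, g), (k, h0)) (bpb_mk E)).
apply: bpb_mk_eq => //=.
by rewrite /h1 !invMg invgK !mulgA mulgK mulgV mul1g.
Qed.

Local Close Scope quotient_scope.
Local Close Scope group_scope.
Local Open Scope ring_scope.

(** * Burnside modules are spanned by bisets *)

Section BurnsideSpan.
Variables (R : comPzRingType) (G H : finGroupType).

(** Stated with linear combinations because every use concerns a property that
    is linear in the morphism. *)
Lemma burnside_ind (P : burnside R G H -> Prop) :
  (forall U : biset H G, P (burnside_class R U)) ->
  (forall a x y, P x -> P y -> P (a *: x + y)) -> forall x, P x.
Proof.
move=> PU PL.
have P0 : P 0.
  have := PL (-1) _ _ (PU (biset_empty H G)) (PU (biset_empty H G)).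
  by rewrite scaleN1r addNr.
have PD x y : P x -> P y -> P (x + y) by move=> Px Py; rewrite -[x]scale1r; apply: PL.
have PZ a x : P x -> P (a *: x) by move=> Px; rewrite -[_ *: _]addr0; apply: PL.
elim/tens_ind => [|a r|//]; first exact: P0.
rewrite -[r]mulr1 -tens_pureZ; apply: (PZ).
elim/groth_ind: a => [c|a b Pa Pb].
  by rewrite -[c]class_reprK; exact: PU.
rewrite tens_pureDl; apply: PD => //.
have [_ ->] := @additive_opp _ (burnside R G H) (fun a => tens_pure a 1)
  (fun a b => tens_pureDl a b 1).
by rewrite -scaleN1r; exact: PZ.
Qed.

Lemma burnside_class_sum (U V : biset H G) :
  burnside_class R (biset_sum U V) = burnside_class R U + burnside_class R V.
Proof.
by rewrite /burnside_class -class_addE groth_inD tens_pureDl.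
Qed.

Lemma burnside_class_iso (U V : biset H G) : biset_iso U V ->
  burnside_class R U = burnside_class R V.
Proof. by move/biset_classP; rewrite /burnside_class => ->. Qed.
End BurnsideSpan.

(** * Deflative Mackey functors act on spans *)

Section FactorSub.
Variables (A W : cell0) (i : cell1 W A) (D : pred (cset A)).
Hypothesis D_inv : forall x g, D (gact g x) = D x.
Hypothesis Di : forall x, D (i x).

Program Definition sub_factor : cell1 W (sub_cell D_inv) :=
  @Cell1 W (sub_cell D_inv) (fun x => exist _ (i x) (Di x)) (ctheta i) _ _.
Next Obligation. by move=> x g; apply: val_inj; rewrite /= cmapE. Qed.
Next Obligation. by move=> x g g'; rewrite cthetaM. Qed.

Lemma sub_factor_surj : (forall y, D y -> in_orbits i y) -> stab_inj i ->
  stab_surjective sub_factor.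
Proof.
move=> Ds inj; apply/stab_surjP; split.
  move=> [y Dy]; have [x [h E]] := Ds y Dy.
  by exists x, h; apply: val_inj.
by move=> x x' h /(congr1 val) /= /inj.
Qed.
End FactorSub.

Section Action.
Variables (R : comPzRingType) (M : mackey R).
Hypothesis dM : deflative M.

Definition span_action (A B : cell0) (S : span A B) (m : M A) : M B :=
  push M (legr S) (pull M (legl S) m).

Lemma span_action_map (A B : cell0) (T S : span A B) (i : cell1 (apex S) (apex T)) m :
  span_map (T := T) (S := S) i ->
  span_action S m = push M (legr T) (push M i (pull M i (pull M (legl T) m))).
Proof.
move=> [[el] [er]].
by rewrite /span_action (pull_cell2 M el) (push_cell2 M er) pull_comp push_comp.
Qed.

Lemma span_action_covers (A B : cell0) (T S : span A B) :
  covers T S -> span_action S =1 span_action T.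
Proof. by move=> [i si mi] m; rewrite (span_action_map _ mi) dM. Qed.

Lemma span_action_id (A : cell0) : @span_action A A (span_id A) =1 id.
Proof. by move=> m; rewrite /span_action /= pull_id push_id. Qed.

(** The axiom is applied to the bipullback taken in the other order, which
    [bipullback_covers] compares with the one that composes the spans. *)
Lemma pull_push_span (X Y Z : cell0) (a : cell1 X Z) (b : cell1 Y Z) (m : M Y) :
  pull M a (push M b m) = span_action (span_comp (span_pull a) (span_push b)) m.
Proof.
rewrite (mackey_bipullback (@bpb_is_bipullback _ _ _ a b)).
exact: (span_action_covers (bipullback_covers (@bpb_is_bipullback _ _ _ a b))).
Qed.

Lemma span_action_comp (A B C : cell0) (S : span B C) (Q : span A B) m :
  span_action (span_comp S Q) m = span_action S (span_action Q m).
Proof.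
rewrite /span_action /= pull_push_span /span_action /=.
by rewrite !(pull_comp, push_comp) pull_id push_id.
Qed.

(** The two maps pull i1 and pull i2 are jointly injective, so the identity can
    be checked after applying each of them. Pulling back a push along the same
    part is the identity, and along the other part it factors through the
    value at an empty set. *)
Lemma sub_cell_sum (A : cell0) (D : pred (cset A))
  (D_inv : forall x g, D (gact g x) = D x) (m : M A) :
  m = push M (sub_in D_inv) (pull M (sub_in D_inv) m) +
      push M (sub_in (compl_inv D_inv)) (pull M (sub_in (compl_inv D_inv)) m).
Proof.
set i1 := sub_in D_inv; set i2 := sub_in _.
have fai (E : pred (cset A)) (E_inv : forall x g, E (gact g x) = E x) :
  faithful_cell1 (sub_in E_inv) by move=> x g g' _.
have jc : joint_cover i1 i2.
  exact/bicoproduct_joint_cover/sub_bicoproduct.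
have same (E : pred (cset A)) (E_inv : forall x g, E (gact g x) = E x) n :
    pull M (sub_in E_inv) (push M (sub_in E_inv) n) = n.
  rewrite pull_push_span -[RHS](span_action_id n); apply/esym/span_action_covers.
  exact: covers_embedding (@sub_in_inj _ _ E_inv) (fai _ E_inv).
have zero (A1 A2 : cell0) (j1 : cell1 A1 A) (j2 : cell1 A2 A) n :
    joint_cover j1 j2 -> pull M j2 (push M j1 n) = 0.
  move/joint_cover_disjoint => E; rewrite pull_push_span /span_action.
  by rewrite [pull M _ n](mackey_empty E) linear0.
have /bij_inj inj := mackey_bicoproduct M (sub_bicoproduct D_inv).
apply: inj; congr (_, _); rewrite linearD /=.
  by rewrite same (zero _ _ i2 i1) ?addr0 //; exact: joint_cover_sym.
by rewrite same (zero _ _ i1 i2) ?add0r.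
Qed.

(** Let D be the union of the orbits that meet the image of i1. Then i1 factors
    through a stab-surjective 1-cell onto D and i2 through one onto the
    complement, and deflativity reduces the claim to these two parts. *)
Lemma joint_cover_sum (A1 A2 A : cell0) (i1 : cell1 A1 A) (i2 : cell1 A2 A) m :
  joint_cover i1 i2 ->
  m = push M i1 (pull M i1 m) + push M i2 (pull M i2 m).
Proof.
case=> cov dis inj1 inj2.
pose D : pred (cset A) := fun x => `[< in_orbits i1 x >].
have D_inv x g : D (gact g x) = D x.
  by apply/asboolP/asboolP; [exact: in_orbitsV|exact: in_orbits_gact].
have D1 x : D (i1 x) by apply/asboolP; exists x, 1%g; rewrite gact1.
have D2 x : ~~ D (i2 x) by apply/asboolP => -[y [h /esym/dis]].
have factor (W : cell0) (i : cell1 W A) (E : pred (cset A)) E_inv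
   (Ei : forall x, E (i x)) : (forall y, E y -> in_orbits i y) -> stab_inj i ->
   push M i (pull M i m) = push M (@sub_in A E E_inv) (pull M (sub_in E_inv) m).
  move=> Es inj.
  have -> : i = cell1_comp (sub_in E_inv) (sub_factor E_inv Ei).
    by apply: cell1_ext.
  by rewrite pull_comp push_comp dM //; exact: sub_factor_surj.
rewrite {1}(sub_cell_sum D_inv m) (factor _ i1 D D_inv D1) //; last by move=> y /asboolP.
rewrite (factor _ i2 _ (compl_inv D_inv) D2) // => y /asboolP nD.
by have [] := cov y.
Qed.

Lemma span_action_covers2 (A B : cell0) (T S1 S2 : span A B) m :
  covers2 T S1 S2 -> span_action T m = span_action S1 m + span_action S2 m.
Proof.
move=> [i1 [i2 [c m1 m2]]]; rewrite (span_action_map _ m1) (span_action_map _ m2) -!linearD.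
by rewrite -joint_cover_sum.
Qed.

Lemma span_action_pull (A B : cell0) (a : cell1 A B) m :
  span_action (span_pull a) m = pull M a m.
Proof. by rewrite /span_action /= push_id. Qed.

Lemma span_action_push (A B : cell0) (a : cell1 A B) m :
  span_action (span_push a) m = push M a m.
Proof. by rewrite /span_action /= pull_id. Qed.

Lemma span_action_linear (A B : cell0) (S : span A B) : linear (span_action S).
Proof. by move=> a m n; rewrite /span_action !linearP. Qed.

(** * The biset functor of a deflative Mackey functor *)

Section BurnsideMap.
Variables G H : finGroupType.
Implicit Types (x y : burnside R G H) (m : M (point G)).

(** The action of a biset is extended first to classes, then to differences of
    classes and last to the tensor product with R. *)
Definition class_map m (c : biset_classes H G) : M (point H) :=
  span_action (biset_span (class_repr c)) m.

Definition groth_map m (a : groth (biset_classes H G)) : M (point H) :=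
  groth_lift (class_map m) a.

Definition burnside_map x m : M (point H) :=
  tens_lift (fun a r => r *: groth_map m a) x.

Lemma class_mapE m U : class_map m (biset_class U) = span_action (biset_span U) m.
Proof.
by apply/esym/span_action_covers/covers_biset_iso/biset_iso_sym/biset_class_repr.
Qed.

Lemma class_mapD m c d : class_map m (c + d) = class_map m c + class_map m d.
Proof.
rewrite -[c]class_reprK -[d]class_reprK [_ + _ in LHS]class_addE !class_mapE.
exact/span_action_covers2/covers2_biset_sum.
Qed.

Lemma groth_mapD m a b : groth_map m (a + b) = groth_map m a + groth_map m b.
Proof. exact/groth_liftD/class_mapD. Qed.

Let nDl m a b (r : R) :
  r *: groth_map m (a + b) = r *: groth_map m a + r *: groth_map m b.
Proof. by rewrite groth_mapD scalerDr. Qed.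

Let nDr m a (r s : R) :
  (r + s) *: groth_map m a = r *: groth_map m a + s *: groth_map m a.
Proof. by rewrite scalerDl. Qed.

Lemma burnside_map_class U m :
  burnside_map (burnside_class R U) m = span_action (biset_span U) m.
Proof.
rewrite /burnside_map tens_lift_pure // scale1r /groth_map groth_lift_in ?class_mapE //.
exact: class_mapD.
Qed.

Lemma burnside_mapD x y m :
  burnside_map (x + y) m = burnside_map x m + burnside_map y m.
Proof. exact: (tens_liftD (nDl m) (nDr m)). Qed.

Lemma burnside_mapZ a x m : burnside_map (a *: x) m = a *: burnside_map x m.
Proof.
elim/tens_ind: x => [|b r|x y IHx IHy].
- have n0 : burnside_map 0 m = 0.
    by have [] := @additive_opp _ _ (burnside_map^~ m) (fun x y => burnside_mapD x y m).
  by rewrite scaler0 n0 scaler0.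
- rewrite tens_pureZ /burnside_map !tens_lift_pure //.
  by rewrite scalerA.
- by rewrite scalerDr !burnside_mapD IHx IHy scalerDr.
Qed.

Lemma burnside_map_linear x : linear (burnside_map x).
Proof.
move=> a m n; rewrite /burnside_map /tens_lift scaler_sumr -big_split /=.
apply: eq_bigr => p _; rewrite /groth_map /groth_lift /class_map !span_action_linear.
by rewrite opprD addrACA scalerDr -scalerBr !scalerA mulrC.
Qed.

HB.instance Definition _ x := GRing.isLinear.Build R (M (point G)) (M (point H))
  *:%R (burnside_map x) (burnside_map_linear x).
End BurnsideMap.

Lemma burnside_map_id (G : finGroupType) m :
  burnside_map (burnside_id R G) m = m :> M (point G).
Proof.
rewrite burnside_map_class -(span_action_covers (covers_biset_id G)).
exact: span_action_id.
Qed.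

(** Both sides are bilinear, so this is the compatibility of the action with
    composition of spans, for two bisets. *)
Lemma burnside_map_comp (G H K : finGroupType) (y : burnside R H K)
    (x : burnside R G H) m :
  burnside_map (burnside_comp y x) m = burnside_map y (burnside_map x m).
Proof.
elim/burnside_ind: y => [V|a y y' IH IH']; last first.
  by rewrite burnside_compDl burnside_compZl !burnside_mapD !burnside_mapZ IH IH'.
elim/burnside_ind: x => [U|a x x' IH IH']; last first.
  by rewrite burnside_compDr burnside_compZr !burnside_mapD !burnside_mapZ IH IH' linearP.
rewrite burnside_comp_class !burnside_map_class -span_action_comp.
exact/esym/span_action_covers/covers_biset_prod.
Qed.

Program Definition biset_functor_of_mackey :
    functor (biset_cat R) (module_cat R) :=
  @Functor (biset_cat R) (module_cat R) (fun G => M (point G))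
    (fun G H x => burnside_map x : {linear _ -> _}) _ _.
Next Obligation. by move=> G; apply: linear_ext => m; exact: burnside_map_id. Qed.
Next Obligation.
by move=> G H K y x; apply: linear_ext => m; exact: burnside_map_comp.
Qed.

Lemma biset_functor_of_mackey_linear : is_linear_functor biset_functor_of_mackey.
Proof. by move=> G H a x y m /=; rewrite burnside_mapD burnside_mapZ. Qed.
End Action.

Section EmptySpan.
Variables A B : cell0.

Definition void_gset : gset 'I_1 :=
  @GSet 'I_1 void (fun _ x => x) (fun _ => erefl) (fun _ _ _ => erefl).

Definition void_cell1 (X : cell0) : cell1 (Cell0 void_gset) X :=
  @Cell1 (Cell0 void_gset) X (fun x => of_void _ x) (fun x _ => of_void _ x)
    (fun x => of_void _ x) (fun x => of_void _ x).

Definition empty_span : span A B := Span (void_cell1 A) (void_cell1 B).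

Lemma card_empty_span : #|cset (apex empty_span)| = 0%N.
Proof. exact: card_void. Qed.
End EmptySpan.

(** * Families of values on spans *)

Section Families.
Variables (R : comPzRingType) (F : functor (biset_cat R) (module_cat R)).

Definition fval (K : finGroupType) : lmodType R := F K.

Definition fmor (G H : finGroupType) (x : burnside R G H) :
  {linear fval G -> fval H} := fmap F x.

(** A linear natural transformation to F from the functor that sends K to the
    module spanned by the spans from A to pt/K, modulo covers. *)
Record family (A : cell0) := Family {
  fam :> forall K : finGroupType, span A (point K) -> fval K;
  fam_covers2 : forall K (T S1 S2 : span A (point K)),
    covers2 T S1 S2 -> fam T = fam S1 + fam S2;
  fam_nat : forall K K' (V : biset K' K) (S : span A (point K)),
    fam (span_comp (biset_span V) S) = fmor (burnside_class R V) (fam S) }.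

Lemma fam_ext (A : cell0) (p q : family A) :
  (forall K (S : span A (point K)), p K S = q K S) -> p = q.
Proof.
case: p q => p p2 pn [q q2 qn] /= E.
have {}E : p = q.
  apply: functional_extensionality_dep => K; apply: funext => S; exact: E.
by subst q; congr Family; exact: Prop_irrelevance.
Qed.

Section FamilyTheory.
Variables (A : cell0) (p : family A) (K : finGroupType).
Implicit Types S T : span A (point K).

(** An empty span is jointly covered by two copies of itself. *)
Lemma fam_empty S : #|cset (apex S)| = 0%N -> p K S = 0.
Proof.
move=> S0; apply: (addrI (p K S)); rewrite addr0.
by rewrite -(fam_covers2 p (covers2_empty (covers_refl S) S0)).
Qed.

Lemma fam_covers S T : covers T S -> p K S = p K T.
Proof.
move=> c; rewrite (fam_covers2 p (covers2_empty c (card_empty_span A (point K)))).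
by rewrite (fam_empty (card_empty_span A (point K))) addr0.
Qed.

Lemma fam_biset S (G : finGroupType) (Q : span A (point G)) (U : biset K G)
   (S' : span (point G) (point K)) :
  covers (biset_span U) S' -> covers S (span_comp S' Q) ->
  p K S = fmor (burnside_class R U) (p G Q).
Proof.
move=> cU /fam_covers <-; rewrite -fam_nat; apply: fam_covers.
exact: span_comp_covers cU (covers_refl Q).
Qed.
End FamilyTheory.

(** A single operation, from which sum, opposite and scaling are specialised, so
    that the two conditions are verified once. *)
Program Definition fam_lin (A : cell0) (a : R) (p q : family A) : family A :=
  @Family A (fun K S => a *: p K S + q K S) _ _.
Next Obligation.
by move=> A a p q K T S1 S2 c; rewrite /= !(fam_covers2 _ c) scalerDr addrACA.
Qed.
Next Obligation. by move=> A a p q K K' V S; rewrite /= !fam_nat linearP. Qed.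

Program Definition fam_zero (A : cell0) : family A :=
  @Family A (fun K S => 0) _ _.
Next Obligation. by move=> *; rewrite /= addr0. Qed.
Next Obligation. by move=> *; rewrite /= linear0. Qed.

(** Additivity survives because covers are stable under composition on the
    right, and naturality is associativity of composition. *)
Program Definition fam_act (A B : cell0) (Q : span A B) (p : family A) : family B :=
  @Family B (fun K S => p K (span_comp S Q)) _ _.
Next Obligation.
by move=> A B Q p K T S1 S2 c; apply: fam_covers2; exact: span_comp_covers2l.
Qed.
Next Obligation.
move=> A B Q p K K' V S; rewrite /= -fam_nat; apply/esym/fam_covers.
exact: span_compA.
Qed.

(** * Families form a small module *)

Definition stab_span (A : cell0) (x : cset A) : span A (point (stabg x)) :=
  span_pull (at_stab x).

Program Definition stab_cell1 (W A : cell0) (l : cell1 W A) (w : cset W) :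
    cell1 (point (stabg w)) (point (stabg (l w))) :=
  @Cell1 (point (stabg w)) (point (stabg (l w))) (fun _ => tt)
    (fun _ g => subg (stab_group (l w)) (ctheta l w (sgval g))) _ _.
Next Obligation. by []. Qed.
Next Obligation.
move=> W A l w u g h; have th (k : stabg w) : ctheta l w (sgval k) \in stab_group (l w).
  by apply/stabP; rewrite -cmapE stabgP.
rewrite /= -subgM ?th //; congr (subg _ _).
by have := cthetaM l w (sgval g) (sgval h); rewrite stabgP => <-.
Qed.

Lemma stab_cell1E (W A : cell0) (l : cell1 W A) (w : cset W) :
  cell1_comp l (at_stab w) = cell1_comp (at_stab (l w)) (stab_cell1 l w).
Proof.
apply: cell1_ext => // -[] g /=; rewrite subgK //.
by apply/stabP; rewrite -cmapE stabgP.
Qed.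

(** Decompose the apex of a span into orbits. For one orbit the apex is a point,
    its left leg factors through the stabiliser of a point x of A, and the
    remaining span between points covers a biset U; so naturality computes the
    value as F(U) applied to the value at the stabiliser of x. *)
Lemma fam_stab_ext (A : cell0) (p q : family A) :
  (forall x, p _ (stab_span x) = q _ (stab_span x)) -> p = q.
Proof.
move=> E; apply: fam_ext => K [W l r].
elim/orbit_ind: W l r => [W W0|W w IH] l r.
  by rewrite !fam_empty.
pose S1 : span A (point K) :=
  Span (cell1_comp l (at_stab w)) (cell1_comp r (at_stab w)).
pose i2 := sub_in (off_orbit_inv w).
have c : covers2 (Span l r) S1 (Span (cell1_comp l i2) (cell1_comp r i2)).
  exists (at_stab w), i2; split; [exact: orbit_cover| |];
    by split; constructor; exact: cell2_id.
rewrite !(fam_covers2 _ c) IH; congr (_ + _).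
pose S' := Span (stab_cell1 l w) (cell1_comp r (at_stab w)).
have [U cU] := covers_biset_exists S'.
have cS : covers S1 (span_comp S' (stab_span (l w))).
  by rewrite /S1 stab_cell1E; exact: (span_comp_pull _ S').
by rewrite !(fam_biset _ cU cS) E.
Qed.

(** Families quantify over all finite groups, so they live in a universe above
    the carriers of modules. By [fam_stab_ext] a family is determined by its
    values at the stabilisers of A; the tuples of values that come from a
    family form a small type in bijection with the families, because the
    existence of the family is a proposition. *)
Record sfam (A : cell0) := SFam {
  sfam_val : forall x : cset A, fval (stabg x);
  sfamP : exists p : family A, forall x, sfam_val x = p _ (stab_span x) }.

Definition restrict (A : cell0) (p : family A) : sfam A :=
  SFam (ex_intro _ p (fun x => erefl (p _ (stab_span x)))).

Definition extend (A : cell0) (s : sfam A) : family A := sval (cid (sfamP s)).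

Lemma restrictK (A : cell0) : cancel (@restrict A) (@extend A).
Proof.
by move=> p; apply: fam_stab_ext => x; rewrite -(svalP (cid (sfamP (restrict p)))).
Qed.

Lemma sfam_val_inj (A : cell0) (s t : sfam A) :
  (forall x, sfam_val s x = sfam_val t x) -> s = t.
Proof.
case: s t => v vP [w wP] /= E.
have {}E : v = w by exact: functional_extensionality_dep.
subst w.
by congr SFam; exact: Prop_irrelevance.
Qed.

Lemma extendK (A : cell0) : cancel (@extend A) (@restrict A).
Proof.
by move=> s; apply: sfam_val_inj => x; rewrite (svalP (cid (sfamP s))).
Qed.

HB.instance Definition _ A := gen_eqMixin (sfam A).
HB.instance Definition _ A := gen_choiceMixin (sfam A).

Section SfamModule.
Variable A : cell0.
Implicit Types (s t u : sfam A).

Definition sfam_zero : sfam A := restrict (fam_zero A).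
Definition sfam_add s t : sfam A := restrict (fam_lin 1 (extend s) (extend t)).
Definition sfam_opp s : sfam A := restrict (fam_lin (-1) (extend s) (fam_zero A)).
Definition sfam_scale (a : R) s : sfam A :=
  restrict (fam_lin a (extend s) (fam_zero A)).

Lemma sfam_ext s t :
  (forall K (S : span A (point K)), extend s K S = extend t K S) -> s = t.
Proof. by move=> E; apply: (can_inj (@extendK A)); exact: fam_ext. Qed.

Lemma extend_addE s t K (S : span A (point K)) :
  extend (sfam_add s t) K S = extend s K S + extend t K S.
Proof. by rewrite restrictK /= scale1r. Qed.

Lemma extend_zeroE K (S : span A (point K)) : extend sfam_zero K S = 0.
Proof. by rewrite restrictK. Qed.

Lemma extend_oppE s K (S : span A (point K)) : extend (sfam_opp s) K S = - extend s K S.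
Proof. by rewrite restrictK /= scaleN1r addr0. Qed.

Lemma extend_scaleE a s K (S : span A (point K)) :
  extend (sfam_scale a s) K S = a *: extend s K S.
Proof. by rewrite restrictK /= addr0. Qed.

Lemma sfam_addA : associative sfam_add.
Proof. by move=> s t u; apply: sfam_ext => K S; rewrite !extend_addE addrA. Qed.

Lemma sfam_addC : commutative sfam_add.
Proof. by move=> s t; apply: sfam_ext => K S; rewrite !extend_addE addrC. Qed.

Lemma sfam_add0 : left_id sfam_zero sfam_add.
Proof. by move=> s; apply: sfam_ext => K S; rewrite extend_addE extend_zeroE add0r. Qed.

Lemma sfam_addN : left_inverse sfam_zero sfam_opp sfam_add.
Proof.
by move=> s; apply: sfam_ext => K S; rewrite extend_addE extend_oppE extend_zeroE addNr.
Qed.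

HB.instance Definition _ :=
  GRing.isZmodule.Build (sfam A) sfam_addA sfam_addC sfam_add0 sfam_addN.

Lemma sfam_scaleA a b s : sfam_scale a (sfam_scale b s) = sfam_scale (a * b) s.
Proof. by apply: sfam_ext => K S; rewrite !extend_scaleE scalerA. Qed.

Lemma sfam_scale1 : left_id 1 sfam_scale.
Proof. by move=> s; apply: sfam_ext => K S; rewrite extend_scaleE scale1r. Qed.

Lemma sfam_scaleDr : right_distributive sfam_scale +%R.
Proof.
move=> a s t; apply: sfam_ext => K S.
by rewrite extend_scaleE !extend_addE !extend_scaleE scalerDr.
Qed.

Lemma sfam_scaleDl s : {morph sfam_scale^~ s : a b / a + b}.
Proof.
by move=> a b; apply: sfam_ext => K S; rewrite extend_addE !extend_scaleE scalerDl.
Qed.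

HB.instance Definition _ := GRing.Zmodule_isLmodule.Build R (sfam A)
  sfam_scaleA sfam_scale1 sfam_scaleDr sfam_scaleDl.

Lemma extendD s t K (S : span A (point K)) :
  extend (s + t) K S = extend s K S + extend t K S.
Proof. exact: extend_addE. Qed.

Lemma extendZ a s K (S : span A (point K)) : extend (a *: s) K S = a *: extend s K S.
Proof. exact: extend_scaleE. Qed.

End SfamModule.

(** * The Mackey functor of a biset functor *)

Section SpanAction.
Variables A B : cell0.

Definition sfam_act (Q : span A B) (s : sfam A) : sfam B :=
  restrict (fam_act Q (extend s)).

Lemma extend_act Q s K (S : span B (point K)) :
  extend (sfam_act Q s) K S = extend s K (span_comp S Q).
Proof. by rewrite restrictK. Qed.

Lemma sfam_act_linear Q : linear (sfam_act Q).
Proof.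
move=> a s t; apply: sfam_ext => K S; rewrite [LHS]extend_act [LHS]extendD [RHS]extendD.
congr (_ + _); last by rewrite [RHS]extend_act.
by rewrite [LHS]extendZ [RHS]extendZ; congr (_ *: _); rewrite [RHS]extend_act.
Qed.

HB.instance Definition _ Q :=
  GRing.isLinear.Build R (sfam A) (sfam B) *:%R (sfam_act Q) (sfam_act_linear Q).

Lemma sfam_act_covers (Q Q' : span A B) s : covers Q Q' -> sfam_act Q' s = sfam_act Q s.
Proof.
move=> c; apply: sfam_ext => K S; rewrite !extend_act; apply: fam_covers.
exact: span_comp_covers (covers_refl S) c.
Qed.

Lemma sfam_act_covers2 (Q Q1 Q2 : span A B) s :
  covers2 Q Q1 Q2 -> sfam_act Q s = sfam_act Q1 s + sfam_act Q2 s.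
Proof.
move=> c; apply: sfam_ext => K S; rewrite [LHS]extend_act [RHS]extendD.
rewrite [X in X + _]extend_act [X in _ + X]extend_act; apply: fam_covers2.
exact: span_comp_covers2r.
Qed.

Lemma sfam_act_empty (Q : span A B) s : #|cset (apex Q)| = 0%N -> sfam_act Q s = 0.
Proof.
move=> Q0; apply: (addrI (sfam_act Q s)).
by rewrite addr0 -(sfam_act_covers2 s (covers2_empty (covers_refl Q) Q0)).
Qed.
End SpanAction.

Lemma sfam_act_id (A : cell0) s : sfam_act (span_id A) s = s.
Proof.
apply: sfam_ext => K S; rewrite extend_act; apply: fam_covers.
exact: span_comp1r.
Qed.

Lemma sfam_act_comp (A B C : cell0) (S : span B C) (Q : span A B) s :
  sfam_act (span_comp S Q) s = sfam_act S (sfam_act Q s).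
Proof.
apply: sfam_ext => K T; rewrite !extend_act; apply: fam_covers.
exact: span_compA.
Qed.

Lemma sfam_act_legs (A B : cell0) (S : span A B) s :
  sfam_act (span_push (legr S)) (sfam_act (span_pull (legl S)) s) = sfam_act S s.
Proof. by rewrite -sfam_act_comp; apply: sfam_act_covers; exact: span_legsE. Qed.

Section Bicoproduct.
Variables (A1 A2 P : cell0) (i1 : cell1 A1 P) (i2 : cell1 A2 P).
Hypothesis cop : is_bicoproduct i1 i2.

(** The inverse is the sum of the two pushes; the four composites and the sum
    over both parts are computed on spans. *)
Lemma sfam_act_bicoproduct :
  bijective (fun s => (sfam_act (span_pull i1) s, sfam_act (span_pull i2) s)).
Proof.
have jc := bicoproduct_joint_cover cop.
have jc' := joint_cover_sym jc; have cop' := bicoproduct_sym cop.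
have same (B : cell0) (i : cell1 B P) t : stab_inj i -> faithful_cell1 i ->
    sfam_act (span_pull i) (sfam_act (span_push i) t) = t.
  move=> inj fai; rewrite -sfam_act_comp -[RHS]sfam_act_id; apply/esym.
  exact/sfam_act_covers/covers_embedding.
have zero (B1 B2 : cell0) (j1 : cell1 B1 P) (j2 : cell1 B2 P) t :
    joint_cover j1 j2 -> sfam_act (span_pull j2) (sfam_act (span_push j1) t) = 0.
  by move=> /joint_cover_disjoint E; rewrite -sfam_act_comp; exact: sfam_act_empty.
exists (fun t => sfam_act (span_push i1) t.1 + sfam_act (span_push i2) t.2) => [s|[s t]] /=.
  by rewrite -!sfam_act_comp -(sfam_act_covers2 s (covers2_joint_cover jc)) sfam_act_id.
rewrite !linearD /= (same _ _ _ (bicoproduct_stab_inj cop) (bicoproduct_faithful cop)).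
rewrite (same _ _ _ (bicoproduct_stab_inj cop') (bicoproduct_faithful cop')).
by rewrite (zero _ _ _ _ _ jc) (zero _ _ _ _ _ jc') addr0 add0r.
Qed.
End Bicoproduct.

Program Definition mackey_of_biset_functor : mackey R :=
  @Mackey R (fun A => sfam A)
    (fun A B a => sfam_act (span_pull a) : {linear sfam B -> sfam A})
    (fun A B a => sfam_act (span_push a) : {linear sfam A -> sfam B})
    _ _ _ _ _ _ _ _ _.
Next Obligation. by move=> A m; exact: sfam_act_id. Qed.
Next Obligation. by move=> A m; exact: sfam_act_id. Qed.
Next Obligation.
move=> A B C b a m; rewrite /= -sfam_act_comp; apply/esym/sfam_act_covers.
exact: span_pullM.
Qed.
Next Obligation.
move=> A B C b a m; rewrite /= -sfam_act_comp; apply/esym/sfam_act_covers.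
exact: span_pushM.
Qed.
Next Obligation.
move=> A B a a' e; apply: linear_ext => m; apply/esym/sfam_act_covers.
exact: span_pull_cell2.
Qed.
Next Obligation.
move=> A B a a' e; apply: linear_ext => m; apply/esym/sfam_act_covers.
exact: span_push_cell2.
Qed.
Next Obligation. by move=> A1 A2 P i1 i2; exact: sfam_act_bicoproduct. Qed.
Next Obligation.
move=> A A0 m; rewrite -[m]sfam_act_id; exact: sfam_act_empty.
Qed.
Next Obligation.
move=> X Y Z W a b c d k bp m.
rewrite /= -!sfam_act_comp -(sfam_act_covers _ (bipullback_covers bp)).
by rewrite -sfam_act_legs sfam_act_comp.
Qed.

Lemma mackey_of_biset_functor_deflative : deflative mackey_of_biset_functor.
Proof.
move=> A B a sa m; rewrite /= -sfam_act_comp -[RHS]sfam_act_id.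
exact/sfam_act_covers/span_deflation.
Qed.
End Families.

(** * Isomorphisms are detected pointwise *)

Lemma nat_isomorphic_sym (C D : category) (F G : functor C D) :
  nat_isomorphic F G -> nat_isomorphic G F.
Proof.
move=> [t ti]; pose s X : hom (G X) (F X) := sval (cid (ti X)).
have st X : compm (s X) (t X) = idm (F X) by have [] := svalP (cid (ti X)).
have ts X : compm (t X) (s X) = idm (G X) by have [] := svalP (cid (ti X)).
have nat X Y (f : hom X Y) : compm (fmap F f) (s X) = compm (s Y) (fmap G f).
  rewrite -[LHS]comp1m -(st Y) -compmA; congr (compm _ _).
  by rewrite compmA -ncomp_nat -compmA ts compm1.
by exists (NatTrans nat) => X; exists (t X).
Qed.


Lemma bijective_of_surj (T T' : Type) (f : T -> T') :
  injective f -> (forall y, exists x, f x = y) -> bijective f.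
Proof.
move=> inj /choice[g gK]; exists g => // x; exact: inj.
Qed.

Section PointwiseIso.
Variable R : comPzRingType.

Lemma linear_inverse (U V : lmodType R) (f : {linear U -> V}) :
  bijective f -> exists g : {linear V -> U}, cancel f g /\ cancel g f.
Proof.
case=> g fK gK.
have gl : linear g by move=> a u v; apply: (can_inj fK); rewrite linearP !gK.
pose gL := GRing.isLinear.Build R V U *:%R g gl.
by exists (HB.pack g gL : {linear V -> U}).
Qed.

Lemma nattrans_iso (C : category) (F G : functor C (module_cat R))
    (t : nattrans F G) :
  (forall X, bijective (t X : {linear F X -> G X})) ->
  is_iso (t : @hom (functor_cat C (module_cat R)) F G).
Proof.
move=> bij; pose s X : hom (G X) (F X) := sval (cid (linear_inverse (bij X))).
have st X : compm (s X) (t X) = idm (F X).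
  apply: linear_ext => x.
  by have [fK _] := svalP (cid (linear_inverse (bij X))); exact: fK.
have ts X : compm (t X) (s X) = idm (G X).
  apply: linear_ext => x.
  by have [_ gK] := svalP (cid (linear_inverse (bij X))); exact: gK.
have nat X Y (f : hom X Y) : compm (fmap F f) (s X) = compm (s Y) (fmap G f).
  rewrite -[LHS]comp1m -(st Y) -compmA; congr (compm _ _).
  by rewrite compmA -ncomp_nat -compmA ts compm1.
by exists (NatTrans nat); split; apply: nattransP => X; [exact: st|exact: ts].
Qed.

Lemma mackey_hom_iso (M N : mackey R) (f : mackey_hom M N) :
  (forall A, bijective (f A)) -> is_iso (f : @hom (mackey_cat R) M N).
Proof.
move=> bij; pose g A := sval (cid (linear_inverse (bij A))).
have fg A : cancel (f A) (g A) by have [] := svalP (cid (linear_inverse (bij A))).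
have gf A : cancel (g A) (f A) by have [] := svalP (cid (linear_inverse (bij A))).
have gpull A B (a : cell1 A B) n : g A (pull N a n) = pull M a (g B n).
  by apply: (can_inj (fg A)); rewrite mhom_pull !gf.
have gpush A B (a : cell1 A B) n : g B (push N a n) = push M a (g A n).
  by apply: (can_inj (fg B)); rewrite mhom_push !gf.
by exists (MackeyHom gpull gpush); split; apply: mackey_hom_ext => A m;
  [exact: fg|exact: gf].
Qed.

(** Induction on orbits: an element is the sum of its pushed pulls to an orbit,
    represented by a point, and to the complement, and the morphism commutes
    with all of these maps. *)
Lemma mackey_hom_bijective (M N : mackey R) (f : mackey_hom M N) :
  deflative M -> deflative N -> (forall G, bijective (f (point G))) ->
  forall A, bijective (f A).
Proof.
move=> dM dN bij; elim/orbit_ind => [A A0|A x IH].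
  apply: bijective_of_surj => [m m' _|n].
    by rewrite [m](mackey_empty A0) [m'](mackey_empty A0).
  by exists 0; rewrite [n](mackey_empty A0) linear0.
set i1 := at_stab x; set i2 := sub_in (@off_orbit_inv A x).
have jc : joint_cover i1 i2 := orbit_cover x.
apply: bijective_of_surj => [m m' E|n].
  have E1 : pull M i1 m = pull M i1 m'.
    by apply: (bij_inj (bij _)); rewrite !mhom_pull E.
  have E2 : pull M i2 m = pull M i2 m'.
    by apply: (bij_inj IH); rewrite !mhom_pull E.
  by rewrite (joint_cover_sum dM m jc) (joint_cover_sum dM m' jc) E1 E2.
have [g1 _ K1] := bij (stabg x); have [g2 _ K2] := IH.
exists (push M i1 (g1 (pull N i1 n)) + push M i2 (g2 (pull N i2 n))).
by rewrite linearD !mhom_push K1 K2 -(joint_cover_sum dN n jc).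
Qed.
End PointwiseIso.

(** * The two functors *)

Section Functors.
Variable R : comPzRingType.
Notation mackeyD := (deflative_mackey_cat R).
Notation bisetF := (biset_functor_cat R).

Lemma span_action_hom (M N : mackey R) (f : mackey_hom M N) (A B : cell0)
    (S : span A B) (m : M A) : f B (span_action S m) = span_action S (f A m).
Proof. by rewrite /span_action mhom_push mhom_pull. Qed.

Definition biset_functor_obj (M : mackeyD) : bisetF :=
  exist _ (biset_functor_of_mackey (svalP M)) (@biset_functor_of_mackey_linear _ _ (svalP M)).

Program Definition biset_functor_map (M N : mackeyD) (f : hom M N) :
    hom (biset_functor_obj M) (biset_functor_obj N) :=
  @NatTrans (biset_cat R) (module_cat R) (biset_functor_of_mackey (svalP M))
    (biset_functor_of_mackey (svalP N)) (fun G => mhom f (point G)) _.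
Next Obligation.
move=> [M dM] [N dN] f G H x; apply: linear_ext => m /=.
elim/burnside_ind: x => [U|a x y IHx IHy].
  by rewrite !burnside_map_class // span_action_hom.
by rewrite !(burnside_mapD, burnside_mapZ) // linearP IHx IHy.
Qed.

Program Definition biset_functor_functor : functor mackeyD bisetF :=
  @Functor mackeyD bisetF biset_functor_obj biset_functor_map _ _.
Next Obligation. by move=> M; apply: nattransP. Qed.
Next Obligation. by move=> M N P g f; apply: nattransP. Qed.

Section FamilyMap.
Variables (F F' : functor (biset_cat R) (module_cat R)) (t : nattrans F F').

Definition ncomp_lin (K : finGroupType) : {linear fval F K -> fval F' K} := t K.

Lemma ncomp_lin_nat (G H : finGroupType) (x : burnside R G H) v :
  fmor F' x (ncomp_lin G v) = ncomp_lin H (fmor F x v).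
Proof. exact: (congr1 (fun f : {linear _ -> _} => f v) (ncomp_nat t x)). Qed.

Program Definition fam_map (A : cell0) (p : family F A) : family F' A :=
  @Family R F' A (fun K S => ncomp_lin K (p K S)) _ _.
Next Obligation. by move=> A p K T S1 S2 c; rewrite /= (fam_covers2 p c) linearD. Qed.
Next Obligation. by move=> A p K K' V S; rewrite /= fam_nat ncomp_lin_nat. Qed.

Definition sfam_map (A : cell0) (s : sfam F A) : sfam F' A :=
  restrict (fam_map (extend s)).

Lemma extend_map (A : cell0) (s : sfam F A) K (S : span A (point K)) :
  extend (sfam_map s) K S = ncomp_lin K (extend s K S).
Proof. by rewrite restrictK. Qed.

Lemma sfam_map_linear A : linear (@sfam_map A).
Proof.
move=> a s s'; apply: sfam_ext => K S.
rewrite [LHS]extend_map [RHS]extendD [in LHS]extendD linearD; congr (_ + _).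
  by rewrite [RHS]extendZ [in LHS]extendZ linearZ; congr (_ *: _); rewrite [RHS]extend_map.
by rewrite [RHS]extend_map.
Qed.

HB.instance Definition _ A := GRing.isLinear.Build R (sfam F A) (sfam F' A)
  *:%R (@sfam_map A) (@sfam_map_linear A).

Lemma sfam_map_act (A B : cell0) (Q : span A B) s :
  sfam_map (sfam_act Q s) = sfam_act Q (sfam_map s).
Proof. by apply: sfam_ext => K S; rewrite extend_map !extend_act extend_map. Qed.

Definition mackey_map :
  mackey_hom (mackey_of_biset_functor F) (mackey_of_biset_functor F') :=
  @MackeyHom R (mackey_of_biset_functor F) (mackey_of_biset_functor F')
    (fun A => @sfam_map A : {linear _ -> _})
    (fun A B a m => sfam_map_act (span_pull a) m)
    (fun A B a m => sfam_map_act (span_push a) m).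
End FamilyMap.

Definition mackey_obj (F : bisetF) : mackeyD :=
  exist _ (mackey_of_biset_functor (sval F))
    (@mackey_of_biset_functor_deflative R (sval F)).

Program Definition mackey_functor : functor bisetF mackeyD :=
  @Functor bisetF mackeyD mackey_obj (fun F F' t => mackey_map t) _ _.
Next Obligation.
by move=> F; apply: mackey_hom_ext => A s; apply: sfam_ext => K S; rewrite extend_map.
Qed.
Next Obligation.
move=> F F' F'' u t; apply: mackey_hom_ext => A s.
by apply: sfam_ext => K S; rewrite /= !extend_map.
Qed.

(** * Families on a point: the Yoneda lemma *)

Section Yoneda.
Variables (F : functor (biset_cat R) (module_cat R)).
Hypothesis Fl : is_linear_functor F.

Definition cover_biset (G H : finGroupType) (S : span (point G) (point H)) :
  biset H G := sval (cid (covers_biset_exists S)).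

Lemma cover_bisetP (G H : finGroupType) (S : span (point G) (point H)) :
  covers (biset_span (cover_biset S)) S.
Proof. exact: svalP (cid (covers_biset_exists S)). Qed.

Lemma fmor_sum (G H : finGroupType) (U U1 U2 : biset H G) v :
  biset_iso (biset_sum U1 U2) U -> fmor F (burnside_class R U) v =
  fmor F (burnside_class R U1) v + fmor F (burnside_class R U2) v.
Proof.
move=> /(burnside_class_iso R) <-; rewrite burnside_class_sum.
by have := Fl 1 (burnside_class R U1) (burnside_class R U2) v; rewrite !scale1r.
Qed.

Lemma fmor_comp (G H K : finGroupType) (y : burnside R H K) (x : burnside R G H) v :
  fmor F (burnside_comp y x) v = fmor F y (fmor F x v).
Proof. exact: (congr1 (fun f : {linear _ -> _} => f v) (fmapM F y x)). Qed.

Lemma fmor_id (G : finGroupType) v : fmor F (burnside_id R G) v = v.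
Proof. exact: (congr1 (fun f : {linear _ -> _} => f v) (fmap1 F G)). Qed.

(** The value at S is F(U) v for a biset U that S covers; any two choices of U
    are isomorphic, and this independence gives additivity and naturality. *)
Program Definition yoneda (G : finGroupType) (v : fval F G) : family F (point G) :=
  @Family R F (point G)
    (fun K S => fmor F (burnside_class R (cover_biset S)) v) _ _.
Next Obligation.
move=> G v K T S1 S2 c; apply: fmor_sum.
by apply: covers_biset_sum c _ _ _; exact: cover_bisetP.
Qed.
Next Obligation.
move=> G v K K' V S; rewrite /= -fmor_comp burnside_comp_class.
congr (fmor F _ v); apply/burnside_class_iso.
apply: covers_biset_unique (cover_bisetP _) _.
apply: covers_trans (covers_biset_prod _ _) _.
exact: span_comp_covers (covers_refl _) (cover_bisetP S).
Qed.

Definition point_eval (G : finGroupType) (s : sfam F (point G)) : fval F G :=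
  extend s G (span_id (point G)).

(** Up to covers, S is the span of U composed with the identity span, and the
    values there are related by naturality. *)
Lemma extend_point (G K : finGroupType) (s : sfam F (point G)) (U : biset K G)
   (S : span (point G) (point K)) : covers (biset_span U) S ->
  extend s K S = fmor F (burnside_class R U) (point_eval s).
Proof. by move=> c; apply: fam_biset c _; exact: span_comp1r. Qed.

Lemma point_eval_linear G : linear (@point_eval G).
Proof. by move=> a s t; rewrite /point_eval extendD extendZ. Qed.

HB.instance Definition _ G := GRing.isLinear.Build R (sfam F (point G)) (fval F G)
  *:%R (@point_eval G) (@point_eval_linear G).

Lemma point_eval_bij G : bijective (@point_eval G).
Proof.
exists (fun v => restrict (yoneda v)) => [s|v].
  apply: sfam_ext => K S; rewrite restrictK /=.
  by rewrite (extend_point s (cover_bisetP S)).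
rewrite /point_eval restrictK /= -[RHS]fmor_id; congr (fmor F _ v).
apply/burnside_class_iso/(covers_biset_unique (cover_bisetP _)).
exact: covers_biset_id.
Qed.

Lemma span_action_sfam (A B : cell0) (S : span A B) (s : sfam F A) :
  span_action (M := mackey_of_biset_functor F) S s = sfam_act S s.
Proof. exact: sfam_act_legs. Qed.

(** For a biset U both sides are the value of the family at the span of U: on
    the left U is composed with the identity span after it, on the right
    before it. *)
Lemma point_eval_nat (G H : finGroupType) (x : burnside R G H) s :
  point_eval (burnside_map (M := mackey_of_biset_functor F) x s) =
  fmor F x (point_eval s).
Proof.
elim/burnside_ind: x => [U|a x y IHx IHy].
  rewrite burnside_map_class; last exact: mackey_of_biset_functor_deflative.
  rewrite span_action_sfam {1}/point_eval extend_act.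
  apply: extend_point; exact: span_comp1l.
rewrite burnside_mapD ?burnside_mapZ; try exact: mackey_of_biset_functor_deflative.
rewrite [LHS]linearP /= IHx IHy; apply/esym; exact: Fl.
Qed.
End Yoneda.

(** * Every deflative Mackey functor consists of families *)

Section Unit.
Variable M : mackey R.
Hypothesis dM : deflative M.
Let F := biset_functor_of_mackey dM.

Program Definition action_family (A : cell0) (m : M A) : family F A :=
  @Family R F A (fun K S => span_action S m) _ _.
Next Obligation. by move=> A m K T S1 S2; exact: span_action_covers2. Qed.
Next Obligation.
by move=> A m K K' V S; rewrite /= (span_action_comp dM) /fmor /= burnside_map_class.
Qed.

Definition unit_map (A : cell0) (m : M A) : sfam F A := restrict (action_family m).

Lemma extend_unit (A : cell0) (m : M A) K (S : span A (point K)) :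
  extend (unit_map m) K S = span_action S m.
Proof. by rewrite restrictK. Qed.

Lemma unit_linear A : linear (@unit_map A).
Proof.
move=> a m n; apply: sfam_ext => K S.
rewrite [LHS]extend_unit [RHS]extendD [X in _ = X + _]extendZ span_action_linear.
by congr (_ *: _ + _); rewrite [RHS]extend_unit.
Qed.

HB.instance Definition _ A := GRing.isLinear.Build R (M A) (sfam F A)
  *:%R (@unit_map A) (@unit_linear A).

Lemma unit_pull (A B : cell0) (a : cell1 A B) m :
  unit_map (pull M a m) = sfam_act (span_pull a) (unit_map m).
Proof.
by apply: sfam_ext => K S; rewrite extend_act !extend_unit span_action_comp // span_action_pull.
Qed.

Lemma unit_push (A B : cell0) (a : cell1 A B) m :
  unit_map (push M a m) = sfam_act (span_push a) (unit_map m).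
Proof.
by apply: sfam_ext => K S; rewrite extend_act !extend_unit span_action_comp // span_action_push.
Qed.

Definition unit_hom : mackey_hom M (mackey_of_biset_functor F) :=
  @MackeyHom R M (mackey_of_biset_functor F) (fun A => @unit_map A : {linear _ -> _})
    unit_pull unit_push.

(** At a point, evaluation at the identity span is a left inverse of the unit,
    and it is itself bijective. *)
Lemma unit_bij A : bijective (unit_hom A).
Proof.
apply: mackey_hom_bijective => // [|G].
  exact: mackey_of_biset_functor_deflative.
have Fl : is_linear_functor F by exact: biset_functor_of_mackey_linear.
have [v sv vs] := point_eval_bij Fl G.
have E m : point_eval (unit_map m) = m by rewrite /point_eval extend_unit span_action_id.
exists (@point_eval F G) => [m|s]; first exact: E.
by rewrite -[RHS]sv -[in RHS](E G (point_eval s)) sv.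
Qed.
End Unit.

Program Definition counit (F : bisetF) :
    hom (functor_comp biset_functor_functor mackey_functor F) F :=
  @NatTrans (biset_cat R) (module_cat R)
    (sval (functor_comp biset_functor_functor mackey_functor F)) (sval F)
    (fun G => @point_eval (sval F) G : {linear _ -> _}) _.
Next Obligation.
move=> F G H x; apply: linear_ext => s; apply/esym.
exact: (point_eval_nat (svalP F)).
Qed.

Lemma counit_nat (F F' : bisetF) (t : hom F F') :
  compm (fmap (functor_id bisetF) t) (counit F) =
  compm (counit F')
    (fmap (functor_comp biset_functor_functor mackey_functor) t).
Proof.
by apply: nattransP => G; apply: linear_ext => s; rewrite /= /point_eval extend_map.
Qed.

Lemma counit_iso :
  nat_isomorphic (functor_comp biset_functor_functor mackey_functor)
                 (functor_id bisetF).
Proof.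
exists (@NatTrans bisetF bisetF (functor_comp biset_functor_functor mackey_functor)
  (functor_id bisetF) counit counit_nat) => F.
by apply: nattrans_iso => G; exact: (point_eval_bij (svalP F)).
Qed.

Definition unit_mor (M : mackeyD) :
    hom M (functor_comp mackey_functor biset_functor_functor M) :=
  unit_hom (svalP M).

Lemma unit_nat (M N : mackeyD) (f : hom M N) :
  compm (fmap (functor_comp mackey_functor biset_functor_functor) f)
    (unit_mor M) =
  compm (unit_mor N) (fmap (functor_id mackeyD) f).
Proof.
apply: mackey_hom_ext => A m; apply: sfam_ext => K S.
by rewrite /= extend_map !extend_unit; exact: span_action_hom.
Qed.

Lemma unit_iso :
  nat_isomorphic (functor_id mackeyD)
                 (functor_comp mackey_functor biset_functor_functor).
Proof.
exists (@NatTrans mackeyD mackeyD (functor_id mackeyD)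
  (functor_comp mackey_functor biset_functor_functor)
  unit_mor unit_nat) => M.
by apply: mackey_hom_iso => A; exact: unit_bij.
Qed.
End Functors.

Theorem theorem6p3p11 (R : comPzRingType) :
  equivalent (deflative_mackey_cat R) (biset_functor_cat R).
Proof.
exists (biset_functor_functor R), (mackey_functor R); split.
  exact/nat_isomorphic_sym/unit_iso.
exact: counit_iso.
Qed.
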